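(* Let $1\le p<\infty$, and let $T$ be a bounded linear operator on the Hardy space $H^p(\Pi)$. For $n=0,1,2,\ldots$ define $e_n\in H^p(\Pi)$ by $e_n(z)=\dfrac{(z-1)^n}{(z+1)^{\frac{2}{p}+n}}$. Then $T$ is a composition operator if and only if all of the following three conditions hold: (a) the function $F:=\dfrac{1}{(Te_0)^{\frac p2}}-1$ is well defined and belongs to $\mathrm{Hol}(\Pi)$; (b) the angular derivative $\angle\lim\limits_{z\to\infty}\dfrac{F(z)}{z}$ exists and is different from zero; (c) the operator $T$ satisfies $Te_n=Te_0\cdot\left(1-2\left(Te_0\right)^{\frac p2}\right)^n$ for all $n\in\mathbb{N}$. Moreover, if these conditions hold, then $T\phi=\phi\circ F$ for all $\phi\in H^p(\Pi)$.
   Context: $\Pi=\{z\in\mathbb{C}:\mathrm{Re}\,z>0\}$; $\mathrm{Hol}(\Pi,\mathbb{C})$ is the set of holomorphic functions on $\Pi$ with values in $\mathbb{C}$, and $\mathrm{Hol}(\Pi)$ is the set of holomorphic self-mappings of $\Pi$. The Hardy space is $$H^p(\Pi)=\Big\{\varphi\in\mathrm{Hol}(\Pi,\mathbb{C}):\ \|\varphi\|=\sup_{x>0}\Big(\frac1\pi\int_{-\infty}^{\infty}|\varphi(x+iy)|^p\,dy\Big)^{1/p}<\infty\Big\}.$$ An operator $T$ on $H^p(\Pi)$ is a composition operator if there is $G\in\mathrm{Hol}(\Pi)$ with $T\phi=\phi\circ G$ for all $\phi\in H^p(\Pi)$. $\angle\lim_{z\to\infty}$ denotes the angular (non-tangential)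 limit, i.e. the limit as $z\to\infty$ within every sector $\{|\arg z|<\beta\}$, $\beta<\frac{\pi}{2}$.
   Formalization: In (a), ''well defined'' is read as: Te_0 is nonzero with |Arg Te_0| < π and (p/2)|Arg Te_0| < π on Π (the branch inverse to the principal 2/p-power); with the plain principal power the claim fails, e.g. p = 8, T = i·Id. *)

(* Defs.v *)
From HB Require Import structures.
From mathcomp Require Import all_boot all_order all_algebra.
From mathcomp Require Import all_classical all_reals all_analysis.
From mathcomp Require Import complex.
Import Order.TTheory GRing.Theory Num.Theory.
Import numFieldNormedType.Exports.

Set Implicit Arguments.
Unset Strict Implicit.
Unset Printing Implicit Defensive.

Local Open Scope classical_set_scope.
Local Open Scope ring_scope.
Local Open Scope complex_scope.

Section HardyHalfPlane.
Context {R : realType}.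
Local Notation C := (R[i]).
Implicit Types (z w l : C) (p s x y : R) (f g phi psi F G : C -> C).

Definition cmod z : R := complex.Re `|z|.

(* Principal argument, with values in ]-pi, pi] (irrelevant value at 0). *)
Definition Arg z : R :=
  let t := acos (complex.Re z / cmod z) in
  if 0 <= complex.Im z then t else - t.

(* Principal branch of z^s = exp (s * Log z), for z != 0 and s real. *)
Definition cpow z s : C :=
  (cmod z `^ s * cos (s * Arg z)) +i* (cmod z `^ s * sin (s * Arg z)).

Definition Pi_plane : set C := [set z | 0 < complex.Re z].

(* Functions on Pi_plane are represented by total functions on C, whose
   values outside Pi_plane play no role. As Pi_plane is open, derivability over
   the field C at its points is holomorphy. *)
Definition Hol f : Prop := forall z, Pi_plane z -> derivable (f : C^o -> C^o) z 1.

Definition Hol_self G : Prop :=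
  Hol G /\ forall z, Pi_plane z -> Pi_plane (G z).

Definition hardy_norm p f : \bar R :=
  ereal_sup [set (((pi^-1)%:E *
      \int[lebesgue_measure]_(y in setT) (cmod (f (x +i* y)) `^ p)%:E)
      `^ p^-1)%E
    | x in [set x : R | 0 < x]].

Definition Hardy p f : Prop := Hol f /\ (hardy_norm p f < +oo)%E.

(* The second clause says that T acts on functions on Pi_plane, i.e. that T phi
   does not depend on how phi is extended outside Pi_plane. *)
Definition bounded_linear_operator p (T : (C -> C) -> (C -> C)) : Prop :=
  [/\ forall phi, Hardy p phi -> Hardy p (T phi),
      forall phi psi, Hardy p phi -> Hardy p psi ->
        {in Pi_plane, phi =1 psi} -> {in Pi_plane, T phi =1 T psi},
      forall (a b : C) phi psi, Hardy p phi -> Hardy p psi ->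
        {in Pi_plane, T (fun z => a * phi z + b * psi z)
                      =1 (fun z => a * T phi z + b * T psi z)}
    & exists M : R, forall phi, Hardy p phi ->
        (hardy_norm p (T phi) <= M%:E * hardy_norm p phi)%E].

Definition composition_operator p (T : (C -> C) -> (C -> C)) : Prop :=
  exists2 G, Hol_self G &
    forall phi, Hardy p phi -> {in Pi_plane, T phi =1 phi \o G}.

Definition e_ p (n : nat) : C -> C :=
  fun z => (z - 1) ^+ n / cpow (z + 1) (2 / p + n%:R).

(* Domain on which w^s is well defined as the inverse of the principal power
   v |-> v^(1/s) used in e_: the nonzero w such that both w and its continuation
   w^s avoid the cut ]-oo, 0], so that Log (w^s) = s * Log w and
   (w^s)^(1/s) = w. The bound on s * |Arg w| cannot be dropped: on the whole slit
   plane the principal power is not injective for s > 1, and for p >= 5 (with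
   s = p / 2) it does not tell T from c * T, where c = exp (4 * pi * i / p).
   E.g. for p = 8, T phi = i * phi is not a composition operator, but
   (T e_0)^4 = e_0^4 = 1 / (z + 1), so that F would be the identity. *)
Definition cpow_dom s : set C :=
  [set w | [/\ w != 0, `|Arg w| < pi & s * `|Arg w| < pi]].

Definition symbol p (u : C -> C) : C -> C := fun z => (cpow (u z) (p / 2))^-1 - 1.

Definition angular_lim f l : Prop :=
  forall beta : R, beta < pi / 2 -> forall eps : R, 0 < eps ->
    exists M : R, forall z, `|Arg z| < beta -> M < cmod z ->
      cmod (f z - l) < eps.

Definition condition_a p (T : (C -> C) -> (C -> C)) : Prop :=
  (forall z, Pi_plane z -> cpow_dom (p / 2) (T (e_ p 0) z)) /\
  Hol_self (symbol p (T (e_ p 0))).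

Definition condition_b p (T : (C -> C) -> (C -> C)) : Prop :=
  exists2 l : C, l != 0 & angular_lim (fun z => symbol p (T (e_ p 0)) z / z) l.

Definition condition_c p (T : (C -> C) -> (C -> C)) : Prop :=
  forall n : nat, {in Pi_plane, T (e_ p n) =1
    (fun z => T (e_ p 0) z * (1 - 2 * cpow (T (e_ p 0) z) (p / 2)) ^+ n)}.

End HardyHalfPlane.

(* Main.v *)
Require Import Defs.
From mathcomp Require Import all_boot all_order all_algebra.
From mathcomp Require Import all_classical all_reals all_analysis.
From mathcomp Require Import measurable_realfun complex.
From mathcomp Require Import ring lra.
Import Order.TTheory GRing.Theory Num.Theory.
Import numFieldNormedType.Exports.
Set Implicit Arguments.
Unset Strict Implicit.
Unset Printing Implicit Defensive.
Local Open Scope classical_set_scope.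
Local Open Scope ring_scope.
Local Open Scope complex_scope.
Local Notation Re := (@complex.Re _).
Local Notation Im := (@complex.Im _).

(** Let [w] be the Cayley coordinate [(z - 1) / (z + 1)], so that [e_n] is [w ^+ n]
    times [e_0]. If [T] is the composition with [G], then [T e_0] is a power of
    [G + 1] from which [G] can be recovered as the function [F] of condition (a),
    and (c) is the identity [(G - 1) / (G + 1) = 1 - 2 / (G + 1)]. Conversely, (a)
    and (c) say that [T e_n] is [e_n] composed with [F]. For fixed [z] the
    functionals [phi |-> T phi z] and [phi |-> phi (F z)] are continuous, by the
    growth estimate [point_bound] for Hardy functions, and the [e_n] are total in
    the Hardy space ([closed_total]); hence the functionals agree ([eval_total]).

    Totality is reduced to Taylor expansion on the disc. The main point is that a
    Hardy function [f] is the norm limit of its translates [f (z + d)]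
    ([shift_approx]). This is proved inside the half-plane. The integral of the
    [p]-th power of [|f|] over the line [Re z = x] is nonincreasing in [x], and so
    is that of the power [p / 2] of [|f g|], because a regularised square root of
    [|f g|] lies below its means over small circles ([product_nonincreasing]). So
    two means of [f] and a translate need only be compared on a single line, and
    if they are nearly as large as for [f] alone, the two functions are close by
    [uniform_convexity]. A translate is bounded; multiplied by [(K / (z + K)) ^+ 2]
    it corresponds to a bounded function on the disc, and the dilations of the
    latter have uniformly convergent Taylor series.

    For (b), testing [T] on powers of Cauchy kernels shows that [Re (G z) / Re z]
    is bounded below by a positive constant ([composition_Re_bound]). The
    Julia-Wolff-Caratheodory theorem then gives the angular derivative as the
    infimum of this quotient ([Julia_Caratheodory]).

    The complex analysis rests on integrals of real functions only: an estimate
    for a complex mean follows from one for the real part of a rotated mean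
    ([cmod_rot]). *)

(** * Complex numbers, holomorphy, exponential and powers *)

Section ComplexModulus.
Context {R : realType}.
Local Notation C := R[i].
Implicit Types (z w : C).

Lemma cmodE z : cmod z = Num.sqrt (Re z ^+ 2 + Im z ^+ 2).
Proof. by rewrite /cmod normc_def. Qed.

Lemma normc_cmod z : `|z| = (cmod z)%:C.
Proof. by rewrite cmodE normc_def. Qed.

Lemma cmod_ge0 z : 0 <= cmod z.
Proof. by rewrite cmodE sqrtr_ge0. Qed.
Hint Resolve cmod_ge0 : core.

Lemma cmodM z w : cmod (z * w) = cmod z * cmod w.
Proof. by apply: complexI; rewrite rmorphM/= -!normc_cmod normrM. Qed.

Lemma cmodN z : cmod (- z) = cmod z.
Proof. by apply: complexI; rewrite -!normc_cmod normrN. Qed.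

Lemma cmodB z w : cmod (z - w) = cmod (w - z).
Proof. by rewrite -cmodN opprB. Qed.

Lemma cmodD z w : cmod (z + w) <= cmod z + cmod w.
Proof. by rewrite -lecR rmorphD/= -!normc_cmod ler_normD. Qed.

Lemma cmodBD z w u : cmod (z - w) <= cmod (z - u) + cmod (u - w).
Proof. by rewrite (le_trans _ (cmodD _ _))// addrA subrK. Qed.

Lemma cmodX z n : cmod (z ^+ n) = cmod z ^+ n.
Proof. by apply: complexI; rewrite rmorphXn/= -!normc_cmod normrX. Qed.

Lemma cmodV z : cmod z^-1 = (cmod z)^-1.
Proof. by apply: complexI; rewrite fmorphV -!normc_cmod normfV. Qed.

Lemma cmod0 : cmod (0 : C) = 0.
Proof. by apply: complexI; rewrite -!normc_cmod normr0. Qed.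

Lemma cmod1 : cmod (1 : C) = 1.
Proof. by apply: complexI; rewrite -!normc_cmod normr1. Qed.

Lemma cmod_eq0 z : (cmod z == 0) = (z == 0).
Proof. by rewrite -[RHS]normr_eq0 normc_cmod -(inj_eq (@complexI R)). Qed.

Lemma cmod_gt0 z : (0 < cmod z) = (z != 0).
Proof. by rewrite lt_neqAle cmod_ge0 andbT eq_sym cmod_eq0. Qed.

Lemma cmod_real (x : R) : cmod x%:C = `|x|.
Proof. by rewrite cmodE/= expr0n/= addr0 sqrtr_sqr. Qed.

Lemma cmod_sqr z : cmod z ^+ 2 = Re z ^+ 2 + Im z ^+ 2.
Proof. by rewrite cmodE sqr_sqrtr// addr_ge0// sqr_ge0. Qed.

Lemma normRe_cmod z : `|Re z| <= cmod z.
Proof.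
by rewrite -ler_sqr ?nnegrE// real_normK ?num_real// cmod_sqr lerDl sqr_ge0.
Qed.

Lemma normIm_cmod z : `|Im z| <= cmod z.
Proof.
by rewrite -ler_sqr ?nnegrE// real_normK ?num_real// cmod_sqr lerDr sqr_ge0.
Qed.

Lemma normIm_ltcmod z : 0 < Re z -> `|Im z| < cmod z.
Proof.
move=> z0; rewrite -(ltr_pXn2r (n := 2)) ?nnegrE//.
by rewrite real_normK ?num_real// cmod_sqr ltrDr exprn_gt0.
Qed.

Lemma Re_cmod z : Re z <= cmod z.
Proof. exact: le_trans (ler_norm _) (normRe_cmod _). Qed.

Lemma cmod_le_ReIm z : cmod z <= `|Re z| + `|Im z|.
Proof.
rewrite -ler_sqr ?nnegrE ?addr_ge0// cmod_sqr sqrrD !real_normK ?num_real//.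
by rewrite -addrA [X in _ <= _ + X]addrC addrA lerDl mulrn_wge0// mulr_ge0.
Qed.

Lemma cmodJ z : cmod (conjc z) = cmod z.
Proof. by case: z => a b; rewrite !cmodE/= sqrrN. Qed.

Lemma cmod_triangle z w : `|cmod z - cmod w| <= cmod (z - w).
Proof.
rewrite ler_norml; apply/andP; split.
  by have := cmodD (w - z) z; rewrite subrK cmodB; lra.
by have := cmodD (z - w) w; rewrite subrK; lra.
Qed.

Lemma reD z w : Re (z + w) = Re z + Re w. Proof. by case: z w => [a b] []. Qed.
Lemma imD z w : Im (z + w) = Im z + Im w. Proof. by case: z w => [a b] []. Qed.
Lemma reN z : Re (- z) = - Re z. Proof. by case: z. Qed.
Lemma imN z : Im (- z) = - Im z. Proof. by case: z. Qed.
Lemma reM z w : Re (z * w) = Re z * Re w - Im z * Im w.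
Proof. by case: z w => [a b] []. Qed.
Lemma imM z w : Im (z * w) = Re z * Im w + Im z * Re w.
Proof. by case: z w => [a b] []. Qed.
Lemma complex_ext z w : Re z = Re w -> Im z = Im w -> z = w.
Proof. by case: z w => [a b] [c d] /= -> ->. Qed.

(** The modulus is attained as the real part of a rotation: this reduces every
    estimate on a complex-valued mean to one on a real-valued mean. *)
Lemma cmod_rot z : exists2 u : C, cmod u = 1 & Re (u * z) = cmod z.
Proof.
have [->|z0] := eqVneq z 0; first by exists 1; rewrite ?cmod1// mulr0 cmod0.
exists ((cmod z)^-1%:C * (conjc z)).
  by rewrite cmodM cmod_real cmodJ ger0_norm ?invr_ge0// mulVf// cmod_eq0.
have -> : (cmod z)^-1%:C * (conjc z) * z = (cmod z)%:C.
  rewrite -mulrA [_ * z]mulrC -sqr_normc normc_cmod -rmorphXn -rmorphM/=.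
  by congr (_%:C); rewrite expr2 mulrA mulVf ?mul1r// cmod_eq0.
by [].
Qed.

End ComplexModulus.
#[global] Hint Extern 0 (is_true (@Order.le _ _ _ (@cmod _ _))) =>
  (solve [apply: cmod_ge0]) : core.

Section ComplexTopology.
Context {R : realType}.
Local Notation C := R[i].
Implicit Types (z w : C) (f g : C -> C).

Lemma nbhsC z (A : set C) : nbhs (z : C^o) A <->
  exists2 e : R, 0 < e & forall w, cmod (w - z) < e -> A w.
Proof.
split.
  move=> /nbhs_ballP[[a b]/=]; rewrite ltcE/= => /andP[/eqP -> a0] H.
  exists a => // w wz; apply: H.
  by rewrite -ball_normE /ball_/= distrC normc_cmod ltcR.
move=> [e e0 H]; apply/nbhs_ballP; exists e%:C => /=; first by rewrite ltcR.
move=> w; rewrite -ball_normE /ball_/= distrC normc_cmod ltcR.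
exact: H.
Qed.

Lemma cvgC (T : Type) (F : set_system T) {FF : Filter F} (f : T -> C) z :
  (f @ F --> (z : C^o)) <->
  (forall e : R, 0 < e -> \forall t \near F, cmod (f t - z) < e).
Proof.
split=> [H e e0|H].
  have /(_ e%:C) := (@cvgrPdist_lt C C^o T F FF f z).1 H.
  rewrite ltcR => /(_ e0); apply: filterS => t.
  by rewrite distrC normc_cmod ltcR.
apply/(@cvgrPdist_lt C C^o T F FF f z) => -[a b]; rewrite ltcE/= => /andP[/eqP -> a0].
move: (H _ a0); apply: filterS => t.
by rewrite distrC normc_cmod ltcR.
Qed.

Lemma cvgC_Re (T : Type) (F : set_system T) {FF : Filter F} (f : T -> C) z :
  f @ F --> (z : C^o) -> (fun t => Re (f t)) @ F --> Re z.
Proof.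
move=> /cvgC H; apply/cvgrPdist_lt => e /H; apply: filterS => t.
by apply: le_lt_trans; rewrite distrC -reN -reD normRe_cmod.
Qed.

Lemma cvgC_Im (T : Type) (F : set_system T) {FF : Filter F} (f : T -> C) z :
  f @ F --> (z : C^o) -> (fun t => Im (f t)) @ F --> Im z.
Proof.
move=> /cvgC H; apply/cvgrPdist_lt => e /H; apply: filterS => t.
by apply: le_lt_trans; rewrite distrC -imN -imD normIm_cmod.
Qed.

Lemma cvgC_cmod (T : Type) (F : set_system T) {FF : Filter F} (f : T -> C) z :
  f @ F --> (z : C^o) -> (fun t => cmod (f t)) @ F --> cmod z.
Proof.
move=> /cvgC H; apply/cvgrPdist_lt => e /H; apply: filterS => t.
by apply: le_lt_trans; rewrite distrC cmod_triangle.
Qed.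

Lemma cvgC_conj (T : Type) (F : set_system T) {FF : Filter F} (f : T -> C) z :
  f @ F --> (z : C^o) -> (fun t => conjc (f t)) @ F --> (conjc z : C^o).
Proof.
move=> /cvgC H; apply/cvgC => e /H; apply: filterS => t.
by rewrite -rmorphB/= cmodJ.
Qed.

Lemma cvgC_pair (T : Type) (F : set_system T) {FF : Filter F} (a b : T -> R)
    (x y : R) :
  a @ F --> x -> b @ F --> y -> (fun t => a t +i* b t) @ F --> (x +i* y : C^o).
Proof.
move=> ax bY; apply/cvgC => e e0.
have e2 : 0 < e / 2 by rewrite divr_gt0.
move/cvgrPdist_lt: ax => /(_ _ e2) ax; move/cvgrPdist_lt: bY => /(_ _ e2) bY.
near=> t; apply: le_lt_trans (cmod_le_ReIm _) _; rewrite /= (splitr e).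
by apply: ltrD; rewrite distrC; near: t.
Unshelve. all: by end_near. Qed.

(** Made opaque once its calculus is established: unfolding it would expose the
    topology of [C] to unification. *)
Definition hol f z : Prop := derivable (f : C^o -> C^o) z 1.

(** The form of differentiability that Goursat's argument and Cauchy's formula
    use. *)
Lemma hol_eps f z : hol f z <->
  exists l : C, forall e : R, 0 < e -> exists2 d : R, 0 < d &
    forall w, cmod (w - z) < d ->
      cmod (f w - f z - l * (w - z)) <= e * cmod (w - z).
Proof.
split.
  rewrite /hol => /cvg_ex[/= l]; rewrite /dnbhs => /cvgC H.
  exists l => e e0; have [d /= d0 Hd] := (nbhsC _ _).1 (H _ e0).
  exists d => // w wd.
  have [->|wz] := eqVneq w z; first by rewrite !subrr mulr0 subrr cmod0 mulr0.
  have wz0 : w - z != 0 by rewrite subr_eq0.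
  have := Hd (w - z); rewrite subr0 => /(_ wd wz0).
  rewrite /= /GRing.scale/= mulr1 subrK => /ltW.
  rewrite -(ler_pM2r (x := cmod (w - z))) ?cmod_gt0// -cmodM mulrBl.
  by rewrite mulrAC mulVf// mul1r.
move=> [l H]; rewrite /hol; apply/cvg_ex; exists (l : C^o) => /=; apply/cvgC => e e0.
have e2 : 0 < e / 2 by rewrite divr_gt0.
have [d d0 Hd] := H _ e2.
apply/(nbhsC 0 _); exists d => // h; rewrite subr0 => hd h0.
have := Hd (h + z); rewrite addrK => /(_ hd).
rewrite /= /GRing.scale/= mulr1 => H1.
have -> : h^-1 * (f (h + z) - f z) - l = h^-1 * (f (h + z) - f z - l * h).
  by rewrite [in RHS]mulrBr (mulrC l) mulKf.
rewrite cmodM cmodV mulrC ltr_pdivrMr ?cmod_gt0//.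
apply: le_lt_trans H1 _; rewrite ltr_pM2r ?cmod_gt0//.
by lra.
Qed.

End ComplexTopology.

Section ComplexDerivative.
Context {R : realType}.
Local Notation C := R[i].
Implicit Types (f g : C -> C) (c z w : C).

Lemma hol_cst c z : hol (fun=> c) z.
Proof. exact: derivable_cst. Qed.

Lemma hol_id z : hol (fun z => z) z.
Proof. exact: derivable_id. Qed.

Lemma holD f g z : hol f z -> hol g z -> hol (fun z => f z + g z) z.
Proof. exact: derivableD. Qed.

Lemma holB f g z : hol f z -> hol g z -> hol (fun z => f z - g z) z.
Proof. exact: derivableB. Qed.

Lemma holM f g z : hol f z -> hol g z -> hol (fun z => f z * g z) z.
Proof. exact: derivableM. Qed.

Lemma holV f z : f z != 0 -> hol f z -> hol (fun z => (f z)^-1) z.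
Proof. exact: derivableV. Qed.

Lemma hol_div f g z : g z != 0 -> hol f z -> hol g z ->
  hol (fun z => f z / g z) z.
Proof. by move=> gz hf hg; exact: (holM hf (holV gz hg)). Qed.

Lemma holX f n z : hol f z -> hol (fun z => f z ^+ n) z.
Proof.
move=> hf; elim: n => [|n IH].
  by under eq_fun do rewrite expr0; exact: hol_cst.
by under eq_fun do rewrite exprS; exact: holM.
Qed.

Lemma hol_comp f g z : hol f z -> hol g (f z) -> hol (fun z => g (f z)) z.
Proof.
rewrite /hol => /derivable1_diffP hf /derivable1_diffP hg.
apply/derivable1_diffP.
exact: (differentiable_comp hf hg).
Qed.

Lemma hol_sub c z : hol (fun z => z - c) z.
Proof. by apply: holB; [exact: hol_id|exact: hol_cst]. Qed.

Lemma hol_add c z : hol (fun z => z + c) z.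
Proof. by apply: holD; [exact: hol_id|exact: hol_cst]. Qed.

Lemma hol_continuous f z : hol f z -> {for z, continuous (f : C^o -> C^o)}.
Proof. by move=> /derivable1_diffP; exact: differentiable_continuous. Qed.

Lemma eq_near_hol f g z : (\forall w \near (z : C^o), f w = g w) ->
  hol f z -> hol g z.
Proof. by move=> fg hf; apply: (near_eq_derivable _ hf). Qed.

Lemma HolP f : Hol f <-> forall z, Pi_plane z -> hol f z.
Proof. by []. Qed.

End ComplexDerivative.
#[global] Opaque hol.
Arguments hol_cst {R} c z.
Arguments hol_id {R} z.
Arguments hol_sub {R} c z.
Arguments hol_add {R} c z.

Section ComplexExponential.
Context {R : realType}.
Local Notation C := R[i].
Implicit Types (z w : C) (x y t s : R).

Lemma is_derive_eps (f : R -> R) x l : is_derive x 1 f l ->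
  forall e : R, 0 < e -> exists2 d : R, 0 < d &
    forall h, `|h| < d -> `|f (h + x) - f x - l * h| <= e * `|h|.
Proof.
move=> [df dl] e e0; move: df => /cvg_ex[/= l' Hl].
have ll : l' = l by rewrite -dl; apply/esym/cvg_lim.
subst l'; move/cvgrPdist_lt: Hl => /(_ _ e0)/= /nbhs_ballP[d /= d0 Hd].
exists d => // h hd; have [->|h0] := eqVneq h 0.
  by rewrite add0r subrr mulr0 subr0 normr0 mulr0.
have := Hd h; rewrite /ball/= sub0r normrN => /(_ hd h0).
rewrite /GRing.scale/= mulr1 distrC => /ltW.
rewrite -(ler_pM2r (x := `|h|)) ?normr_gt0// -normrM mulrBl.
by rewrite mulrAC mulVf// mul1r.
Qed.

Definition expc z : C := (expR (Re z) * cos (Im z)) +i* (expR (Re z) * sin (Im z)).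

Lemma expcD z w : expc (z + w) = expc z * expc w.
Proof.
by apply: complex_ext; rewrite ?reM ?imM /expc/= !reD !imD expRD ?cosD ?sinD; ring.
Qed.

Lemma expc0 : expc 0 = 1.
Proof. by apply: complex_ext; rewrite /expc/= expR0 ?cos0 ?sin0 mul1r. Qed.

Lemma cmod_polar x t : 0 <= x -> cmod ((x * cos t) +i* (x * sin t)) = x.
Proof.
move=> x0; rewrite cmodE/= !exprMn -mulrDr cos2Dsin2 mulr1 sqrtr_sqr.
by rewrite ger0_norm.
Qed.

Lemma cmod_expc z : cmod (expc z) = expR (Re z).
Proof. by rewrite /expc cmod_polar// expR_ge0. Qed.

Lemma expc_neq0 z : expc z != 0.
Proof. by rewrite -cmod_eq0 cmod_expc gt_eqF// expR_gt0. Qed.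

Lemma expcN z : expc (- z) = (expc z)^-1.
Proof.
apply: (mulfI (expc_neq0 z)).
by rewrite -expcD subrr expc0 divff// expc_neq0.
Qed.

Lemma expc_eps (e : R) : 0 < e -> exists2 d : R, 0 < d &
  forall h, cmod h < d -> cmod (expc h - 1 - h) <= e * cmod h.
Proof.
move=> e0; pose k : R := Order.min 1 (e / 8).
have k0 : 0 < k by rewrite lt_min ltr01 divr_gt0.
have k1 : k <= 1 by rewrite /k ge_min lexx.
have ke : k <= e / 8 by rewrite /k ge_min lexx orbT.
have [d1 d10 H1] := is_derive_eps (is_derive_expR (0 : R)) k0.
have [d2 d20 H2] := is_derive_eps (is_derive_cos (0 : R)) k0.
have [d3 d30 H3] := is_derive_eps (is_derive_sin (0 : R)) k0.
exists (Order.min (Order.min d1 d2) (Order.min d3 (k / 2))).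
  by rewrite !lt_min d10 d20 d30 divr_gt0.
move=> [x y]; rewrite !lt_min => /andP[/andP[h1 h2] /andP[h3 h4]].
have xh := normRe_cmod (x +i* y); have yh := normIm_cmod (x +i* y).
rewrite /= in xh yh.
set m := cmod (x +i* y) in h1 h2 h3 h4 xh yh *.
have m0 : 0 <= m by exact: cmod_ge0.
have {H1} := H1 x (le_lt_trans xh h1); have {H2} := H2 y (le_lt_trans yh h2).
have {H3} := H3 y (le_lt_trans yh h3).
rewrite !addr0 sin0 cos0 expR0 oppr0 mul0r !subr0 !mul1r !addr0 => H3 H2 H1.
have kx : k * `|x| <= k * m by rewrite ler_pM2l.
have ky : k * `|y| <= k * m by rewrite ler_pM2l.
apply: le_trans (cmod_le_ReIm _) _; rewrite !reD !imD !reN !imN /=.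
have -> : expR x * cos y - 1 - x =
  (expR x - 1 - x) * cos y + (1 + x) * (cos y - 1) by ring.
have -> : expR x * sin y - 0 - y = (expR x - 1) * sin y + (sin y - y) by ring.
have A1 : `|(expR x - 1 - x) * cos y| <= k * m.
  rewrite normrM -[k * m]mulr1 ler_pM// ?cos_max//; exact: le_trans kx.
have A2 : `|(1 + x) * (cos y - 1)| <= 2 * (k * m).
  rewrite normrM ler_pM//; last exact: le_trans ky.
  by apply: le_trans (ler_normD _ _) _; rewrite normr1; lra.
have A3 : `|(expR x - 1) * sin y| <= k * m * 2.
  have X1 : `|expR x - 1| <= 2 * m.
    rewrite -(subrK x (expR x - 1)); apply: le_trans (ler_normD _ _) _.
    have : k * `|x| <= 1 * m by rewrite ler_pM// ltW.
    by lra.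
  have X2 : `|sin y| <= k.
    rewrite -(subrK y (sin y)); apply: le_trans (ler_normD _ _) _.
    have : k * `|y| <= 1 * m by rewrite ler_pM// ltW.
    by lra.
  by rewrite normrM [k * m]mulrC -mulrA [k * 2]mulrC mulrA [m * 2]mulrC ler_pM.
have A4 : `|sin y - y| <= k * m by exact: le_trans ky.
have km : k * m <= e / 8 * m by rewrite ler_wpM2r.
apply: le_trans (lerD (ler_normD _ _) (ler_normD _ _)) _.
by have := mulr_ge0 (ltW e0) m0; lra.
Qed.

Lemma expc_derive_eps z (e : R) : 0 < e -> exists2 d : R, 0 < d &
  forall w, cmod (w - z) < d ->
    cmod (expc w - expc z - expc z * (w - z)) <= e * cmod (w - z).
Proof.
move=> e0.
have z0 : 0 < cmod (expc z) by rewrite cmod_gt0 expc_neq0.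
have [d d0 H] := expc_eps (divr_gt0 e0 z0).
exists d => // w /H; rewrite -(ler_pM2l z0) -cmodM.
have -> : expc z * (expc (w - z) - 1 - (w - z)) =
  expc w - expc z - expc z * (w - z).
  have -> : expc w = expc z * expc (w - z) by rewrite -expcD addrC subrK.
  by rewrite !mulrBr mulr1.
by rewrite mulrA mulrCA divff ?mulr1 ?gt_eqF//.
Qed.

Lemma hol_expc z : hol expc z.
Proof.
apply/hol_eps; exists (expc z) => e; exact: expc_derive_eps.
Qed.

Lemma divRe_cmod z : -1 <= Re z / cmod z <= 1.
Proof.
rewrite -ler_norml normrM normfV (ger0_norm (cmod_ge0 z)).
have [->|z0] := eqVneq (cmod z) 0; first by rewrite invr0 mulr0 ler01.
rewrite ler_pdivrMr ?mul1r ?normRe_cmod//.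
by rewrite lt_neqAle eq_sym z0 cmod_ge0.
Qed.

Lemma cmod_cos_Arg z : z != 0 -> cmod z * cos (Arg z) = Re z.
Proof.
rewrite -cmod_eq0 => z0; rewrite /Arg.
have -> : forall b : bool, cos (if b then acos (Re z / cmod z)
  else - acos (Re z / cmod z)) = Re z / cmod z.
  by case; rewrite ?cosN acosK// in_itv/= divRe_cmod.
by rewrite mulrCA divff// mulr1.
Qed.

Lemma cmod_sin_Arg z : z != 0 -> cmod z * sin (Arg z) = Im z.
Proof.
rewrite -cmod_eq0 => z0; rewrite /Arg.
have E : cmod z * Num.sqrt (1 - (Re z / cmod z) ^+ 2) = `|Im z|.
  rewrite -[X in X * _](ger0_norm (cmod_ge0 z)) -sqrtr_sqr -sqrtrM ?sqr_ge0//.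
  rewrite mulrBr mulr1 -exprMn mulrCA divff// mulr1 cmod_sqr addrAC subrr add0r.
  by rewrite sqrtr_sqr.
case: ifPn => [I0|]; first by rewrite sin_acos ?divRe_cmod// E ger0_norm.
rewrite -ltNge => I0.
by rewrite sinN sin_acos ?divRe_cmod// mulrN E ltr0_norm// opprK.
Qed.

Lemma polarE z : z != 0 ->
  z = (cmod z * cos (Arg z)) +i* (cmod z * sin (Arg z)).
Proof. by move=> z0; apply: complex_ext; rewrite /= ?cmod_cos_Arg ?cmod_sin_Arg. Qed.

Lemma Arg_polar x t : 0 < x -> - pi < t < pi ->
  Arg ((x * cos t) +i* (x * sin t)) = t.
Proof.
move=> x0 /andP[t1 t2]; rewrite /Arg (cmod_polar _ (ltW x0))/=.
have -> : x * cos t / x = cos t by rewrite mulrAC divff ?gt_eqF// mul1r.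
rewrite (pmulr_rge0 _ x0).
have [t0|t0] := leP 0 t.
  by rewrite sin_ge0_pi ?t0 ?ltW// cosK// in_itv/= t0 ltW.
rewrite ifN ?cosKN ?opprK ?(ltW t0) ?(ltW t1)//.
rewrite -ltNge -oppr_gt0 -sinN sin_gt0_pi//; lra.
Qed.

(** Unlike the definition of [Arg] by cases, the arcsine makes continuity on the
    half-plane visible. *)
Lemma Arg_Re_gt0 z : 0 < Re z -> Arg z = asin (Im z / cmod z).
Proof.
move=> z0; have m0 : 0 < cmod z by apply: lt_le_trans (Re_cmod z).
have m1 : cmod z != 0 by rewrite gt_eqF.
have I1 : -1 <= Im z / cmod z <= 1.
  rewrite -ler_norml normrM normfV (ger0_norm (cmod_ge0 z)).
  by rewrite ler_pdivrMr ?mul1r ?normIm_cmod.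
rewrite -[in LHS](@complex_ext _ ((cmod z * cos (asin (Im z / cmod z)))
   +i* (cmod z * sin (asin (Im z / cmod z)))) z).
- rewrite Arg_polar//; apply/andP; split.
    by apply: lt_le_trans (asin_geNpi2 I1); have := pi_gt0 R; lra.
  by apply: le_lt_trans (asin_lepi2 I1) _; have := pi_gt0 R; lra.
- rewrite /= cos_asin// -[X in X * _](ger0_norm (cmod_ge0 z)) -sqrtr_sqr.
  rewrite -sqrtrM ?sqr_ge0// mulrBr mulr1 -exprMn mulrCA divff// mulr1.
  by rewrite cmod_sqr addrK sqrtr_sqr gtr0_norm.
- by rewrite /= asinK ?in_itv//= mulrCA divff// mulr1.
Qed.

Lemma Im_div_cmod z : 0 < Re z -> -1 < Im z / cmod z < 1.
Proof.
move=> z0; have m0 : 0 < cmod z by apply: lt_le_trans (Re_cmod z).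
rewrite -ltr_norml normrM normfV (ger0_norm (cmod_ge0 z)).
by rewrite ltr_pdivrMr// mul1r normIm_ltcmod.
Qed.

Lemma Arg_bound z : 0 < Re z -> - (pi / 2) < Arg z < pi / 2.
Proof.
move=> z0; have m0 : 0 < cmod z by apply: lt_le_trans (Re_cmod z).
have /andP[a b] := Im_div_cmod z0.
by rewrite Arg_Re_gt0// asin_gtNpi2 ?asin_ltpi2 ?a ?b ?(ltW a) ?(ltW b).
Qed.

Lemma sector_Re (beta : R) z : `|Arg z| < beta -> beta < pi / 2 ->
  0 < cos beta /\ cos beta * cmod z <= Re z /\ z != 0.
Proof.
move=> zb b2; have b0 : 0 < beta by apply: le_lt_trans zb.
have p0 := pi_gt0 R.
have z0 : z != 0.
  apply: contraTneq zb => ->; rewrite -leNgt /Arg/= lexx mul0r acos0.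
  by rewrite ger0_norm; [exact: ltW | lra].
split; first by apply: cos_gt0_pihalf; lra.
split=> //; rewrite -(cmod_cos_Arg z0) mulrC ler_wpM2l//.
rewrite -(cos_norm (Arg z)) ltW// ltr_cos// in_itv/=; apply/andP; split=> //; lra.
Qed.

Definition logc z : C := ln (cmod z) +i* Arg z.

Lemma logcK z : z != 0 -> expc (logc z) = z.
Proof.
move=> z0; rewrite /expc/= lnK ?posrE ?cmod_gt0//.
by rewrite -polarE.
Qed.

Lemma cpowE z s : z != 0 -> cpow z s = expc (s%:C * logc z).
Proof.
move=> z0; rewrite /expc /cpow reM imM/= !mul0r subr0 addr0.
by rewrite -[s * ln _]ln_powR lnK// posrE powR_gt0 ?cmod_gt0.
Qed.

Lemma continuous_logc z : 0 < Re z -> {for z, continuous (logc : C^o -> C^o)}.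
Proof.
move=> z0; have m0 : 0 < cmod z by apply: lt_le_trans (Re_cmod z).
pose F : set_system C := nbhs (z : C^o).
have FF : Filter F := nbhs_filter (z : C^o).
have zz : (fun w : C => w) @ F --> (z : C^o) by exact: cvg_id.
have mz : (fun w : C => cmod w) @ F --> cmod z by exact: cvgC_cmod.
suff : (fun w => ln (cmod w) +i* Arg w) @ F --> (ln (cmod z) +i* Arg z : C^o).
  by [].
apply: cvgC_pair; first exact: (cvg_comp _ _ mz (@continuous_ln R _ m0)).
rewrite Arg_Re_gt0//.
have N : \forall w \near F, 0 < Re w.
  apply/nbhsC; exists (Re z) => // w wz.
  have := normRe_cmod (w - z); rewrite reD reN => /le_lt_trans/(_ wz).
  by rewrite ltr_norml; lra.
have E : \forall w \near F, asin (Im w / cmod w) = Arg w.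
  by apply: filterS N => w w0; rewrite Arg_Re_gt0.
apply: cvg_trans; first exact: (near_eq_cvg E).
have Q : (fun w => Im w / cmod w) @ F --> Im z / cmod z.
  apply: cvgM; first exact: cvgC_Im.
  by apply: cvgV => //; rewrite gt_eqF.
exact: (cvg_comp _ _ Q (@continuous_asin R _ (Im_div_cmod z0))).
Qed.

(** The logarithm is a continuous inverse of the exponential, so its difference
    quotient is the inverse of that of the exponential. *)
Lemma hol_logc z : 0 < Re z -> hol logc z.
Proof.
move=> z0; have m0 : 0 < cmod z by apply: lt_le_trans (Re_cmod z).
have zn : z != 0 by rewrite -cmod_gt0.
apply/hol_eps; exists z^-1 => e e0.
pose m := cmod z; pose k : R := Order.min (m / 2) (e * m ^+ 2 / 2).
have k0 : 0 < k by rewrite lt_min !divr_gt0// mulr_gt0// exprn_gt0.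
have km : k <= m / 2 by rewrite /k ge_min lexx.
have ke : k <= e * m ^+ 2 / 2 by rewrite /k ge_min lexx orbT.
have [d d0 Hd] := expc_derive_eps (logc z) k0.
have /cvgC/(_ _ d0)/nbhsC[r r0 Hr] := continuous_logc z0.
exists (Order.min r m); first by rewrite lt_min r0.
move=> w; rewrite lt_min => /andP[/Hr wr wm].
have wn : w != 0.
  by apply: contraTneq wm => ->; rewrite sub0r cmodN -leNgt.
have := Hd _ wr; rewrite !logcK//.
set u := logc w - logc z => H.
have B : m * cmod u <= 2 * cmod (w - z).
  have : cmod (z * u) <= cmod (w - z) + k * cmod u.
    rewrite -(subrK (w - z) (z * u)) addrC; apply: le_trans (cmodD _ _) _.
    by rewrite lerD2l cmodB.
  rewrite cmodM -/m; have : k * cmod u <= m / 2 * cmod u by rewrite ler_wpM2r.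
  by lra.
have -> : u - z^-1 * (w - z) = - (z^-1 * (w - z - z * u)).
  by rewrite [in RHS]mulrBr mulKf// opprB.
rewrite cmodN cmodM cmodV mulrC -/m ler_pdivrMr// (le_trans H)//.
rewrite -(ler_pM2l m0) -/m mulrCA.
apply: le_trans (ler_wpM2l (ltW k0) B) _.
have := ler_wpM2r (cmod_ge0 (w - z)) ke; rewrite -/m; lra.
Qed.

Lemma hol_cpow z s : 0 < Re z ->
  hol (fun w => cpow w s) z.
Proof.
move=> z0; have m0 : 0 < cmod z by apply: lt_le_trans (Re_cmod z).
have zn : z != 0 by rewrite -cmod_gt0.
apply: (@eq_near_hol _ (fun w => expc (s%:C * logc w))).
  apply/nbhsC; exists (cmod z) => // w wz; rewrite cpowE//.
  by apply: contraTneq wz => ->; rewrite sub0r cmodN -leNgt.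
apply: hol_comp; last exact: hol_expc.
exact: (holM (hol_cst _ _) (hol_logc z0)).
Qed.

Lemma cpowD z s t : z != 0 -> cpow z (s + t) = cpow z s * cpow z t.
Proof. by move=> z0; rewrite !cpowE// rmorphD mulrDl expcD. Qed.

Lemma cmod_cpow z s : cmod (cpow z s) = cmod z `^ s.
Proof. by rewrite /cpow cmod_polar// powR_ge0. Qed.

Lemma cpow_neq0 z s : z != 0 -> cpow z s != 0.
Proof. by move=> z0; rewrite cpowE// expc_neq0. Qed.

Lemma cpow_nat z n : z != 0 -> cpow z n%:R = z ^+ n.
Proof.
move=> z0; elim: n => [|n IH].
  by rewrite cpowE// mul0r expc0 expr0.
rewrite -addn1 natrD cpowD// IH exprD; congr (_ * _).
by rewrite cpowE// mul1r logcK.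
Qed.

Lemma Arg_cpow z s : z != 0 -> `|s * Arg z| < pi -> Arg (cpow z s) = s * Arg z.
Proof.
move=> z0; rewrite ltr_norml => /andP[a b].
by rewrite /cpow Arg_polar ?powR_gt0 ?cmod_gt0 ?a.
Qed.

(** The bound keeps [s * Log z] in the strip on which [Log] inverts the
    exponential. *)
Lemma cpow_cpow z s t : z != 0 -> `|s * Arg z| < pi ->
  cpow (cpow z s) t = cpow z (s * t).
Proof.
move=> z0 h; have A := Arg_cpow z0 h; have M := cmod_cpow z s.
move: (cpow z s) A M => w A M.
by rewrite /cpow A M -powRrM !mulrA (mulrC t s).
Qed.

Lemma cpowV z s : z != 0 -> (cpow z s)^-1 = cpow z (- s).
Proof. by move=> z0; rewrite !cpowE// -expcN rmorphN mulNr. Qed.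

End ComplexExponential.

(** * Goursat's theorem *)

Section SegmentIntegrals.
Context {R : realType}.
Local Notation mu := (@lebesgue_measure R).
Implicit Types (f g : R -> R) (a b c d x y : R).

Definition Iseg a b f : R := \int[mu]_(x in `[a, b]) f x.

(** Two-sided continuity also at the end points: every integrand below is
    defined near its segment. *)
Definition contin a b f := forall x, a <= x <= b -> {for x, continuous f}.

Lemma contin_integrable a b f : contin a b f ->
  mu.-integrable `[a, b] (EFin \o f).
Proof.
move=> cf; apply: continuous_compact_integrable; first exact: segment_compact.
apply: continuous_in_subspaceT => x; rewrite inE/= in_itv/=; exact: cf.
Qed.

Lemma sub_contin a b c d f : a <= c -> d <= b -> contin a b f -> contin c d f.
Proof.
move=> ac db H x /andP[cx xd]; apply: H.
by rewrite (le_trans ac)// (le_trans xd).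
Qed.

Lemma continB a b f g : contin a b f -> contin a b g ->
  contin a b (fun x => f x - g x).
Proof. by move=> cf cg x xab; apply: cvgB; [exact: cf|exact: cg]. Qed.

Lemma contin_cst a b (k : R) : contin a b (fun=> k).
Proof. by move=> x _; exact: cvg_cst. Qed.

Lemma IsegD a b f g : contin a b f -> contin a b g ->
  Iseg a b (fun x => f x + g x) = Iseg a b f + Iseg a b g.
Proof. by move=> cf cg; rewrite /Iseg RintegralD//; exact: contin_integrable. Qed.

Lemma IsegB a b f g : contin a b f -> contin a b g ->
  Iseg a b (fun x => f x - g x) = Iseg a b f - Iseg a b g.
Proof. by move=> cf cg; rewrite /Iseg RintegralB//; exact: contin_integrable. Qed.

Lemma IsegZ a b f k : contin a b f ->
  Iseg a b (fun x => k * f x) = k * Iseg a b f.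
Proof. by move=> cf; rewrite /Iseg RintegralZl//; exact: contin_integrable. Qed.

Lemma Iseg_cst a b k : a <= b -> Iseg a b (fun=> k) = k * (b - a).
Proof.
move=> ab; rewrite /Iseg Rintegral_cst//=; congr (_ * _).
rewrite lebesgue_measure_itv/= lte_fin; case: ltP => //= ba.
lra.
Qed.

Lemma eq_Iseg a b f g : (forall x, a <= x <= b -> f x = g x) ->
  Iseg a b f = Iseg a b g.
Proof. by move=> fg; apply: eq_Rintegral => x; rewrite inE/= in_itv/=; exact: fg. Qed.

Lemma le_Iseg a b f g : contin a b f -> contin a b g ->
  (forall x, a <= x <= b -> f x <= g x) -> Iseg a b f <= Iseg a b g.
Proof.
by move=> cf cg fg; apply: le_Rintegral => //; exact: contin_integrable.
Qed.

Lemma norm_Iseg a b f k : a <= b -> contin a b f ->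
  (forall x, a <= x <= b -> `|f x| <= k) -> `|Iseg a b f| <= k * (b - a).
Proof.
move=> ab cf fk; rewrite ler_norml -mulNr -!(Iseg_cst _ ab).
by apply/andP; split; apply: le_Iseg => //; do ?[exact: contin_cst] => x /fk;
  rewrite ler_norml => /andP[].
Qed.

Lemma Iseg_split a b c f : a <= c <= b -> contin a b f ->
  Iseg a b f = Iseg a c f + Iseg c b f.
Proof.
move=> /andP[ac cb] cf; apply/eqP; rewrite addrC -subr_eq; apply/eqP.
rewrite /Iseg Rintegral_itvB ?bnd_simp//; last exact: contin_integrable.
rewrite Rintegral_itv_obnd_cbnd//.
have := contin_integrable (sub_contin ac (lexx b) cf).
by apply: integrableS => //; apply: subset_itvr; rewrite bnd_simp.
Qed.

End SegmentIntegrals.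

Section Goursat.
Context {R : realType}.
Local Notation C := R[i].
Implicit Types (g : C -> C) (a b c d x y h k : R).

Lemma continuous_hline g x y : {for (x +i* y), continuous (g : C^o -> C^o)} ->
  {for x, continuous (fun t => Re (g (t +i* y)))}.
Proof.
move=> cg; have h : (fun t => t +i* y) @ nbhs x --> (x +i* y : C^o).
  by apply: cvgC_pair; [exact: cvg_id|exact: cvg_cst].
have := cvg_comp _ _ h cg; exact: cvgC_Re.
Qed.

Lemma continuous_vline g x y : {for (x +i* y), continuous (g : C^o -> C^o)} ->
  {for y, continuous (fun t => Im (g (x +i* t)))}.
Proof.
move=> cg; have h : (fun t => x +i* t) @ nbhs y --> (x +i* y : C^o).
  by apply: cvgC_pair; [exact: cvg_cst|exact: cvg_id].
have := cvg_comp _ _ h cg; exact: cvgC_Im.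
Qed.

(** The real part of the integral of [g] along the boundary of the rectangle
    with corners [a +i* c] and [b +i* d], with opposite sides put together: an
    affine function then contributes constant integrands. *)
Definition rect_int g a b c d : R :=
  Iseg a b (fun x => Re (g (x +i* c)) - Re (g (x +i* d))) -
  Iseg c d (fun y => Im (g (b +i* y)) - Im (g (a +i* y))).

Definition holo_rect g a b c d := forall x y, a <= x <= b -> c <= y <= d ->
  hol g (x +i* y).

Lemma holo_rect_h g a b c d y : holo_rect g a b c d -> c <= y <= d ->
  contin a b (fun x => Re (g (x +i* y))).
Proof.
by move=> H ycd x xab; apply: continuous_hline; apply: hol_continuous; exact: H.
Qed.

Lemma holo_rect_v g a b c d x : holo_rect g a b c d -> a <= x <= b ->
  contin c d (fun y => Im (g (x +i* y))).
Proof.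
by move=> H xab y ycd; apply: continuous_vline; apply: hol_continuous; exact: H.
Qed.

Lemma rect_int_splith g a b c d m : a <= m <= b -> c <= d ->
  holo_rect g a b c d ->
  rect_int g a b c d = rect_int g a m c d + rect_int g m b c d.
Proof.
move=> amb cd H; have /andP[am mb] := amb.
have cc : c <= c <= d by rewrite lexx.
have dd : c <= d <= d by rewrite lexx cd.
have aa : a <= a <= b by rewrite lexx (le_trans am).
have bb : a <= b <= b by rewrite lexx (le_trans am).
rewrite /rect_int (Iseg_split amb); last first.
  by apply: continB; exact: (holo_rect_h H).
rewrite addrACA -opprD -IsegD; last 2 first.
- by apply: continB; exact: (holo_rect_v H).
- by apply: continB; exact: (holo_rect_v H).
by congr (_ - _); apply: eq_Iseg => y _; ring.
Qed.

Lemma rect_int_splitv g a b c d m : a <= b -> c <= m <= d ->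
  holo_rect g a b c d ->
  rect_int g a b c d = rect_int g a b c m + rect_int g a b m d.
Proof.
move=> ab cmd H; have /andP[cm md] := cmd.
have aa : a <= a <= b by rewrite lexx.
have bb : a <= b <= b by rewrite lexx ab.
have cc : c <= c <= d by rewrite lexx (le_trans cm).
have dd : c <= d <= d by rewrite lexx (le_trans cm).
rewrite /rect_int (Iseg_split cmd); last first.
  by apply: continB; exact: (holo_rect_v H).
rewrite addrACA -opprD -IsegD; last 2 first.
- by apply: continB; exact: (holo_rect_h H).
- by apply: continB; exact: (holo_rect_h H).
by congr (_ - _); apply: eq_Iseg => y _; ring.
Qed.

(** Affine functions have no boundary integral, so only the remainder of the
    derivative counts. *)
Lemma rect_int_small g a b c d x0 y0 (l : C) (eta : R) :
  0 <= eta -> a <= x0 <= b -> c <= y0 <= d -> holo_rect g a b c d ->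
  (forall x y, a <= x <= b -> c <= y <= d ->
    cmod (g (x +i* y) - g (x0 +i* y0) - l * (x +i* y - (x0 +i* y0)))
      <= eta * cmod (x +i* y - (x0 +i* y0))) ->
  `|rect_int g a b c d| <= 2 * eta * ((b - a) + (d - c)) ^+ 2.
Proof.
move=> eta0 /andP[ax xb] /andP[cy yd] H G.
have ab : a <= b by exact: le_trans xb.
have cd : c <= d by exact: le_trans yd.
set D := (b - a) + (d - c).
pose r x y := g (x +i* y) - g (x0 +i* y0) - l * (x +i* y - (x0 +i* y0)).
have rD x y : a <= x <= b -> c <= y <= d -> cmod (r x y) <= eta * D.
  move=> xab ycd; apply: le_trans (G _ _ xab ycd) _; apply: ler_wpM2l => //.
  apply: le_trans (cmod_le_ReIm _) _; rewrite /= /D.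
  by move: xab ycd => /andP[? ?] /andP[? ?]; apply: lerD; rewrite ler_norml; lra.
pose q := Im l.
have cc : c <= c <= d by rewrite lexx.
have dd : c <= d <= d by rewrite lexx cd.
have aa : a <= a <= b by rewrite lexx ab.
have bb : a <= b <= b by rewrite lexx ab.
have Eh x : Re (g (x +i* c)) - Re (g (x +i* d)) - q * (d - c) =
    Re (r x c) - Re (r x d).
  by rewrite /r !reD !reN !reM !reD !imD !reN !imN /= -/q; ring.
have Ev y : Im (g (b +i* y)) - Im (g (a +i* y)) - q * (b - a) =
    Im (r b y) - Im (r a y).
  by rewrite /r !imD !imN !imM !reD !imD !reN !imN /= -/q; ring.
have C1 : contin a b (fun x => Re (g (x +i* c)) - Re (g (x +i* d))).
  by apply: continB; exact: (holo_rect_h H).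
have C2 : contin c d (fun y => Im (g (b +i* y)) - Im (g (a +i* y))).
  by apply: continB; exact: (holo_rect_v H).
have -> : rect_int g a b c d =
  Iseg a b (fun x => Re (g (x +i* c)) - Re (g (x +i* d)) - q * (d - c)) -
  Iseg c d (fun y => Im (g (b +i* y)) - Im (g (a +i* y)) - q * (b - a)).
  rewrite /rect_int (IsegB C1 (@contin_cst _ _ _ _)) (IsegB C2 (@contin_cst _ _ _ _)).
  by rewrite !Iseg_cst//; ring.
have E1 : `|Iseg a b (fun x => Re (g (x +i* c)) - Re (g (x +i* d)) - q * (d - c))|
    <= 2 * eta * D * (b - a).
  apply: norm_Iseg => //; first by apply: continB => //; exact: contin_cst.
  move=> x xab; rewrite Eh; apply: le_trans (ler_normB _ _) _.
  have := le_trans (normRe_cmod _) (rD _ _ xab cc).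
  by have := le_trans (normRe_cmod _) (rD _ _ xab dd); lra.
have E2 : `|Iseg c d (fun y => Im (g (b +i* y)) - Im (g (a +i* y)) - q * (b - a))|
    <= 2 * eta * D * (d - c).
  apply: norm_Iseg => //; first by apply: continB => //; exact: contin_cst.
  move=> x xab; rewrite Ev; apply: le_trans (ler_normB _ _) _.
  have := le_trans (normIm_cmod _) (rD _ _ aa xab).
  by have := le_trans (normIm_cmod _) (rD _ _ bb xab); lra.
apply: le_trans (ler_normB _ _) _; apply: le_trans (lerD E1 E2) _.
by rewrite /D expr2; lra.
Qed.

(** The integral is additive under bisection in both directions, so one of the
    four quarters carries its share. *)
Lemma rect_int_quarter g a b c d (K : R) : a <= b -> c <= d ->
  holo_rect g a b c d -> K < `|rect_int g a b c d| ->
  let m := (a + b) / 2 in let n := (c + d) / 2 in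
  exists p : R * R, [/\ p.1 = a \/ p.1 = m, p.2 = c \/ p.2 = n &
    K / 4 < `|rect_int g p.1 (p.1 + (b - a) / 2) p.2 (p.2 + (d - c) / 2)|].
Proof.
move=> ab cd H HK m n.
have amb : a <= m <= b by rewrite /m; lra.
have cnd : c <= n <= d by rewrite /n; lra.
have /andP[am mb] := amb; have /andP[cn nd] := cnd.
have Hl : holo_rect g a m c d.
  by move=> x y /andP[? ?]; apply: H; lra.
have Hr : holo_rect g m b c d.
  by move=> x y /andP[? ?]; apply: H; lra.
move: HK; rewrite (rect_int_splith amb cd H) (rect_int_splitv am cnd Hl).
rewrite (rect_int_splitv mb cnd Hr).
have m1 : a + (b - a) / 2 = m by rewrite /m; field.
have m2 : m + (b - a) / 2 = b by rewrite /m; field.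
have n1 : c + (d - c) / 2 = n by rewrite /n; field.
have n2 : n + (d - c) / 2 = d by rewrite /n; field.
move=> HK; apply: contrapT => N.
have {}N p1 p2 : p1 = a \/ p1 = m -> p2 = c \/ p2 = n ->
  `|rect_int g p1 (p1 + (b - a) / 2) p2 (p2 + (d - c) / 2)| <= K / 4.
  move=> ? ?; rewrite leNgt; apply/negP => ?.
  by apply: N; exists (p1, p2).
have := N a c (or_introl erefl) (or_introl erefl).
have := N a n (or_introl erefl) (or_intror erefl).
have := N m c (or_intror erefl) (or_introl erefl).
have := N m n (or_intror erefl) (or_intror erefl).
rewrite m1 m2 n1 n2 => N1 N2 N3 N4.
move: HK; apply/negP; rewrite -leNgt.
apply: le_trans (ler_normD _ _) _.
apply: le_trans (lerD (ler_normD _ _) (ler_normD _ _)) _; lra.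
Qed.

(** Otherwise bisection yields rectangles whose boundary integrals are large
    compared with the square of their size; they shrink to a point, at which
    differentiability makes these integrals small. *)
Theorem Goursat g a b c d : a < b -> c < d -> holo_rect g a b c d ->
  rect_int g a b c d = 0.
Proof.
move=> ab cd H; apply/eqP/negPn/negP => W0.
pose h n := (b - a) / 2 ^+ n; pose k n := (d - c) / 2 ^+ n.
have pow2 n : 0 < 2 ^+ n :> R by rewrite exprn_gt0.
have h0 n : 0 < h n by rewrite divr_gt0// subr_gt0.
have k0 n : 0 < k n by rewrite divr_gt0// subr_gt0.
have hS n : h n.+1 = h n / 2.
  by rewrite /h exprSr invfM mulrA.
have kS n : k n.+1 = k n / 2.
  by rewrite /k exprSr invfM mulrA.
pose D n := h n + k n.
have D0 n : 0 < D n by rewrite addr_gt0.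
(* Half of the initial ratio, so that the bound in [Bad] is strict at the
   start. *)
pose e : R := `|rect_int g a b c d| / (2 * D 0 ^+ 2).
have e0 : 0 < e by rewrite divr_gt0 ?normr_gt0// mulr_gt0// exprn_gt0.
pose Bad n (p : R * R) := [/\ a <= p.1, p.1 + h n <= b, c <= p.2, p.2 + k n <= d &
  e * D n ^+ 2 < `|rect_int g p.1 (p.1 + h n) p.2 (p.2 + k n)|].
have Bad0 : Bad 0 (a, c).
  rewrite /Bad/= /h /k !expr0 !divr1 !subrKC !lexx; split=> //.
  have -> : e * D 0%N ^+ 2 = `|rect_int g a b c d| / 2.
    by rewrite /e; field; rewrite gt_eqF// D0.
  by have := normr_gt0 (rect_int g a b c d); rewrite W0; lra.
have step n p : exists p', Bad n p ->
   [/\ Bad n.+1 p', p.1 <= p'.1 <= p.1 + h n.+1 & p.2 <= p'.2 <= p.2 + k n.+1].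
  have [|nB] := pselect (Bad n p); last by exists p.
  move=> [p1 p2 p3 p4 p5].
  have Hp : holo_rect g p.1 (p.1 + h n) p.2 (p.2 + k n).
    by move=> x y /andP[? ?] /andP[? ?]; apply: H; lra.
  have := h0 n; have := k0 n => k0n h0n.
  have s1 : p.1 <= p.1 + h n by lra.
  have s2 : p.2 <= p.2 + k n by lra.
  have [p' [q1 q2 q3]] := rect_int_quarter s1 s2 Hp p5.
  exists p' => _; move: q3.
  have -> : p.1 + h n - p.1 = h n by ring.
  have -> : p.2 + k n - p.2 = k n by ring.
  rewrite -hS -kS => q3.
  have hSn := hS n; have kSn := kS n.
  have r1 : p.1 <= p'.1 <= p.1 + h n.+1 by case: q1 => ->; lra.
  have r2 : p.2 <= p'.2 <= p.2 + k n.+1 by case: q2 => ->; lra.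
  split=> //; split; [by clear -p1 r1; lra|by clear -p2 r1 hSn; lra|
    by clear -p3 r2; lra|by clear -p4 r2 kSn; lra|].
  apply: le_lt_trans q3; rewrite /D hS kS -mulrDl exprMn mulrA.
  by rewrite le_eqVlt; apply/orP; left; apply/eqP; field.
pose st n p := projT1 (cid (step n p)).
pose u := fix u n := if n is n'.+1 then st n' (u n') else (a, c).
have Bu n : Bad n (u n).
  elim: n => [//|n IH] /=; rewrite /st; case: cid => p' /= /(_ IH)[]//.
have uS n : (u n).1 <= (u n.+1).1 <= (u n).1 + h n.+1 /\
            (u n).2 <= (u n.+1).2 <= (u n).2 + k n.+1.
  by rewrite /= /st; case: cid => p' /= /(_ (Bu n))[].
have mon n m : (n <= m)%N -> [/\ (u n).1 <= (u m).1, (u m).1 + h m <= (u n).1 + h n,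
   (u n).2 <= (u m).2 & (u m).2 + k m <= (u n).2 + k n].
  move=> /subnK <-; elim: (m - n)%N => [|j [i1 i2 i3 i4]]; first by rewrite add0n !lexx.
  have := uS (j + n)%N; have := hS (j + n)%N; have := kS (j + n)%N.
  by rewrite addSn => ? ? [/andP[? ?] /andP[? ?]]; split; lra.
have U1 n m : (u n).1 <= (u m).1 + h m.
  have := h0 n; have := h0 m => ? ?.
  have [/mon[]|/ltnW/mon[]] := leqP n m; lra.
have U2 n m : (u n).2 <= (u m).2 + k m.
  have := k0 n; have := k0 m => ? ?.
  have [/mon[]|/ltnW/mon[]] := leqP n m; lra.
pose x0 := sup (range (fun n => (u n).1)).
pose y0 := sup (range (fun n => (u n).2)).
have hx n : (u n).1 <= x0 <= (u n).1 + h n.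
  apply/andP; split.
    apply: ub_le_sup; last by exists n.
    by exists ((u 0%N).1 + h 0%N) => _ [m _ <-].
  by apply: ge_sup; [exists (u 0%N).1, 0%N|move=> _ [m _ <-]].
have hy n : (u n).2 <= y0 <= (u n).2 + k n.
  apply/andP; split.
    apply: ub_le_sup; last by exists n.
    by exists ((u 0%N).2 + k 0%N) => _ [m _ <-].
  by apply: ge_sup; [exists (u 0%N).2, 0%N|move=> _ [m _ <-]].
have [u1 u2 u3 u4 _] := Bu 0%N.
have xab : a <= x0 <= b by have := hx 0%N; lra.
have ycd : c <= y0 <= d by have := hy 0%N; lra.
have [l Hl] := (hol_eps _ _).1 (H _ _ xab ycd).
have [de de0 Hde] := Hl (e / 2) (divr_gt0 e0 (ltr0n _ 2)).
have [n Dn] : exists n, D n < de.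
  have [n nD] : exists n : nat, D 0 / de < n%:R.
    exists (Num.bound (D 0%N / de)).
    exact: archi_boundP (ltW (divr_gt0 (D0 0%N) de0)).
  exists n; have -> : D n = D 0 / 2 ^+ n by rewrite /D /h /k !expr0 !divr1 -mulrDl.
  rewrite ltr_pdivrMr// -ltr_pdivrMl// mulrC; apply: lt_trans nD _.
  by rewrite -natrX ltr_nat ltn_expl.
have [v1 v2 v3 v4 v5] := Bu n.
have Hn : holo_rect g (u n).1 ((u n).1 + h n) (u n).2 ((u n).2 + k n).
  by move=> x y /andP[? ?] /andP[? ?]; apply: H; lra.
have := rect_int_small (ltW (divr_gt0 e0 (ltr0n _ 2))) (hx n) (hy n) Hn.
move=> /(_ l) HH; move: v5; apply/negP; rewrite -leNgt.
have -> : e * D n ^+ 2 = 2 * (e / 2) * ((u n).1 + h n - (u n).1 + ((u n).2 + k n - (u n).2)) ^+ 2.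
  by rewrite /D; field.
apply: HH => x y /andP[w1 w2] /andP[w3 w4]; apply: Hde.
apply: le_lt_trans Dn; apply: le_trans (cmod_le_ReIm _) _; rewrite /= /D.
have /andP[? ?] := hx n; have /andP[? ?] := hy n.
by apply: lerD; rewrite ler_norml; lra.
Qed.

End Goursat.

(** * Circle means and the formulas of Cauchy, Harnack and Taylor *)

Section CircleMeans.
Context {R : realType}.
Local Notation C := R[i].
Implicit Types (f g k : C -> C) (c z w u : C) (r t : R).

Definition circ c r t : C := c + ((r * cos t) +i* (r * sin t)).

Definition cavg (h : R -> R) : R := (pi *+ 2)^-1 * Iseg 0 (pi *+ 2) h.

Lemma circBc c r t : circ c r t - c = (r * cos t) +i* (r * sin t).
Proof. by rewrite /circ addrC addKr. Qed.

Lemma cmod_circ c r t : cmod (circ c r t - c) = `|r|.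
Proof.
rewrite circBc; have [r0|r0] := leP 0 r; first by rewrite cmod_polar// ger0_norm.
rewrite -cmodN -[r in LHS]opprK ltr0_norm//.
rewrite -[RHS](@cmod_polar _ (- r) t) ?oppr_ge0 ?ltW//; congr cmod.
by apply: complex_ext; rewrite /= ?opprK; ring.
Qed.

Lemma circ_expc c s t : circ c (expR s) t = c + expc (s +i* t).
Proof. by []. Qed.

Lemma cvg_circ c (T : Type) (F : set_system T) {FF : Filter F} (a b : T -> R) r t :
  a @ F --> r -> b @ F --> t ->
  (fun x => circ c (a x) (b x)) @ F --> (circ c r t : C^o).
Proof.
move=> ar bt; apply: (@cvgD _ C^o); first exact: cvg_cst.
apply: cvgC_pair; apply: cvgM => //.
  exact: (cvg_comp _ _ bt (@continuous_cos R t)).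
exact: (cvg_comp _ _ bt (@continuous_sin R t)).
Qed.

Lemma pi2_gt0 : 0 < pi *+ 2 :> R.
Proof. by rewrite mulrn_wgt0// pi_gt0. Qed.
Hint Resolve pi2_gt0 : core.

Lemma continuous_contin a b (h : R -> R) : continuous h -> contin a b h.
Proof. by move=> ch x _; exact: ch. Qed.

Lemma cavgD (h1 h2 : R -> R) : continuous h1 -> continuous h2 ->
  cavg (fun t => h1 t + h2 t) = cavg h1 + cavg h2.
Proof. by move=> c1 c2; rewrite /cavg IsegD ?mulrDr//; exact: continuous_contin. Qed.

Lemma cavgB (h1 h2 : R -> R) : continuous h1 -> continuous h2 ->
  cavg (fun t => h1 t - h2 t) = cavg h1 - cavg h2.
Proof. by move=> c1 c2; rewrite /cavg IsegB ?mulrBr//; exact: continuous_contin. Qed.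

Lemma cavgZ (h : R -> R) x : continuous h ->
  cavg (fun t => x * h t) = x * cavg h.
Proof. by move=> ch; rewrite /cavg IsegZ 1?mulrCA//; exact: continuous_contin. Qed.

Lemma cavg_cst x : cavg (fun=> x) = x.
Proof.
by rewrite /cavg Iseg_cst ?ltW// subr0 mulrC mulfK// gt_eqF.
Qed.

Lemma le_cavg (h1 h2 : R -> R) : continuous h1 -> continuous h2 ->
  (forall t, h1 t <= h2 t) -> cavg h1 <= cavg h2.
Proof.
move=> c1 c2 h12; rewrite /cavg ler_pM2l ?invr_gt0//.
by apply: le_Iseg => //; exact: continuous_contin.
Qed.

Lemma eq_cavg (h1 h2 : R -> R) : h1 =1 h2 -> cavg h1 = cavg h2.
Proof. by move=> h12; rewrite /cavg; congr (_ * _); apply: eq_Iseg. Qed.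

(** Goursat's theorem in logarithmic coordinates around [c]: the two horizontal
    sides of the rectangle cancel by periodicity. *)
Lemma circle_Im_const f c (r1 r2 : R) : 0 < r1 -> r1 < r2 ->
  (forall z, r1 <= cmod (z - c) <= r2 -> hol f z) ->
  cavg (fun t => Im (f (circ c r1 t))) = cavg (fun t => Im (f (circ c r2 t))).
Proof.
move=> r10 r12 H; have r20 : 0 < r2 by exact: lt_trans r12.
pose g := fun z => f (c + expc z).
have E1 t : circ c r1 t = c + expc (ln r1 +i* t).
  by rewrite -circ_expc lnK.
have E2 t : circ c r2 t = c + expc (ln r2 +i* t).
  by rewrite -circ_expc lnK.
have hg : holo_rect g (ln r1) (ln r2) 0 (pi *+ 2).
  move=> x y /andP[x1 x2] _; apply: (@hol_comp _ (fun z => c + expc z)).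
    by apply: holD; [exact: hol_cst|exact: hol_expc].
  apply: H.
  rewrite addrC addKr cmod_expc/= -[r1]lnK ?posrE// -[r2]lnK ?posrE//.
  by rewrite !ler_expR x1.
have l12 : ln r1 < ln r2 by rewrite ltr_ln.
have := Goursat l12 pi2_gt0 hg; rewrite /rect_int.
have -> : Iseg (ln r1) (ln r2)
    (fun x => Re (g (x +i* 0)) - Re (g (x +i* (pi *+ 2)))) = 0.
  rewrite -[RHS](mul0r (ln r2 - ln r1)) -Iseg_cst ?ltW//.
  apply: eq_Iseg => x _; rewrite /g /expc/= cos2pi sin2pi cos0 sin0.
  by rewrite subrr.
have [i1 i2] : ln r1 <= ln r1 <= ln r2 /\ ln r1 <= ln r2 <= ln r2.
  by rewrite !lexx (ltW l12).
rewrite (IsegB (holo_rect_v hg i2) (holo_rect_v hg i1)) sub0r opprB.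
move=> /eqP; rewrite subr_eq0 => /eqP; rewrite /cavg => E.
rewrite (@eq_Iseg _ _ _ _ (fun t => Im (g (ln r1 +i* t)))); last first.
  by move=> t _; rewrite E1.
by rewrite E; congr (_ * _); apply: eq_Iseg => t _; rewrite E2.
Qed.

Lemma circle_Re_const f c (r1 r2 : R) : 0 < r1 -> r1 < r2 ->
  (forall z, r1 <= cmod (z - c) <= r2 -> hol f z) ->
  cavg (fun t => Re (f (circ c r1 t))) = cavg (fun t => Re (f (circ c r2 t))).
Proof.
move=> r10 r12 H.
have E z : Re (f z) = Im ((0 +i* 1) * f z) by rewrite imM/= mul0r add0r mul1r.
under eq_cavg do rewrite E.
rewrite (@circle_Im_const (fun z => (0 +i* 1) * f z) _ _ _ r10 r12).
  by apply: eq_cavg => t; rewrite E.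
by move=> z /H hz; exact: (holM (hol_cst _ _) hz).
Qed.

Lemma const_right (J : R -> R) (x0 x1 : R) : {for x0, continuous J} ->
  (forall s s', x0 < s -> s < s' -> s' < x1 -> J s = J s') ->
  forall s, x0 < s -> s < x1 -> J s = J x0.
Proof.
move=> cJ H s s0 s1; apply/eqP/negPn/negP => N.
have e0 : 0 < `|J s - J x0| by rewrite normr_gt0 subr_eq0.
move/cvgrPdist_lt: cJ => /(_ _ e0)/nbhs_ballP[d /= d0 Hd].
pose s' := Order.min ((x0 + s) / 2) (x0 + d / 2).
have s'0 : x0 < s' by rewrite lt_min; apply/andP; split; lra.
have s's : s' < s by rewrite gt_min; apply/orP; left; lra.
have s'd : s' <= x0 + d / 2 by rewrite ge_min lexx orbT.
have := Hd s'; rewrite /ball/= ltr_norml (H s' s)// distrC ltxx => X.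
by suff : false by []; apply: X; lra.
Qed.

Lemma const_left (J : R -> R) (x0 x1 : R) : {for x1, continuous J} ->
  (forall s s', x0 < s -> s < s' -> s' < x1 -> J s = J s') ->
  forall s, x0 < s -> s < x1 -> J s = J x1.
Proof.
move=> cJ H s s0 s1; apply/eqP/negPn/negP => N.
have e0 : 0 < `|J s - J x1| by rewrite normr_gt0 subr_eq0.
move/cvgrPdist_lt: cJ => /(_ _ e0)/nbhs_ballP[d /= d0 Hd].
pose s' := Order.max ((s + x1) / 2) (x1 - d / 2).
have s'0 : s' < x1 by rewrite gt_max; apply/andP; split; lra.
have s's : s < s' by rewrite lt_max; apply/orP; left; lra.
have s'd : x1 - d / 2 <= s' by rewrite le_max lexx orbT.
have := Hd s'; rewrite /ball/= ltr_norml -(H s s')// distrC ltxx => X.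
by suff : false by []; apply: X; lra.
Qed.

Definition cont_disc k c r := forall z, cmod (z - c) < r ->
  {for z, continuous (k : C^o -> C^o)}.

Lemma continuous_circ k c (R0 r : R) : cont_disc k c R0 -> `|r| < R0 ->
  continuous (fun t => Re (k (circ c r t))).
Proof.
move=> ck rR t.
have h : circ c r @ nbhs t --> (circ c r t : C^o).
  by apply: cvg_circ; [exact: cvg_cst|exact: cvg_id].
have ckt : {for circ c r t, continuous (k : C^o -> C^o)}.
  by apply: ck; rewrite cmod_circ.
have := cvg_comp _ _ h ckt; exact: cvgC_Re.
Qed.

Lemma circ_bounded k c (R0 R1 : R) : cont_disc k c R0 -> 0 < R1 < R0 ->
  exists B : R, forall r t, `|r| <= R1 -> 0 <= t <= pi *+ 2 ->
    `|Re (k (circ c r t))| <= B.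
Proof.
move=> ck /andP[R10 R1R].
pose A : set (R * R) := `[- R1, R1] `*` `[0, pi *+ 2].
pose F : R * R -> R := fun q => `|Re (k (circ c q.1 q.2))|.
have cA : compact A by apply: compact_setX; exact: segment_compact.
have A0 : A !=set0.
  exists (0, 0); split; rewrite /= in_itv/=; first by rewrite oppr_le0 !ltW.
  by rewrite lexx ltW.
have cF : {within A, continuous F}.
  apply: continuous_in_subspaceT => -[r t]; rewrite inE => -[/=].
  rewrite !in_itv/= -ler_norml => rR _.
  have h : (fun q : R * R => circ c q.1 q.2) @ nbhs (r, t) --> (circ c r t : C^o).
    by apply: cvg_circ; [exact: cvg_fst|exact: cvg_snd].
  have ckt : {for circ c r t, continuous (k : C^o -> C^o)}.
    by apply: ck; rewrite cmod_circ (le_lt_trans rR).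
  have := cvg_comp _ _ h ckt => /cvgC_Re hR.
  exact: cvg_norm.
have [q _ Hq] := compact_EVT_max A0 cA cF.
exists (F q) => r t rR tp; apply: (Hq (r, t)).
by rewrite inE; split; rewrite /= in_itv/= -?ler_norml.
Qed.

(** An exceptional point [w] is harmless: the mean over the circle is constant
    on both sides of the circle through [w], and it is continuous. *)
Lemma circle_mean k c w (R0 r : R) : 0 < r < R0 -> cont_disc k c R0 ->
  (forall z, cmod (z - c) < R0 -> z != w -> hol k z) ->
  cavg (fun t => Re (k (circ c r t))) = Re (k c).
Proof.
move=> /andP[r0 rR] ck dk.
pose R1 := (r + R0) / 2.
have R1b : 0 < R1 < R0 by rewrite /R1; lra.
have /andP[R10 R1R] := R1b.
have [B HB] := circ_bounded ck R1b.
pose J r := cavg (fun t => Re (k (circ c r t))).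
have cJ x : - R1 < x < R1 -> {for x, continuous J}.
  move=> xR.
  have cI : {in `]- R1, R1[%classic, continuous (fun l =>
      \int[@lebesgue_measure R]_(t in `[0, pi *+ 2]) Re (k (circ c l t)))}.
    apply: (@continuity_under_integral _ _ _ _ _ _ _ _ _ _ _ (fun=> B)) => //.
    - move=> y; rewrite /= in_itv/= => yR; apply: contin_integrable.
      apply: continuous_contin; apply: (continuous_circ ck).
      by rewrite ltr_norml; lra.
    - apply: aeW => t /=; rewrite in_itv/= => tp y; rewrite inE/= in_itv/= => yR.
      have h : (fun y => circ c y t) @ nbhs y --> (circ c y t : C^o).
        by apply: cvg_circ; [exact: cvg_id|exact: cvg_cst].
      have ckt : {for circ c y t, continuous (k : C^o -> C^o)}.
        by apply: ck; rewrite cmod_circ ltr_norml; lra.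
      have := cvg_comp _ _ h ckt; exact: cvgC_Re.
    - by apply: contin_integrable; exact: contin_cst.
    - move=> y; rewrite /= in_itv/= => yR; apply: aeW => t /=; rewrite in_itv/=.
      by apply: HB; rewrite ler_norml; lra.
  rewrite /J /cavg /Iseg; apply: cvgM; first exact: cvg_cst.
  by apply: cI; rewrite inE/= in_itv.
have J0 : J 0 = Re (k c).
  rewrite /J -[RHS]cavg_cst; apply: eq_cavg => t.
  by rewrite /circ !mul0r addr0.
have JC s s' : 0 < s -> s < s' -> s' < R1 -> (s' < cmod (w - c)) || (cmod (w - c) < s) ->
    J s = J s'.
  move=> s0 ss sR H; apply: circle_Re_const => // z /andP[z1 z2].
  apply: dk; first by lra.
  by apply: contraTneq H => <-; rewrite negb_or -!leNgt z1 z2.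
rewrite -J0 -/(J r); set m := cmod (w - c) in JC.
have m0 : 0 <= m by exact: cmod_ge0.
have rR1 : r < R1 by rewrite /R1; lra.
have cJ0 : {for 0, continuous J} by apply: cJ; lra.
have [m00|mn0] := eqVneq m 0.
  apply: (const_right cJ0 (x1 := R1)) => // s s' s0 ss sR.
  by apply: JC => //; rewrite m00 s0 orbT.
have {}m0 : 0 < m by rewrite lt_neqAle eq_sym mn0.
have Jl s : 0 < s -> s < m -> s < R1 -> J s = J 0.
  move=> s0 sm sR.
  apply: (const_right cJ0 (x1 := Order.min m R1)) => //; last first.
    by rewrite lt_min sm.
  move=> x y x0 xy; rewrite lt_min => /andP[ym yR].
  by apply: JC => //; rewrite ym.
have [rm|mr] := ltP r m; first exact: Jl.
have mR1 : m < R1 by lra.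
have cJm : {for m, continuous J} by apply: cJ; lra.
have Jm : J m = J 0.
  have m2 : J (m / 2) = J 0 by apply: Jl; lra.
  rewrite -m2; apply/esym; apply: (const_left cJm (x0 := 0)); try lra.
  by move=> x y x0 xy ym; rewrite !Jl//; lra.
have [rm|] := eqVneq r m; first by rewrite rm.
move=> rm; rewrite -Jm; apply: (const_right cJm (x1 := R1)) => //.
  move=> x y x0 xy yR; apply: JC => //; first lra.
  by rewrite x0 orbT.
by rewrite lt_neqAle eq_sym rm.
Qed.

Definition holo_disc f c r := forall z, cmod (z - c) < r ->
  hol f z.

Lemma holo_cont_disc f c r : holo_disc f c r -> cont_disc f c r.
Proof. by move=> H z /H; exact: hol_continuous. Qed.

Lemma mean_value f c (R0 r : R) : 0 < r < R0 -> holo_disc f c R0 ->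
  cavg (fun t => Re (f (circ c r t))) = Re (f c).
Proof.
move=> rR H; apply: (circle_mean (w := c) rR); first exact: holo_cont_disc.
by move=> z /H.
Qed.

(** The Cauchy kernel, normalised for the mean over the circle. *)
Definition cker c w z : C := (z - c) / (z - w).

Lemma circ_neq c w (r t : R) : cmod (w - c) < r -> circ c r t - w != 0.
Proof.
move=> wr; rewrite subr_eq0; apply: contraTneq wr => <-.
by rewrite cmod_circ -leNgt ler_norm.
Qed.

Lemma circ_sub_ge c w (r t : R) : cmod (w - c) < r ->
  r - cmod (w - c) <= cmod (circ c r t - w).
Proof.
move=> wr; have := cmodBD (circ c r t) c w; rewrite cmod_circ.
have := ler_norm r; lra.
Qed.

(** On the circle, the conjugate of the Cauchy kernel is the boundary value of a
    function that is holomorphic in a larger disc. *)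
Lemma conj_cker c w (r t : R) : 0 < r -> cmod (w - c) < r ->
  (conjc (cker c w (circ c r t))) =
  (r ^+ 2)%:C / ((r ^+ 2)%:C - (conjc (w - c)) * (circ c r t - c)).
Proof.
move=> r0 wr; have zw := circ_neq t wr.
rewrite /cker; set z := circ c r t in zw *; set h := w - c.
have E : (z - c) * (conjc (z - c)) = (r ^+ 2)%:C.
  by rewrite -sqr_normc normc_cmod cmod_circ -rmorphXn/= real_normK ?num_real.
have zc : (z - c) != 0 by rewrite -cmod_gt0 cmod_circ normr_gt0 gt_eqF.
rewrite -E; have -> : z - w = (z - c) - h by rewrite /h; ring.
have -> : (z - c) * (conjc (z - c)) - (conjc h) * (z - c) = (conjc ((z - c) - h)) * (z - c).
  by rewrite rmorphB/=; ring.
by rewrite rmorphM/= conjc_inv [X in _ = X / _]mulrC -mulf_div divff// mulr1.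
Qed.

Lemma continuous_Re_circ (F : C -> C) c (r : R) :
  (forall t, {for circ c r t, continuous (F : C^o -> C^o)}) ->
  continuous (fun t => Re (F (circ c r t))).
Proof.
move=> HF t.
have h : circ c r @ nbhs t --> (circ c r t : C^o).
  by apply: cvg_circ; [exact: cvg_cst|exact: cvg_id].
have := cvg_comp _ _ h (HF t); exact: cvgC_Re.
Qed.

Lemma hol_cker c w z : z != w ->
  hol (cker c w) z.
Proof.
by move=> zw; apply: hol_div; rewrite ?subr_eq0//; exact: hol_sub.
Qed.

(** On the circle the conjugate of the integrand is holomorphic in a larger
    disc, so this is the mean value property again. It provides the
    antiholomorphic half of the kernel in Harnack's inequality. *)
Lemma Cauchy_conj f c w (R0 r : R) : 0 < r < R0 -> cmod (w - c) < r ->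
  holo_disc f c R0 ->
  cavg (fun t => Re ((conjc (f (circ c r t))) * cker c w (circ c r t))) = Re (f c).
Proof.
move=> /andP[r0 rR] wr H; set h := w - c in wr.
pose den z := (r ^+ 2)%:C - (conjc h) * (z - c).
pose F z := f z * ((r ^+ 2)%:C / den z).
have r2 : 0 < r ^+ 2 by rewrite exprn_gt0.
pose m := cmod h; have m0 : 0 <= m by exact: cmod_ge0.
have mr : m < r by [].
(* [R2] exceeds [r], and [den] has no zero inside the circle of radius [R2]. *)
pose R1 := (r + R0) / 2; pose R2 := Order.min R1 (2 * r ^+ 2 / (r + m)).
have rm0 : 0 < r + m by lra.
have rR2 : r < R2.
  rewrite lt_min; apply/andP; split; first by rewrite /R1; lra.
  by rewrite ltr_pdivlMr// expr2 mulrDr [2 * _]mulr_natl mulr2n ltrD2l ltr_pM2l.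
have R2R : R2 <= R1 by rewrite ge_min lexx.
have R2m : m * R2 < r ^+ 2.
  have : m * R2 <= m * (2 * r ^+ 2 / (r + m)).
    by rewrite ler_wpM2l// ge_min lexx orbT.
  move=> /le_lt_trans -> //; rewrite mulrA ltr_pdivrMr//.
  have -> : m * (2 * r ^+ 2) = r ^+ 2 * (2 * m) by ring.
  by rewrite ltr_pM2l//; lra.
have den0 z : cmod (z - c) < R2 -> den z != 0.
  move=> zR; rewrite subr_eq0; apply: contraTneq R2m => E.
  rewrite -leNgt -[X in X <= _](ger0_norm (ltW r2)) -cmod_real E cmodM cmodJ.
  exact: ler_wpM2l (ltW zR).
have HF : holo_disc F c R2.
  move=> z zR; apply: holM; first by apply: H; rewrite /R1 in R2R *; lra.
  apply: hol_div; [exact: den0|exact: hol_cst|].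
  by apply: holB; [exact: hol_cst|apply: holM; [exact: hol_cst|exact: hol_sub]].
have rR2' : 0 < r < R2 by rewrite r0.
have := mean_value rR2' HF.
have -> : F c = f c.
  by rewrite /F /den subrr mulr0 subr0 divff ?mulr1// -cmod_gt0 cmod_real normr_gt0 gt_eqF.
move=> <-; apply: eq_cavg => t.
have -> : F (circ c r t) = (conjc ((conjc (f (circ c r t))) * cker c w (circ c r t))).
  by rewrite rmorphM/= conjcK conj_cker.
by case: (_ * _).
Qed.

(** The difference quotient of [f] at [w], times [z - c], vanishes at [c] and is
    holomorphic except at [w]: this is what the exceptional point of
    [circle_mean] is for. *)
Lemma Cauchy_formula f c w (R0 r : R) : 0 < r < R0 -> cmod (w - c) < r ->
  holo_disc f c R0 ->
  cavg (fun t => Re (f (circ c r t) * cker c w (circ c r t))) = Re (f w).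
Proof.
move=> rR0 wr H; have /andP[r0 rR] := rR0.
have wR : cmod (w - c) < R0 by lra.
have [l Hl] := (hol_eps _ _).1 (H w wR).
pose Q z := if z == w then l else (f z - f w) / (z - w).
pose k z := Q z * (z - c).
have dQ z : cmod (z - c) < R0 -> z != w -> hol Q z.
  move=> zR zw.
  apply: (@eq_near_hol _ (fun z => (f z - f w) / (z - w))).
    apply/nbhsC; exists (cmod (z - w)); first by rewrite cmod_gt0 subr_eq0.
    move=> y yz; rewrite /Q ifN//; apply: contraTneq yz => ->.
    by rewrite cmodB ltxx.
  apply: hol_div; [by rewrite subr_eq0| |exact: hol_sub].
  by apply: holB; [exact: H|exact: hol_cst].
have cQ : cont_disc Q c R0.
  move=> z zR; have [->|zw] := eqVneq z w; last first.
    exact: hol_continuous (dQ z zR zw).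
  apply/(@cvgC _ _ (nbhs (w : C^o))) => e e0; apply/nbhsC.
  have [d d0 Hd] := Hl (e / 2) (divr_gt0 e0 (ltr0n _ 2)).
  exists d => // y yd; rewrite /Q eqxx; case: eqVneq => [_|yw].
    by rewrite subrr cmod0.
  have yw0 : y - w != 0 by rewrite subr_eq0.
  have -> : (f y - f w) / (y - w) - l = (f y - f w - l * (y - w)) / (y - w).
    by rewrite [in RHS]mulrBl mulfK.
  rewrite cmodM cmodV ltr_pdivrMr ?cmod_gt0//.
  apply: le_lt_trans (Hd _ yd) _; rewrite ltr_pM2r ?cmod_gt0//; lra.
have dc z : hol (fun z => z - c) z by exact: hol_sub.
have K : cavg (fun t => Re (k (circ c r t))) = Re (k c).
  apply: (circle_mean (w := w) rR0).
    by move=> z zR; exact: (cvgM (cQ z zR) (hol_continuous (dc z))).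
  by move=> z zR zw; exact: (holM (dQ z zR zw) (dc z)).
have cc (F : C -> C) : (forall z, cmod (z - c) < R0 -> hol F z) ->
    continuous (fun t => Re (F (circ c r t) * cker c w (circ c r t))).
  move=> HF; apply: (@continuous_Re_circ (fun z => F z * cker c w z)) => t.
  apply: hol_continuous; apply: holM.
    by apply: HF; rewrite cmod_circ ger0_norm ?ltW.
  by apply: hol_cker; rewrite -subr_eq0 circ_neq.
have E : cavg (fun t => Re (f (circ c r t) * cker c w (circ c r t))) -
         cavg (fun t => Re (f w * cker c w (circ c r t))) = 0.
  have cf := cc f H.
  have cw : continuous (fun t => Re (f w * cker c w (circ c r t))).
    exact: (cc (fun=> f w) (fun z _ => hol_cst _ _)).
  rewrite -(cavgB cf cw).
  have -> : 0 = Re (k c) by rewrite /k subrr mulr0.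
  rewrite -K; apply: eq_cavg => t; rewrite -reN -reD; congr Re.
  rewrite /k /Q ifN; last by rewrite -subr_eq0 circ_neq.
  by rewrite /cker -mulrBl -!mulrA; congr (_ * _); exact: mulrC.
apply/eqP; rewrite -subr_eq0 -[X in _ == X]E; apply/eqP; congr (_ - _).
have := Cauchy_conj rR0 wr (fun z (_ : cmod (z - c) < R0) => hol_cst (conjc (f w)) z).
have -> : Re (conjc (f w)) = Re (f w) by case: (f w).
by move=> <-; apply: eq_cavg => t; rewrite conjcK.
Qed.

Lemma continuous_Cauchy f c w (R0 r : R) : 0 < r < R0 -> cmod (w - c) < r ->
  holo_disc f c R0 ->
  continuous (fun t => Re (f (circ c r t) * cker c w (circ c r t))).
Proof.
move=> /andP[r0 rR] wr H.
apply: (@continuous_Re_circ (fun z => f z * cker c w z)) => t.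
apply: hol_continuous; apply: holM.
  by apply: H; rewrite cmod_circ ger0_norm ?ltW.
by apply: hol_cker; rewrite -subr_eq0 circ_neq.
Qed.

Lemma continuous_cmod_circ f c (R0 r : R) : 0 < r < R0 -> cont_disc f c R0 ->
  continuous (fun t => cmod (f (circ c r t))).
Proof.
move=> /andP[r0 rR] H t.
have h : circ c r @ nbhs t --> (circ c r t : C^o).
  by apply: cvg_circ; [exact: cvg_cst|exact: cvg_id].
have ft : {for circ c r t, continuous (f : C^o -> C^o)}.
  by apply: H; rewrite cmod_circ ger0_norm ?ltW.
have := cvg_comp _ _ h ft; exact: cvgC_cmod.
Qed.

Lemma cmod_cker c w (r t : R) : 0 < r -> cmod (w - c) < r ->
  cmod (cker c w (circ c r t)) <= r / (r - cmod (w - c)).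
Proof.
move=> r0 wr; rewrite cmodM cmodV cmod_circ (gtr0_norm r0).
rewrite ler_pM2l// lef_pV2 ?posrE ?subr_gt0//; first exact: circ_sub_ge.
by apply: lt_le_trans (circ_sub_ge t wr); rewrite subr_gt0.
Qed.

(** Only the modulus of the Cauchy kernel enters; its bound degenerates when [w]
    approaches the circle. *)
Lemma Cauchy_bound f c w (R0 r : R) : 0 < r < R0 -> cmod (w - c) < r ->
  holo_disc f c R0 ->
  cmod (f w) <= r / (r - cmod (w - c)) * cavg (fun t => cmod (f (circ c r t))).
Proof.
move=> rR0 wr H; have /andP[r0 rR] := rR0.
have [u u1 <-] := cmod_rot (f w).
have Hu : holo_disc (fun z => u * f z) c R0.
  by move=> z /H hz; exact: (holM (hol_cst _ _) hz).
have cf := continuous_cmod_circ rR0 (holo_cont_disc H).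
rewrite -(Cauchy_formula rR0 wr Hu) -(cavgZ _ cf); apply: le_cavg.
- exact: continuous_Cauchy Hu.
- by move=> t; apply: cvgM; [exact: cvg_cst|exact: cf].
move=> t; apply: le_trans (Re_cmod _) _.
rewrite (cmodM _ (cker _ _ _)) (cmodM u) u1 mul1r mulrC.
by rewrite ler_wpM2r// cmod_cker.
Qed.

Lemma holo_mean_le f c (R0 r : R) : 0 < r < R0 -> holo_disc f c R0 ->
  cmod (f c) <= cavg (fun t => cmod (f (circ c r t))).
Proof.
move=> rR0 H; have /andP[r0 rR] := rR0.
have := @Cauchy_bound f c c R0 r rR0.
rewrite subrr cmod0 subr0 divff ?gt_eqF// mul1r; exact.
Qed.

(** Subtract the mean value formula from Cauchy's: the difference of the two
    kernels is [(w - c) / (z - w)]. *)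
Lemma Cauchy_lipschitz f c w (R0 r B : R) : 0 < r < R0 -> cmod (w - c) < r ->
  holo_disc f c R0 -> (forall z, cmod (z - c) < R0 -> cmod (f z) <= B) ->
  cmod (f w - f c) <= B * (cmod (w - c) / (r - cmod (w - c))).
Proof.
move=> rR0 wr H HB; have /andP[r0 rR] := rR0.
have [u u1 <-] := cmod_rot (f w - f c).
have Hu : holo_disc (fun z => u * f z) c R0.
  by move=> z /H hz; exact: (holM (hol_cst _ _) hz).
have Eu := Cauchy_formula rR0 wr Hu; have Mu := mean_value rR0 Hu.
have c1 := continuous_Cauchy rR0 wr Hu.
have c2 : continuous (fun t => Re (u * f (circ c r t))).
  apply: (continuous_circ (k := fun z => u * f z) (holo_cont_disc Hu)).
  by rewrite ger0_norm ?ltW.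
rewrite mulrBr reD reN -Eu -Mu -(cavgB c1 c2) -[X in _ <= X]cavg_cst.
apply: le_cavg.
- by move=> t; apply: cvgB; [exact: c1|exact: c2].
- by move=> t; exact: cvg_cst.
move=> t; rewrite -reN -reD; apply: le_trans (Re_cmod _) _.
have zw := circ_neq t wr.
have -> : u * f (circ c r t) * cker c w (circ c r t) - u * f (circ c r t) =
    u * f (circ c r t) * ((w - c) / (circ c r t - w)).
  rewrite -[X in _ - X]mulr1 -mulrBr /cker; congr (_ * _).
  by apply: (mulIf zw); rewrite mulrBl !mulfVK// mul1r; ring.
rewrite !cmodM u1 mul1r cmodV; apply: ler_pM => //.
- by rewrite divr_ge0.
- by apply: HB; rewrite cmod_circ ger0_norm ?ltW.
- rewrite ler_wpM2l// lef_pV2 ?posrE ?subr_gt0//; first exact: circ_sub_ge.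
  by apply: lt_le_trans (circ_sub_ge t wr); rewrite subr_gt0.
Qed.

(** The sum of [Cauchy_formula] and [Cauchy_conj] tests the kernel against the
    nonnegative function [2 * Re g], whose mean is [2 * Re (g c)]. *)
Lemma Harnack g c w (R0 r : R) : 0 < r < R0 -> cmod (w - c) < r ->
  holo_disc g c R0 -> (forall z, cmod (z - c) < R0 -> 0 <= Re (g z)) ->
  cmod (g w + (conjc (g c))) <= 2 * Re (g c) * (r / (r - cmod (w - c))).
Proof.
move=> rR0 wr H g0; have /andP[r0 rR] := rR0.
have [u u1 <-] := cmod_rot (g w + (conjc (g c))).
have Hu : holo_disc (fun z => u * g z) c R0.
  by move=> z /H hz; exact: (holM (hol_cst _ _) hz).
have Hu' : holo_disc (fun z => (conjc u) * g z) c R0.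
  by move=> z /H hz; exact: (holM (hol_cst _ _) hz).
have Eu := Cauchy_formula rR0 wr Hu; have Mu := Cauchy_conj rR0 wr Hu'.
have c1 := continuous_Cauchy rR0 wr Hu.
have cg : continuous (fun t => Re (g (circ c r t))).
  by apply: (continuous_circ (holo_cont_disc H)); rewrite ger0_norm ?ltW.
have c2 : continuous (fun t => Re (conjc (conjc u * g (circ c r t)) * cker c w (circ c r t))).
  apply: (@continuous_Re_circ (fun z => conjc (conjc u * g z) * cker c w z)) => t.
  have hz : hol (fun z => conjc u * g z) (circ c r t).
    by apply: Hu'; rewrite cmod_circ ger0_norm ?ltW.
  have hk : hol (cker c w) (circ c r t) by apply: hol_cker; rewrite -subr_eq0 circ_neq.
  exact: (cvgM (cvgC_conj (hol_continuous hz)) (hol_continuous hk)).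
have uE X : u * (2 * Re X)%:C = u * X + conjc (conjc u * X).
  apply: complex_ext; rewrite ?reD ?imD; case: (u) (X) => [? ?] [? ?] /=; ring.
have -> : Re (u * (g w + conjc (g c))) = cavg (fun t => Re (u * (2 * Re (g (circ c r t)))%:C * cker c w (circ c r t))).
  have -> : Re (u * (g w + conjc (g c))) = Re (u * g w) + Re (conjc u * g c).
    by rewrite mulrDr reD; congr (_ + _); rewrite !reM; case: (u) (g c) => [? ?] [? ?] /=; ring.
  rewrite -Eu -Mu -(cavgD c1 c2); apply: eq_cavg => t.
  by rewrite uE mulrDl reD.
have -> : 2 * Re (g c) * (r / (r - cmod (w - c))) =
    cavg (fun t => 2 * (r / (r - cmod (w - c))) * Re (g (circ c r t))).
  by rewrite (cavgZ _ cg) (mean_value rR0 H); ring.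
have cE : (fun t => Re (u * (2 * Re (g (circ c r t)))%:C * cker c w (circ c r t))) =
    (fun t => Re (u * g (circ c r t) * cker c w (circ c r t)) +
      Re (conjc (conjc u * g (circ c r t)) * cker c w (circ c r t))).
  by apply/funext => t; rewrite uE mulrDl reD.
apply: le_cavg.
- by rewrite cE => t; apply: cvgD; [exact: c1|exact: c2].
- by move=> t; apply: cvgM; [exact: cvg_cst|exact: cg].
move=> t; apply: le_trans (Re_cmod _) _.
have gz : 0 <= Re (g (circ c r t)).
  by apply: g0; rewrite cmod_circ ger0_norm ?ltW.
rewrite (cmodM _ (cker _ _ _)) (cmodM u) u1 mul1r cmod_real ger0_norm ?mulr_ge0//.
by rewrite [X in _ <= X]mulrAC ler_wpM2l ?mulr_ge0// cmod_cker.
Qed.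

Lemma continuous_sum N (h : nat -> R -> R) : (forall n, continuous (h n)) ->
  continuous (fun t => \sum_(n < N) h n t).
Proof.
move=> ch; elim: N => [|N IH] t.
  have -> : (fun t => \sum_(n < 0) h n t) = fun=> 0.
    by apply/funext => x; rewrite big_ord0.
  exact: cvg_cst.
have -> : (fun t => \sum_(n < N.+1) h n t) = fun t => \sum_(n < N) h n t + h N t.
  by apply/funext => x; rewrite big_ord_recr.
by apply: cvgD; [exact: IH|exact: ch].
Qed.

Lemma cavg_sum N (h : nat -> R -> R) : (forall n, continuous (h n)) ->
  cavg (fun t => \sum_(n < N) h n t) = \sum_(n < N) cavg (h n).
Proof.
move=> ch; elim: N => [|N IH].
  by rewrite big_ord0 -[RHS]cavg_cst; apply: eq_cavg => t; rewrite big_ord0.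
rewrite big_ord_recr/= -IH -cavgD//; last exact: continuous_sum.
by apply: eq_cavg => t; rewrite big_ord_recr.
Qed.

Definition cavgC (F : R -> C) : C :=
  cavg (fun t => Re (F t)) +i* cavg (fun t => Im (F t)).

Lemma Re_cavgC u (F : R -> C) :
  continuous (fun t => Re (F t)) -> continuous (fun t => Im (F t)) ->
  Re (u * cavgC F) = cavg (fun t => Re (u * F t)).
Proof.
move=> cR cI; rewrite reM /cavgC/= -(cavgZ _ cR) -(cavgZ _ cI) -cavgB.
- by apply: eq_cavg => t; rewrite reM.
- by move=> t; apply: cvgM; [exact: cvg_cst|exact: cR].
- by move=> t; apply: cvgM; [exact: cvg_cst|exact: cI].
Qed.

Lemma continuous_Im_circ (F : C -> C) c (r : R) :
  (forall t, {for circ c r t, continuous (F : C^o -> C^o)}) ->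
  continuous (fun t => Im (F (circ c r t))).
Proof.
move=> HF t.
have h : circ c r @ nbhs t --> (circ c r t : C^o).
  by apply: cvg_circ; [exact: cvg_cst|exact: cvg_id].
have := cvg_comp _ _ h (HF t); exact: cvgC_Im.
Qed.

(** Expand the Cauchy kernel as a geometric series with explicit remainder. *)
Lemma Taylor_approx f (R0 r rho B e : R) : 0 < r < R0 -> 0 <= rho < r ->
  holo_disc f 0 R0 -> (forall z, cmod z < R0 -> cmod (f z) <= B) -> 0 < e ->
  exists (N : nat) (a : nat -> C), forall w, cmod w <= rho ->
    cmod (f w - \sum_(n < N) a n * w ^+ n) <= e.
Proof.
move=> rR0 /andP[rho0 rhor] H HB e0; have /andP[r0 rR] := rR0.
pose a n := cavgC (fun t => f (circ 0 r t) * (circ 0 r t)^-1 ^+ n).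
pose q := rho / r.
have q0 : 0 <= q by rewrite divr_ge0// ltW.
have q1 : q < 1 by rewrite ltr_pdivrMr// mul1r.
have B0 : 0 <= B by apply: le_trans (cmod_ge0 _) (HB 0 _); rewrite cmod0; lra.
pose K := B * (r / (r - rho)).
have K0 : 0 <= K by rewrite mulr_ge0// divr_ge0; lra.
have [N qN] : exists N, K * q ^+ N <= e.
  have /cvgrPdist_lt/(_ (e / (K + 1))) : q ^+ n @[n --> \oo] --> (0 : R).
    by apply: cvg_expr; rewrite ger0_norm.
  have K1 : 0 < K + 1 by lra.
  move=> /(_ (divr_gt0 e0 K1)) [N _ /(_ N (leqnn N))] /=.
  rewrite sub0r normrN ger0_norm ?exprn_ge0// ltr_pdivlMr// => h.
  by exists N; have := exprn_ge0 N q0; lra.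
exists N, a => w wrho.
have wr : cmod (w - 0) < r by rewrite subr0; lra.
have zn0 t : circ 0 r t != 0.
  by rewrite -cmod_gt0 -[circ _ _ _]subr0 cmod_circ normr_gt0 gt_eqF.
have mz t : cmod (circ 0 r t) = r.
  by rewrite -[circ _ _ _]subr0 cmod_circ gtr0_norm.
have mzR t : cmod (circ 0 r t) < R0 by rewrite mz.
have hf z : cmod z < R0 -> hol f z by move=> ?; apply: H; rewrite subr0.
have [u u1 <-] := cmod_rot (f w - \sum_(n < N) a n * w ^+ n).
have Hu : holo_disc (fun z => u * f z) 0 R0.
  by move=> z /H hz; exact: (holM (hol_cst _ _) hz).
have Eu := Cauchy_formula rR0 wr Hu.
have c1 := continuous_Cauchy rR0 wr Hu.
have hn n t : hol (fun z => f z * z^-1 ^+ n) (circ 0 r t).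
  apply: holM; first exact: hf.
  by apply: holX; apply: holV => //; exact: hol_id.
have cn n t : {for circ 0 r t, continuous ((fun z => f z * z^-1 ^+ n) : C^o -> C^o)}.
  exact: hol_continuous.
pose hh n t := Re (u * w ^+ n * (f (circ 0 r t) * (circ 0 r t)^-1 ^+ n)).
have cn' n : continuous (hh n).
  apply: (@continuous_Re_circ (fun z => u * w ^+ n * (f z * z^-1 ^+ n))) => t.
  by apply: hol_continuous; exact: (holM (hol_cst _ _) (hn n t)).
have ES : Re (u * \sum_(n < N) a n * w ^+ n) =
    cavg (fun t => \sum_(n < N) hh n t).
  rewrite (cavg_sum N cn'); rewrite mulr_sumr (big_morph _ reD (erefl (Re (0 : C)))).
  apply: eq_bigr => n _; rewrite [_ * w ^+ n]mulrC mulrA -Re_cavgC//.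
    exact: (continuous_Re_circ (cn n)).
  exact: (continuous_Im_circ (cn n)).
have c2 : continuous (fun t => \sum_(n < N) hh n t) by exact: continuous_sum.
rewrite mulrBr reD reN -Eu ES -(cavgB c1 c2) -[X in _ <= X]cavg_cst.
apply: le_cavg.
- by move=> t; apply: cvgB; [exact: c1|exact: c2].
- by move=> t; exact: cvg_cst.
move=> t; set z := circ 0 r t.
have zw : z - w != 0 by exact: circ_neq.
pose x := w / z.
have -> : \sum_(n < N) hh n t =
    Re (u * f z * \sum_(n < N) x ^+ n).
  rewrite mulr_sumr (big_morph _ reD (erefl (Re (0 : C)))).
  apply: eq_bigr => n _; congr Re.
  by rewrite /x exprMn mulrACA.
have kx : cker 0 w z * (1 - x) = 1.
  have zz : z / z = 1 by rewrite divff// zn0.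
  rewrite /cker subr0 -zz -mulrBl mulrA mulfVK// zz//.
have -> : u * f z * cker 0 w z = u * f z * \sum_(n < N) x ^+ n +
    u * f z * (cker 0 w z * x ^+ N).
  have -> : \sum_(n < N) x ^+ n = cker 0 w z * (1 - x ^+ N).
    rewrite -[LHS]mul1r -{1}kx -mulrA; congr (_ * _).
    by apply: oppr_inj; rewrite -mulNr !opprB subrX1.
  by rewrite -mulrDr -mulrDr subrK mulr1.
rewrite reD addrAC subrr add0r; apply: le_trans (Re_cmod _) _.
rewrite (cmodM (u * f z)) (cmodM u) u1 mul1r (cmodM (cker _ _ _)) cmodX.
apply: le_trans qN; rewrite /K -mulrA; apply: ler_pM => //.
- by rewrite mulr_ge0// exprn_ge0.
- exact: (HB _ (mzR t)).
apply: ler_pM => //; first by rewrite exprn_ge0.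
  apply: le_trans (cmod_cker _ r0 wr) _; rewrite ler_pM2l// subr0.
  by rewrite lef_pV2 ?posrE; lra.
rewrite lerXn2r ?nnegrE//; rewrite /x cmodM cmodV mz /q ler_pM2r ?invr_gt0//.
Qed.

End CircleMeans.

(** * Integrals over vertical lines *)

Section LineIntegrals.
Context {R : realType}.

(** Monotonicity without measurability: the integral of a nonnegative function is
    a supremum over the simple functions below it. *)
Lemma ge0_le_integral_nomeas d (T : measurableType d) (m : {measure set T -> \bar R})
    (D : set T) (f1 f2 : T -> \bar R) : (forall s, D s -> 0 <= f1 s)%E ->
  (forall s, D s -> f1 s <= f2 s)%E ->
  (\int[m]_(x in D) f1 x <= \int[m]_(x in D) f2 x)%E.
Proof.
move=> f10 f12; rewrite !(integral_mkcond D).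
have h1 x : (0 <= (f1 \_ D) x)%E by apply: erestrict_ge0.
have h2 x : (0 <= (f2 \_ D) x)%E.
  by apply: erestrict_ge0 => // t Dt; exact: le_trans (f10 _ Dt) (f12 _ Dt).
rewrite !ge0_integralTE//; apply: ereal_sup_le => _ [h hf <-]; exists h => // x.
by apply: le_trans (hf x) _; exact: lee_restrict.
Qed.

Local Notation mu := (@lebesgue_measure R).
Implicit Types (h : R -> R).

Definition Lint h : \bar R := (\int[mu]_y (h y)%:E)%E.

Lemma Lint_meas h : continuous h -> measurable_fun setT (EFin \o h).
Proof. by move=> ch; apply/measurable_EFinP; exact: continuous_measurable_fun. Qed.

Lemma Lint_ge0 h : (forall y, 0 <= h y) -> (0 <= Lint h)%E.
Proof. by move=> h0; apply: integral_ge0 => y _; rewrite lee_fin. Qed.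

Lemma Lint_fatou (H : nat -> R -> R) h (K : \bar R) :
  (forall n, continuous (H n)) -> (forall n y, 0 <= H n y) ->
  (forall y, H n y @[n --> \oo] --> h y) -> (forall n, (Lint (H n) <= K)%E) ->
  (Lint h <= K)%E.
Proof.
move=> cH H0 Hh HK; pose F n y : \bar R := (H n y)%:E.
have E y : limn_einf (F ^~ y) = (h y)%:E.
  have c : F n y @[n --> \oo] --> (h y)%:E by apply: cvg_EFin; [exact: nearW|exact: Hh].
  rewrite is_cvg_limn_einfE; last by apply/cvg_ex; exists (h y)%:E.
  exact/cvg_lim.
rewrite /Lint; under eq_integral do rewrite -E.
apply: le_trans (fatou _ _ _ _) _ => //.
- by move=> n; exact: Lint_meas.
- by move=> n y _; rewrite lee_fin.
rewrite limn_einf_lim; apply: lime_le; first exact: is_cvg_einfs.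
apply: nearW => n; apply: le_trans (HK n); apply: ereal_inf_lbound.
by exists n => /=.
Qed.

Lemma LintD h1 h2 : continuous h1 -> continuous h2 -> (forall y, 0 <= h1 y) ->
  (forall y, 0 <= h2 y) -> Lint (fun y => h1 y + h2 y) = (Lint h1 + Lint h2)%E.
Proof.
move=> c1 c2 p1 p2; rewrite /Lint -ge0_integralD//; try exact: Lint_meas.
- by move=> y _; rewrite lee_fin.
- by move=> y _; rewrite lee_fin.
Qed.

Lemma LintZ h (k : R) : continuous h -> (forall y, 0 <= h y) -> 0 <= k ->
  Lint (fun y => k * h y) = (k%:E * Lint h)%E.
Proof.
move=> ch h0 k0; rewrite /Lint -ge0_integralZl//; first exact: Lint_meas.
by move=> y _; rewrite lee_fin.
Qed.

Lemma Lint_shift h (a : R) : continuous h -> (forall y, 0 <= h y) ->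
  Lint (fun y => h (y + a)) = Lint h.
Proof.
move=> ch h0; pose F (y : R) := y + a.
have dF : (F^`())%classic = cst 1.
  apply/funext => x; rewrite derive1E.
  exact: (@derive_val _ _ _ _ _ _ _ (@is_derive_shift R x 1 a)).
rewrite /Lint (@increasing_ge0_integration_by_substitutionT R F h).
- by apply: eq_integral => y _; rewrite /= dF mulr1.
- by move=> x y xy; rewrite ltrD2r.
- by rewrite dF; exact: cst_continuous.
- by rewrite dF; exact: is_cvg_cst.
- by rewrite dF; exact: is_cvg_cst.
- by move=> x; exact: (@ex_derive _ _ _ _ _ _ _ (@is_derive_shift R x 1 a)).
- apply/cvgrNyPle => A; near=> x; rewrite /F -lerBrDr.
  by near: x; apply: nbhs_ninfty_le; rewrite num_real.
- apply/cvgryPge => A; near=> x; rewrite /F -lerBlDr.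
  by near: x; apply: nbhs_pinfty_ge; rewrite num_real.
- exact: ch.
- exact: h0.
Unshelve. all: by end_near. Qed.

(** An open subset of the plane is a countable union of rational squares, hence
    is measurable for the product sigma-algebra. *)
Lemma open_measurable2 (O : set (R * R)) : open O -> measurable O.
Proof.
move=> oO.
pose box (i : rat * rat * nat) : set (R * R) :=
  ball (ratr i.1.1 : R) (i.2.+1%:R^-1) `*` ball (ratr i.1.2 : R) (i.2.+1%:R^-1).
pose F i := if `[< box i `<=` O >] then box i else set0.
have -> : O = \bigcup_i F i.
  apply/seteqP; split => [[a b] ab|[a b] [i _]]; last first.
    by rewrite /F; case: ifPn => // /asboolP; exact.
  have /nbhs_ballP[d /= d0 Hd] : nbhs (a, b) O by apply: open_nbhs_nbhs.
  have [n nd] : exists n : nat, n.+1%:R^-1 < d / 2.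
    have d20 : 0 < (d / 2)^-1 by rewrite invr_gt0; lra.
    exists (Num.bound (d / 2)^-1); rewrite invf_plt ?posrE ?divr_gt0//.
    by apply: lt_trans (archi_boundP (ltW d20)) _; rewrite ltr_nat.
  have n0 : 0 < n.+1%:R^-1 :> R by rewrite invr_gt0.
  have [q1 /andP[q1a q1b]] : exists q : rat, (ratr q : R) \in `]a - n.+1%:R^-1, a + n.+1%:R^-1[.
    by apply: rat_in_itvoo; rewrite ltrBlDr -addrA ltrDl addr_gt0.
  have [q2 /andP[q2a q2b]] : exists q : rat, (ratr q : R) \in `]b - n.+1%:R^-1, b + n.+1%:R^-1[.
    by apply: rat_in_itvoo; rewrite ltrBlDr -addrA ltrDl addr_gt0.
  rewrite !bnd_simp in q1a q1b q2a q2b.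
  pose e : R := n.+1%:R^-1; rewrite -/e in nd n0 q1a q1b q2a q2b.
  exists (q1, q2, n) => //; rewrite /F ifT.
    by split; rewrite /ball/= -/e ltr_norml; lra.
  apply/asboolP => -[x y] [/=]; rewrite /ball/= -/e !ltr_norml => hx hy.
  by apply: Hd; split; rewrite /ball/= ltr_norml; lra.
apply: countable_bigcupT_measurable => [|i]; first exact: countableP.
rewrite /F; case: ifP => // _; apply: measurableX; apply: open_measurable; exact: ball_open.
Qed.

Lemma continuous_measurable2 (V : R * R -> R) : continuous V ->
  measurable_fun setT V.
Proof.
move=> cV; apply: (measurability _ (RGenOInfty.measurableE R)).
move=> /= _ [_ [a ->]] <-; rewrite setTI; apply: open_measurable2.
apply: open_comp; first by move=> q _; exact: cV.
exact: interval_open.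
Qed.

Lemma cavg_integral h : continuous h -> (forall t, 0 <= h t) ->
  (cavg h)%:E = ((pi *+ 2)^-1%:E * \int[mu]_(t in `[0%R, (pi *+ 2)%R]) (h t)%:E)%E.
Proof.
move=> ch h0; rewrite /cavg EFinM; congr (_ * _)%E.
rewrite /Iseg /Rintegral fineK//; apply: integrable_fin_num => //.
exact: contin_integrable (continuous_contin ch).
Qed.

Lemma cavg_ge0 h : continuous h -> (forall t, 0 <= h t) -> 0 <= cavg h.
Proof.
move=> ch h0; rewrite -[0](cavg_cst 0); apply: le_cavg => // t; exact: cvg_cst.
Qed.

Section CircleMeanUnderLineIntegral.
Variable V : R * R -> R.
Hypothesis cV : continuous V.
Hypothesis V0 : forall q, 0 <= V q.
Let I := [set` `[0%R, (pi *+ 2 : R)%R]].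
Let W (q : R * R) : \bar R := ((V q)%:E * (\1_I q.2)%:E)%E.

Let mW : measurable_fun setT W.
Proof.
apply: emeasurable_funM; first by apply/measurable_EFinP; exact: continuous_measurable2.
apply/measurable_EFinP; apply: measurableT_comp; last exact: measurable_snd.
by apply: measurable_indic; exact: measurable_itv.
Qed.

Let W0 q : (0 <= W q)%E.
Proof. by rewrite mule_ge0// lee_fin. Qed.

Let cV1 y : continuous (fun t => V (y, t)).
Proof.
move=> t; have h : (fun t => (y, t)) @ nbhs t --> (y, t).
  by apply: (@cvg_pair _ _ _ (nbhs t) (nbhs y) (nbhs t) _ _ _ (fun=> y) id);
    [exact: cvg_cst|exact: cvg_id].
exact: (cvg_comp _ _ h (@cV (y, t))).
Qed.

Let cV2 t : continuous (fun y => V (y, t)).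
Proof.
move=> y; have h : (fun y => (y, t)) @ nbhs y --> (y, t).
  by apply: (@cvg_pair _ _ _ (nbhs y) (nbhs y) (nbhs t) _ _ _ id (fun=> t));
    [exact: cvg_id|exact: cvg_cst].
exact: (cvg_comp _ _ h (@cV (y, t))).
Qed.

Let cavgW y : (cavg (fun t => V (y, t)))%:E = ((pi *+ 2)^-1%:E * \int[mu]_t W (y, t))%E.
Proof.
rewrite (cavg_integral (@cV1 y) (fun t => V0 (y, t))); congr (_ * _)%E.
by rewrite integral_mkcond; apply: eq_integral => t _; rewrite /W epatch_indic.
Qed.

Lemma measurable_cavg : measurable_fun setT (fun y => cavg (fun t => V (y, t))).
Proof.
apply/measurable_EFinP.
have -> : EFin \o (fun y => cavg (fun t => V (y, t))) =
    (fun y => (pi *+ 2)^-1%:E * \int[mu]_t W (y, t))%E.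
  by apply/funext => y; exact: cavgW.
apply: emeasurable_funM; first exact: measurable_cst.
exact: (@measurable_fun_fubini_tonelli_F _ _ _ _ _ mu W mW W0).
Qed.

(** Tonelli's theorem; [W] extends the integrand by zero outside one period. *)
Lemma Lint_cavg :
  (\int[mu]_y (cavg (fun t => V (y, t)))%:E)%E =
  ((pi *+ 2)^-1%:E * \int[mu]_(t in `[0%R, (pi *+ 2)%R]) Lint (fun y => V (y, t)))%E.
Proof.
have E2 t : (\int[mu]_y W (y, t) = Lint (fun y => V (y, t)) * (\1_I t)%:E)%E.
  rewrite muleC -ge0_integralZl//.
  - by apply: eq_integral => y _; rewrite /W muleC.
  - by apply/measurable_EFinP; exact: continuous_measurable_fun.
  - by move=> y _; rewrite lee_fin.
have p0 : (0 <= (pi *+ 2)^-1%:E :> \bar R)%E by rewrite lee_fin invr_ge0 ltW// pi2_gt0.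
under eq_integral do rewrite cavgW.
have mF : measurable_fun setT (fun y => \int[mu]_t W (y, t))%E :=
  @measurable_fun_fubini_tonelli_F _ _ _ _ _ mu W mW W0.
have F0 (y : R) : setT y -> (0%R <= \int[mu]_t W (y, t))%E.
  by move=> _; apply: integral_ge0.
rewrite (ge0_integralZl mu measurableT mF F0 p0).
congr (_ * _)%E; rewrite (@fubini_tonelli _ _ _ _ _ mu mu W mW W0).
under eq_integral do rewrite E2.
by rewrite [RHS]integral_mkcond; apply: eq_integral => t _; rewrite epatch_indic.
Qed.

End CircleMeanUnderLineIntegral.

End LineIntegrals.

(** * Powers, Jensen's inequality and growth of Hardy functions *)

Section PowersAndJensen.
Context {R : realType}.
Implicit Types (a b m t p x y : R).

Lemma le_powR p x y : 0 <= p -> 0 <= x -> x <= y -> x `^ p <= y `^ p.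
Proof.
move=> p0 x0 xy; apply: ge0_ler_powR => //; rewrite nnegrE//.
exact: le_trans xy.
Qed.

Lemma powRVK p x : 0 < p -> 0 <= x -> (x `^ p^-1) `^ p = x.
Proof. by move=> p0 x0; rewrite -powRrM mulVf ?gt_eqF// powRr1. Qed.

Lemma powRKV p x : 0 < p -> 0 <= x -> (x `^ p) `^ p^-1 = x.
Proof. by move=> p0 x0; rewrite -powRrM mulfV ?gt_eqF// powRr1. Qed.

Lemma cvg_powR (T : Type) (F : set_system T) {FF : Filter F} (f : T -> R) (l p : R) :
  0 < p -> (forall s, 0 <= f s) -> 0 <= l -> f @ F --> l ->
  (fun s => f s `^ p) @ F --> l `^ p.
Proof.
move=> p0 f0; rewrite le_eqVlt => /orP[/eqP <-|l0] fl; last first.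
  have cl : {for l, continuous (fun x => x `^ p)}.
    apply: differentiable_continuous.
    by apply/derivable1_diffP; apply: derivable_powR; rewrite in_itv/= l0.
  exact: (cvg_comp _ _ fl cl).
rewrite powR0 ?gt_eqF//; apply/cvgrPdist_lt => e e0.
have e1 : 0 < e `^ p^-1 by rewrite powR_gt0.
move/cvgrPdist_lt: fl => /(_ _ e1); apply: filterS => t.
rewrite !sub0r !normrN ger0_norm// ger0_norm ?powR_ge0// => fe.
rewrite -(powRVK p0 (ltW e0)); by apply: gt0_ltr_powR => //; rewrite nnegrE ?powR_ge0.
Qed.

(** Convexity as a tangent line, the form in which it implies Jensen's
    inequality and midpoint convexity. *)
Lemma powR_tangent p m t : 1 <= p -> 0 <= m -> 0 <= t ->
  m `^ p + p * m `^ (p - 1) * (t - m) <= t `^ p.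
Proof.
rewrite le_eqVlt => /orP[/eqP <-|p1] m0 t0.
  by rewrite subrr !powRr1// powRr0 !mul1r addrC subrK.
have p0 : 0 < p by lra.
have q0 : 0 < p / (p - 1) by rewrite divr_gt0//; lra.
have pq : p^-1 + (p / (p - 1))^-1 = 1.
  by field; rewrite !gt_eqF//; lra.
have := conjugate_powR t0 (powR_ge0 m (p - 1)) p0 q0 pq.
have -> : (m `^ (p - 1)) `^ (p / (p - 1)) = m `^ p.
  by rewrite -powRrM mulrCA divff ?mulr1//; rewrite gt_eqF//; lra.
have -> : t `^ p / p + m `^ p / (p / (p - 1)) = (t `^ p + (p - 1) * m `^ p) / p.
  by field; rewrite !gt_eqF//; lra.
rewrite ler_pdivlMr// => H.
have E : m * m `^ (p - 1) = m `^ p by rewrite mulr_powRB1.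
have -> : p * m `^ (p - 1) * (t - m) = t * m `^ (p - 1) * p - p * (m * m `^ (p - 1)).
  by ring.
rewrite E; lra.
Qed.

Lemma continuous_powR (h : R -> R) p : 0 < p -> continuous h -> (forall t, 0 <= h t) ->
  continuous (fun t => h t `^ p).
Proof. by move=> p0 ch h0 t; apply: cvg_powR => //; exact: ch. Qed.

Lemma Jensen_powR (h : R -> R) p : 1 <= p -> continuous h -> (forall t, 0 <= h t) ->
  cavg h `^ p <= cavg (fun t => h t `^ p).
Proof.
move=> p1 ch h0; set m := cavg h.
have m0 : 0 <= m by exact: cavg_ge0.
pose k := p * m `^ (p - 1).
have c1 : continuous (fun t => k * h t).
  by move=> t; apply: cvgM; [exact: cvg_cst|exact: ch].
have cc (c : R) : continuous (fun t : R => c) by move=> t; exact: cvg_cst.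
have -> : m `^ p = cavg (fun t => (m `^ p - k * m) + k * h t).
  by rewrite (cavgD (cc _) c1) cavg_cst (cavgZ _ ch) -/m subrK.
apply: le_cavg.
- by move=> t; apply: cvgD; [exact: cvg_cst|exact: c1].
- by apply: continuous_powR => //; lra.
move=> t; have := powR_tangent p1 m0 (h0 t); rewrite -/k; lra.
Qed.

Lemma Jensen_le (h : R -> R) p x : 1 <= p -> continuous h -> (forall t, 0 <= h t) ->
  0 <= x -> x <= cavg h -> x `^ p <= cavg (fun t => h t `^ p).
Proof.
move=> p1 ch h0 x0 xh; apply: le_trans (Jensen_powR p1 ch h0).
by apply: le_powR => //; lra.
Qed.

End PowersAndJensen.

Section HardySpace.
Context {R : realType}.
Local Notation C := R[i].
Local Notation mu := (@lebesgue_measure R).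
Implicit Types (f g phi psi : C -> C) (U : C -> R) (z w : C) (p r t x y B K : R).

Definition cont_Pi U := forall z, 0 < Re z -> {for z, continuous (U : C^o -> R)}.

Definition hol_Pi f := forall z, 0 < Re z -> hol f z.

Definition lpow p f x y : R := cmod (f (x +i* y)) `^ p.

(** Up to the normalisation [1 / pi] and the [p]-th root this is a bound on the
    Hardy norm, see [hardy_norm_le]. *)
Definition hp_le p f B := forall x, 0 < x -> (Lint (lpow p f x) <= B%:E)%E.

Lemma cont_Pi_line U x : cont_Pi U -> 0 < x -> continuous (fun y => U (x +i* y)).
Proof.
move=> cU x0 y; have h : (fun y => x +i* y) @ nbhs y --> (x +i* y : C^o).
  by apply: cvgC_pair; [exact: cvg_cst|exact: cvg_id].
exact: (cvg_comp _ _ h (cU (x +i* y) x0)).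
Qed.

Lemma Re_circ c r t : Re (circ c r t) = Re c + r * cos t.
Proof. by rewrite /circ reD. Qed.

Lemma Re_circ_gt0 c r t : `|r| < Re c -> 0 < Re (circ c r t).
Proof.
move=> rc; rewrite Re_circ; have : `|r * cos t| <= `|r|.
  by rewrite normrM ler_piMr// cos_max.
by rewrite ler_norml => /andP[]; lra.
Qed.

Lemma cont_Pi_circ2 U x r : cont_Pi U -> `|r| < x ->
  continuous (fun q : R * R => U (circ (x +i* q.1) r q.2)).
Proof.
move=> cU rx [y t].
have h : (fun q : R * R => circ (x +i* q.1) r q.2) @ nbhs (y, t) -->
    (circ (x +i* y) r t : C^o).
  have h2 : (fun q : R * R => q.2) @ nbhs (y, t) --> t by exact: cvg_snd.
  apply: (@cvgD _ C^o).
    by apply: cvgC_pair; [exact: cvg_cst|exact: cvg_fst].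
  apply: cvgC_pair; apply: cvgM; try exact: cvg_cst.
    exact: (cvg_comp _ _ h2 (@continuous_cos R t)).
  exact: (cvg_comp _ _ h2 (@continuous_sin R t)).
exact: (cvg_comp _ _ h (cU _ (@Re_circ_gt0 (x +i* y) r t rx))).
Qed.

Lemma cont_Pi_circ U c r : cont_Pi U -> `|r| < Re c ->
  continuous (fun t => U (circ c r t)).
Proof.
move=> cU rx t; have h : circ c r @ nbhs t --> (circ c r t : C^o).
  by apply: cvg_circ; [exact: cvg_cst|exact: cvg_id].
exact: (cvg_comp _ _ h (cU _ (Re_circ_gt0 t rx))).
Qed.

(** Tonelli's theorem, and translation invariance of the line integrals along
    the line. *)
Lemma Lint_circ U x r : cont_Pi U -> (forall z, 0 <= U z) -> `|r| < x ->
  (\int[mu]_y (cavg (fun t => U (circ (x +i* y) r t)))%:E =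
  (pi *+ 2)^-1%:E * \int[mu]_(t in `[0%R, (pi *+ 2)%R])
    Lint (fun y => U ((x + r * cos t)%R +i* y)))%E.
Proof.
move=> cU U0 rx.
rewrite (Lint_cavg (cont_Pi_circ2 cU rx)); last by move=> q; exact: U0.
congr (_ * _)%E; apply: eq_integral => t _.
have x0 : 0 < x + r * cos t by exact: (@Re_circ_gt0 (x +i* 0) r t rx).
rewrite -[RHS](Lint_shift (r * sin t))//; last exact: cont_Pi_line.
Qed.

Lemma Lint_circ_le U x r K : cont_Pi U -> (forall z, 0 <= U z) -> `|r| < x ->
  (forall x, 0 < x -> (Lint (fun y => U (x +i* y)) <= K%:E)%E) ->
  (\int[mu]_y (cavg (fun t => U (circ (x +i* y) r t)))%:E <= K%:E)%E.
Proof.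
move=> cU U0 rx HK; rewrite (Lint_circ cU U0 rx).
have p0 := @pi2_gt0 R.
have K0 : 0 <= K.
  by rewrite -lee_fin (le_trans (Lint_ge0 _) (HK 1 ltr01)).
have -> : K%:E = ((pi *+ 2)^-1%:E * (K * (pi *+ 2))%:E)%E.
  by rewrite -EFinM mulrC mulfK// gt_eqF.
rewrite lee_pmul2l//; last by rewrite lte_fin invr_gt0.
have -> : (K * (pi *+ 2))%:E = (\int[mu]_(t in `[0%R, (pi *+ 2)%R]) K%:E)%E.
  rewrite integral_cst//= lebesgue_measure_itv/= lte_fin p0.
  by rewrite oppr0 adde0 -EFinM.
apply: ge0_le_integral_nomeas => t _; first by apply: Lint_ge0.
by apply: HK; exact: (@Re_circ_gt0 (x +i* 0) r t rx).
Qed.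

Lemma hol_Pi_cmod f : hol_Pi f -> cont_Pi (fun z => cmod (f z)).
Proof. by move=> hf z z0; exact: (cvgC_cmod (hol_continuous (hf z z0))). Qed.

Lemma hol_Pi_pow f p : 0 < p -> hol_Pi f -> cont_Pi (fun z => cmod (f z) `^ p).
Proof.
move=> p0 hf z z0.
have h := hol_Pi_cmod hf z0.
by apply: (@cvg_powR _ _ (nbhs (z : C^o)) _ (fun w => cmod (f w)) (cmod (f z))).
Qed.

Lemma hol_Pi_disc f c r : hol_Pi f -> r <= Re c -> holo_disc f c r.
Proof.
move=> hf rc z zc; apply: hf.
have := normRe_cmod (z - c); rewrite reD reN ler_norml => /andP[]; lra.
Qed.

(** [Cauchy_bound] and Jensen's inequality; on the half-size disc the constant
    is uniform. *)
Lemma circle_dom p f c w r : 1 <= p -> hol_Pi f -> 0 < r < Re c ->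
  cmod (w - c) <= r / 2 ->
  cmod (f w) `^ p <= 2 `^ p * cavg (fun t => cmod (f (circ c r t)) `^ p).
Proof.
move=> p1 hf rc wr; have /andP[r0 rR] := rc.
have wr' : cmod (w - c) < r by lra.
have hd : holo_disc f c (Re c) by exact: hol_Pi_disc.
have cf := continuous_cmod_circ rc (holo_cont_disc hd).
have a0 : 0 <= cavg (fun t => cmod (f (circ c r t))) by exact: cavg_ge0.
have : cmod (f w) <= 2 * cavg (fun t => cmod (f (circ c r t))).
  apply: le_trans (Cauchy_bound rc wr' hd) _; apply: ler_wpM2r => //.
  by rewrite ler_pdivrMr; lra.
move=> H; apply: le_trans (le_powR _ (cmod_ge0 _) H) _; first by lra.
rewrite powRM// ler_wpM2l ?powR_ge0//.
by apply: Jensen_powR.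
Qed.

(** A majorant of [lpow p f x'] for all [x'] near [x]. *)
Definition dom p f x y : R :=
  2 `^ p * cavg (fun t => cmod (f (circ (x +i* y) (x / 2) t)) `^ p).

Lemma dom_ge0 p f x y : 0 < p -> 0 < x -> hol_Pi f -> 0 <= dom p f x y.
Proof.
move=> p0 x0 hf; rewrite mulr_ge0 ?powR_ge0//; apply: cavg_ge0 => [|t].
  apply: (cont_Pi_circ (hol_Pi_pow p0 hf)).
  by rewrite /= ger0_norm; lra.
exact: powR_ge0.
Qed.

Lemma dom_le p f x x' y : 1 <= p -> hol_Pi f -> 0 < x -> `|x' - x| <= x / 4 ->
  cmod (f (x' +i* y)) `^ p <= dom p f x y.
Proof.
move=> p1 hf x0 xx; apply: circle_dom => //=; first by lra.
by rewrite cmodE/= subrr expr0n/= addr0 sqrtr_sqr; lra.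
Qed.

Lemma measurable_dom p f x : 0 < p -> hol_Pi f -> 0 < x ->
  measurable_fun setT (dom p f x).
Proof.
move=> p0 hf x0; apply: measurable_funM; first exact: measurable_cst.
apply: (@measurable_cavg _ (fun q => cmod (f (circ (x +i* q.1) (x / 2) q.2)) `^ p)).
  by apply: (cont_Pi_circ2 (hol_Pi_pow p0 hf)); rewrite ger0_norm; lra.
by move=> q; exact: powR_ge0.
Qed.

Lemma Lint_dom p f x B : 0 < p -> hol_Pi f -> 0 < x -> hp_le p f B ->
  (\int[mu]_y (dom p f x y)%:E <= (2 `^ p * B)%:E)%E.
Proof.
move=> p0 hf x0 HB; rewrite /dom; under eq_integral do rewrite EFinM.
have rx : `|x / 2| < x by rewrite ger0_norm; lra.
have cU := hol_Pi_pow p0 hf.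
have c0 y : 0 <= cavg (fun t => cmod (f (circ (x +i* y) (x / 2) t)) `^ p).
  by apply: cavg_ge0 => [|t]; [exact: (cont_Pi_circ cU)|exact: powR_ge0].
rewrite ge0_integralZl//.
- rewrite EFinM lee_wpmul2l ?lee_fin ?powR_ge0//.
  by apply: (Lint_circ_le cU) => // z; exact: powR_ge0.
- apply/measurable_EFinP.
  apply: (@measurable_cavg _ (fun q => cmod (f (circ (x +i* q.1) (x / 2) q.2)) `^ p)).
    exact: (cont_Pi_circ2 cU).
  by move=> q; exact: powR_ge0.
- by move=> y _; rewrite lee_fin.
Qed.

Lemma integrable_dom p f x B : 0 < p -> hol_Pi f -> 0 < x -> hp_le p f B ->
  mu.-integrable setT (EFin \o dom p f x).
Proof.
move=> p0 hf x0 HB; apply/integrableP; split.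
  by apply/measurable_EFinP; exact: measurable_dom.
apply: le_lt_trans (ltry (2 `^ p * B)); apply: le_trans (Lint_dom p0 hf x0 HB).
apply: ge0_le_integral_nomeas => y _ /=; first by rewrite lee_fin.
by rewrite lee_fin ger0_norm// dom_ge0.
Qed.

(** Average [circle_dom] over a vertical segment of length comparable to
    [Re z]. *)
Lemma point_bound p f z B : 1 <= p -> hol_Pi f -> 0 < Re z -> hp_le p f B ->
  cmod (f z) `^ p <= 2 `^ p * (2 / Re z) * B.
Proof.
move=> p1 hf; case: z => x y0 /= x0 HB; set v := cmod _ `^ p.
have p0 : 0 < p by lra.
have v0 : 0 <= v by exact: powR_ge0.
have vd y : y0 - x / 4 <= y <= y0 + x / 4 -> v <= dom p f x y.
  move=> yy; apply: circle_dom => //=; first by lra.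
  by rewrite cmodE/= subrr expr0n/= add0r sqrtr_sqr ler_norml; lra.
have H : (\int[mu]_(y in `[(y0 - x / 4)%R, (y0 + x / 4)%R]) v%:E <= (2 `^ p * B)%:E)%E.
  apply: le_trans (Lint_dom p0 hf x0 HB).
  apply: (@le_trans _ _ (\int[mu]_(y in `[(y0 - x / 4)%R, (y0 + x / 4)%R]) (dom p f x y)%:E)%E).
    apply: ge0_le_integral_nomeas => y; rewrite /= in_itv/= lee_fin//.
    exact: vd.
  apply: ge0_subset_integral => //.
  - by apply/measurable_EFinP; exact: measurable_dom.
  - by move=> y _; rewrite lee_fin dom_ge0.
move: H; rewrite integral_cst//= lebesgue_measure_itv/= lte_fin.
rewrite ifT; last by lra.
rewrite -EFinD -EFinM lee_fin.
have -> : y0 + x / 4 - (y0 - x / 4) = x / 2 by field.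
rewrite mulrA ler_pdivrMr// -ler_pdivlMr//.
by have -> : 2 `^ p * B * 2 / x = 2 `^ p * (2 / x) * B by field; rewrite gt_eqF.
Qed.

End HardySpace.

(** * Monotonicity of integrals over vertical lines *)

Section Monotonicity.
Context {R : realType}.
Local Notation C := R[i].
Local Notation mu := (@lebesgue_measure R).
Implicit Types (f g phi psi : C -> C) (U : C -> R) (z w : C) (p r t x y B K : R).

Lemma cavg_cos : cavg (@cos R) = 0.
Proof.
have r1 : 0 < (1 : R) < 2 by lra.
have H : holo_disc (fun z : C => z) 0 2 by move=> z _; exact: hol_id.
have := mean_value r1 H; rewrite /= => <-.
by apply: eq_cavg => t; rewrite add0r mul1r.
Qed.

Lemma cavg_cos2 : cavg (fun t : R => cos t ^+ 2) = 2^-1.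
Proof.
have r1 : 0 < (1 : R) < 2 by lra.
have H : holo_disc (fun z : C => z ^+ 2) 0 2.
  by move=> z _; apply: holX; exact: hol_id.
have := mean_value r1 H; rewrite expr0n/= => E.
have cc : continuous (fun t : R => 2 * cos t ^+ 2).
  move=> t; apply: cvgM; first exact: cvg_cst.
  by apply: cvgM; exact: continuous_cos.
have c2 : continuous (fun t : R => cos t ^+ 2).
  by move=> t; apply: cvgM; exact: continuous_cos.
have : cavg (fun t : R => 2 * cos t ^+ 2 - 1) = 0.
  rewrite -[RHS]E; apply: eq_cavg => t.
  by rewrite !add0r !mul1r -!expr2 sin2cos2; ring.
rewrite (cavgB cc (fun t => @cvg_cst _ _ _ _ _)) cavg_cst (cavgZ _ c2); lra.
Qed.

(** Otherwise subtracting an increasing linear function from the bounded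
    function [M] and adding a small quadratic term gives a function with an
    interior maximum on a segment; the quadratic term makes this contradict the
    submean property. *)
Lemma submean_nonincreasing (M : R -> R) K :
  (forall x, 0 < x -> {for x, continuous M}) ->
  (forall x, 0 < x -> 0 <= M x <= K) ->
  (forall x0, 0 < x0 -> exists2 rho, 0 < rho < x0 & forall x r, x0 <= x -> 0 < r < rho ->
    M x <= cavg (fun t => M (x + r * cos t))) ->
  forall x1 x2, 0 < x1 -> x1 <= x2 -> M x2 <= M x1.
Proof.
move=> cM MK sM x1 x2 x10; rewrite le_eqVlt => /orP[/eqP->//|x12].
rewrite leNgt; apply/negP => M12.
pose k := (M x2 - M x1) / (2 * (x2 - x1)).
have k0 : 0 < k by rewrite divr_gt0 ?mulr_gt0//; lra.
have K0 : 0 <= K by have := MK x1 x10; lra.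
(* At [X] the linear term outweighs the bound [K]; [eta] makes the quadratic
   term at most 1/2 up to there. *)
pose X := x2 + (K + 1) / k.
have XK : 0 < (K + 1) / k by rewrite divr_gt0//; lra.
have x2X : x2 < X by rewrite /X; lra.
have X1 : 0 < (X - x1) ^+ 2 by rewrite exprn_gt0//; lra.
pose eta := (2 * (X - x1) ^+ 2)^-1.
have eta0 : 0 < eta by rewrite invr_gt0 mulr_gt0.
pose N x := M x - k * (x - x1) + eta * (x - x1) ^+ 2.
have x2p : 0 < x2 by lra.
have kx : k * (x2 - x1) = (M x2 - M x1) / 2.
  by rewrite /k; field; rewrite gt_eqF//; lra.
have N1 : N x1 = M x1 by rewrite /N subrr mulr0 subr0 expr0n/= mulr0 addr0.
have N2 : (M x1 + M x2) / 2 <= N x2.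
  rewrite /N kx; have : 0 <= eta * (x2 - x1) ^+ 2 by rewrite mulr_ge0 ?sqr_ge0 ?ltW.
  by lra.
have NX : N X < 0.
  have e1 : eta * (X - x1) ^+ 2 = 2^-1.
    by rewrite /eta; field; rewrite gt_eqF//; lra.
  have kX : k * (X - x1) = k * (x2 - x1) + (K + 1).
    by rewrite /X; field; rewrite gt_eqF.
  rewrite /N e1 kX; have := MK X (lt_trans x2p x2X).
  have : 0 < k * (x2 - x1) by rewrite mulr_gt0//; lra.
  by lra.
have cN : {within `[x1, X], continuous N}.
  apply: continuous_in_subspaceT => x; rewrite inE/= in_itv/= => /andP[xa xb].
  apply: cvgD.
    apply: cvgB; first by apply: cM; lra.
    by apply: cvgM; [exact: cvg_cst|apply: cvgB; [exact: cvg_id|exact: cvg_cst]].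
  apply: cvgM; first exact: cvg_cst.
  by apply: cvgM; (apply: cvgB; [exact: cvg_id|exact: cvg_cst]).
have x1X : x1 <= X by lra.
have [s] := EVT_max x1X cN; rewrite in_itv/= => /andP[s1 sX] Hs.
have x2in : x2 \in `[x1, X] by rewrite in_itv/=; lra.
have Ns := Hs _ x2in.
have := MK x1 x10; have := MK x2 x2p => /andP[M2p _] /andP[M1p _].
have s1' : x1 < s.
  by rewrite lt_neqAle s1 andbT; apply/eqP => E; move: Ns; rewrite -E N1; lra.
have sX' : s < X.
  by rewrite lt_neqAle sX andbT; apply/eqP => E; move: Ns; rewrite E; lra.
have [rho /andP[rho0 rhox] Hrho] := sM x1 x10.
pose r := Order.min (rho / 2) (Order.min (s - x1) (X - s)).
have r0 : 0 < r by rewrite !lt_min; apply/and3P; split; lra.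
have rrho : r <= rho / 2 by rewrite ge_min lexx.
have rs1 : r <= s - x1 by rewrite !ge_min lexx /= orbT.
have rsX : r <= X - s by rewrite !ge_min lexx /= !orbT.
have rr : 0 < r < rho by lra.
have := Hrho s r s1 rr.
pose c1 := (2 * eta * r * (s - x1) - k * r).
have ccos : continuous (fun t : R => - c1 * cos t).
  by move=> t; apply: cvgM; [exact: cvg_cst|exact: continuous_cos].
have c2 : continuous (fun t : R => cos t ^+ 2).
  by move=> t; apply: cvgM; exact: continuous_cos.
have ccos2 : continuous (fun t : R => (- (eta * r ^+ 2)) * cos t ^+ 2).
  by move=> t; apply: cvgM; [exact: cvg_cst|exact: c2].
have cc (c : R) : continuous (fun t : R => c) by move=> t; exact: cvg_cst.
have ca : continuous (fun t : R => M s + - c1 * cos t).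
  by move=> t; apply: cvgD; [exact: cc|exact: ccos].
have UB : cavg (fun t => M (s + r * cos t)) <=
    cavg (fun t => M s + - c1 * cos t + (- (eta * r ^+ 2)) * cos t ^+ 2).
  have scos t : x1 <= s + r * cos t <= X.
    have : `|r * cos t| <= r.
      by rewrite normrM (ger0_norm (ltW r0)) ler_piMr ?cos_max// ltW.
    by rewrite ler_norml; lra.
  apply: le_cavg.
  - move=> t.
    have h : (fun t => s + r * cos t) @ nbhs t --> s + r * cos t.
      apply: cvgD; first exact: cvg_cst.
      by apply: cvgM; [exact: cvg_cst|exact: continuous_cos].
    have cMs : {for s + r * cos t, continuous M} by apply: cM; have := scos t; lra.
    exact: (cvg_comp _ _ h cMs).
  - by move=> t; apply: cvgD; [exact: ca|exact: ccos2].
  move=> t; have xin : s + r * cos t \in `[x1, X] by rewrite in_itv/= scos.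
  have := Hs _ xin; rewrite /N /c1.
  set m1 := M (s + r * cos t); set m2 := M s; set u := cos t.
  have -> : (s + r * u - x1) ^+ 2 =
    (s - x1) ^+ 2 + 2 * r * (s - x1) * u + r ^+ 2 * u ^+ 2 by ring.
  by lra.
move: UB; rewrite (cavgD ca ccos2) (cavgD (cc _) ccos) cavg_cst.
have cosc : continuous (@cos R) by exact: continuous_cos.
rewrite (cavgZ _ cosc) (cavgZ _ c2) cavg_cos cavg_cos2 mulr0 addr0.
have : 0 < eta * r ^+ 2 by rewrite mulr_gt0// exprn_gt0.
by lra.
Qed.

(** Line integrals inherit the submean property of [U] by Tonelli's theorem, and
    continuity in [x] by domination. *)
Lemma Lint_nonincreasing U K : cont_Pi U -> (forall z, 0 <= U z) ->
  (forall x, 0 < x -> (Lint (fun y => U (x +i* y)) <= K%:E)%E) ->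
  (forall x, 0 < x -> exists rho (G : R -> R),
    [/\ 0 < rho < x, mu.-integrable setT (EFin \o G) &
     forall x' y, `|x' - x| < rho -> U (x' +i* y) <= G y]) ->
  (forall x0, 0 < x0 -> exists2 rho, 0 < rho < x0 & forall z r, x0 <= Re z ->
    0 < r < rho -> U z <= cavg (fun t => U (circ z r t))) ->
  forall x1 x2, 0 < x1 -> x1 <= x2 ->
    (Lint (fun y => U (x2 +i* y)) <= Lint (fun y => U (x1 +i* y)))%E.
Proof.
move=> cU U0 UK Ud Us x1 x2 x10 x12.
pose M x := fine (Lint (fun y => U (x +i* y))).
have ME x : 0 < x -> Lint (fun y => U (x +i* y)) = (M x)%:E.
  move=> x0; rewrite /M fineK// ge0_fin_numE ?Lint_ge0//.
  exact: le_lt_trans (UK _ x0) (ltry _).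
have UI x : 0 < x -> mu.-integrable setT (EFin \o (fun y => U (x +i* y))).
  move=> x0; apply/integrableP; split; first exact: (Lint_meas (cont_Pi_line cU x0)).
  apply: le_lt_trans (ltry K); apply: le_trans (UK _ x0).
  apply: ge0_le_integral_nomeas => y _ /=; first by rewrite lee_fin.
  by rewrite lee_fin ger0_norm.
have cM x : 0 < x -> {for x, continuous M}.
  move=> x0; have [rho [G [/andP[rho0 rhox] iG HG]]] := Ud x x0.
  have : {in `]x - rho, x + rho[%classic, continuous (fun l =>
      \int[mu]_(y in setT) U (l +i* y))}.
    apply: (@continuity_under_integral _ _ _ mu (fun l y => U (l +i* y)) setT measurableT (x - rho) (x + rho) _ _ G) => //.
    - by move=> x'; rewrite /= in_itv/= => hx; apply: UI; lra.
    - apply: aeW => y _ x'; rewrite inE/= in_itv/= => hx.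
      have h : (fun l => l +i* y) @ nbhs x' --> (x' +i* y : C^o).
        by apply: cvgC_pair; [exact: cvg_id|exact: cvg_cst].
      have x'0 : 0 < x' by lra.
      exact: (cvg_comp _ _ h (cU (x' +i* y) x'0)).
    - move=> x'; rewrite /= in_itv/= => hx; apply: aeW => y _.
      by rewrite ger0_norm//; apply: HG; rewrite ltr_norml; lra.
  by move=> H; apply: H; rewrite inE/= in_itv/=; lra.
have MK x : 0 < x -> 0 <= M x <= K.
  move=> x0; rewrite -!lee_fin -ME// UK// andbT.
  exact: Lint_ge0.
rewrite !ME//; last lra.
rewrite lee_fin; apply: (@submean_nonincreasing M K) => // x0 x00.
have [rho rho0 Hrho] := Us x0 x00; exists rho => // x r x0x rr.
have xp : 0 < x by lra.
have rx : `|r| < x by rewrite ger0_norm; lra.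
rewrite -lee_fin -ME//.
have sc t : 0 < x + r * cos t.
  exact: (@Re_circ_gt0 _ (x +i* 0) r t rx).
have cMc : continuous (fun t => M (x + r * cos t)).
  move=> t; have h : (fun t => x + r * cos t) @ nbhs t --> x + r * cos t.
    apply: cvgD; first exact: cvg_cst.
    by apply: cvgM; [exact: cvg_cst|exact: continuous_cos].
  exact: (cvg_comp _ _ h (cM _ (sc t))).
rewrite (cavg_integral cMc); last by move=> t; have /andP[] := MK _ (sc t).
have -> : (\int[mu]_(t in `[0%R, (pi *+ 2)%R]) (M (x + r * cos t))%:E =
    \int[mu]_(t in `[0%R, (pi *+ 2)%R]) Lint (fun y => U ((x + r * cos t)%R +i* y)))%E.
  by apply: eq_integral => t _; rewrite ME.
rewrite -(Lint_circ cU U0 rx); apply: ge0_le_integral_nomeas => y _.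
  by rewrite lee_fin.
by rewrite lee_fin; apply: Hrho.
Qed.

End Monotonicity.

Section SquareRoots.
Context {R : realType}.
Local Notation C := R[i].
Implicit Types (f g h phi psi : C -> C) (z w : C) (p r t x y B K eps : R).

Lemma sqrt_le (a x : R) : 0 <= a -> x <= a ^+ 2 -> Num.sqrt x <= a.
Proof. by move=> a0 h; rewrite -[X in _ <= X](ger0_norm a0) -sqrtr_sqr ler_wsqrtr. Qed.

Lemma le_sqrt (a x : R) : 0 <= a -> a ^+ 2 <= x -> a <= Num.sqrt x.
Proof. by move=> a0 h; rewrite -[X in X <= _](ger0_norm a0) -sqrtr_sqr ler_wsqrtr. Qed.

Lemma cmod_powR_le f z p K : 0 < p -> cmod (f z) `^ p <= K ->
  cmod (f z) <= K `^ p^-1.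
Proof.
move=> p0 H; rewrite -[X in X <= _](powRKV p0)//; apply: le_powR => //.
- by rewrite invr_ge0 ltW.
- exact: powR_ge0.
Qed.

Lemma hp_le_ge0 f p B : hp_le p f B -> 0 <= B.
Proof.
move=> H; rewrite -lee_fin (le_trans _ (H 1 ltr01))//.
by apply: Lint_ge0 => y; exact: powR_ge0.
Qed.

Lemma hardy_bounded f p B x0 : 1 <= p -> hol_Pi f -> hp_le p f B -> 0 < x0 ->
  exists2 K, 0 <= K & forall z, x0 <= Re z -> cmod (f z) <= K.
Proof.
move=> p1 hf HB x00; have B0 := hp_le_ge0 HB.
exists ((2 `^ p * (2 / x0) * B) `^ p^-1); first exact: powR_ge0.
move=> z x0z; have z0 : 0 < Re z by lra.
have p0 : 0 < p by lra.
apply: cmod_powR_le => //; apply: le_trans (point_bound p1 hf z0 HB) _.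
rewrite ler_wpM2r// ler_wpM2l ?powR_ge0// ler_wpM2l//.
by rewrite lef_pV2 ?posrE.
Qed.

(** A regularised square root of [cmod (h z)]. Subtracting [Num.sqrt eps] keeps
    it below the square root itself, so that its powers are integrable on
    lines. *)
Definition sqreg h eps z : R :=
  Num.sqrt (Num.sqrt (cmod (h z) ^+ 2 + eps ^+ 2)) - Num.sqrt eps.

Lemma sqreg_ge0 h eps z : 0 < eps -> 0 <= sqreg h eps z.
Proof.
move=> e0; rewrite subr_ge0 ler_wsqrtr//; apply: le_sqrt; first exact: ltW.
by rewrite lerDr sqr_ge0.
Qed.

Lemma sqreg_le h eps z : 0 < eps -> sqreg h eps z <= Num.sqrt (cmod (h z)).
Proof.
move=> e0; rewrite lerBlDr; set m := cmod (h z).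
have m0 : 0 <= m by exact: cmod_ge0.
have H1 : Num.sqrt (m ^+ 2 + eps ^+ 2) <= m + eps.
  apply: sqrt_le; first lra.
  by rewrite sqrrD; have := mulr_ge0 m0 (ltW e0); lra.
apply: le_trans (ler_wsqrtr H1) _.
have s0 : 0 <= Num.sqrt m + Num.sqrt eps by rewrite addr_ge0 ?sqrtr_ge0.
apply: sqrt_le => //; rewrite sqrrD (sqr_sqrtr m0) (sqr_sqrtr (ltW e0)).
by have := mulr_ge0 (sqrtr_ge0 m) (sqrtr_ge0 eps); lra.
Qed.

Lemma continuous_sqreg h eps : hol_Pi h -> cont_Pi (sqreg h eps).
Proof.
move=> hh z z0; have ch := hol_Pi_cmod hh z0.
have cs : continuous (@Num.sqrt R) by exact: sqrt_continuous.
have h1 : (fun w => cmod (h w) ^+ 2 + eps ^+ 2) @ nbhs (z : C^o) -->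
    cmod (h z) ^+ 2 + eps ^+ 2.
  by apply: cvgD; [apply: cvgM; exact: ch|exact: cvg_cst].
have h2 := cvg_comp _ _ (cvg_comp _ _ h1 (cs _)) (cs _).
exact: (cvgB h2 (@cvg_cst _ (Num.sqrt eps) _ (nbhs (z : C^o)) _)).
Qed.

(** The modulus of a holomorphic function with values in [C ^ 2], here [(h, eps)],
    is a supremum of moduli of holomorphic scalar functions. The one that realises
    it at [z0] has no zero near [z0], hence a holomorphic square root there. *)
Lemma sqreg_submean h eps z0 (r0 r : R) : hol_Pi h -> 0 < eps ->
  0 < r < r0 -> r0 <= Re z0 ->
  (forall z, cmod (z - z0) < r0 -> cmod (h z - h z0) < eps) ->
  sqreg h eps z0 <= cavg (fun t => sqreg h eps (circ z0 r t)).
Proof.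
move=> hh e0 rr0 r0z Hh; have /andP[rp rlt] := rr0.
have h0 : 0 <= cmod (h z0) by exact: cmod_ge0.
have N2 : 0 < cmod (h z0) ^+ 2 + eps ^+ 2.
  by rewrite ltr_wpDl ?sqr_ge0// exprn_gt0.
pose n := Num.sqrt (cmod (h z0) ^+ 2 + eps ^+ 2).
have n0 : 0 < n by rewrite sqrtr_gt0.
have n2 : n ^+ 2 = cmod (h z0) ^+ 2 + eps ^+ 2 by rewrite sqr_sqrtr// ltW.
have nn : n != 0 by rewrite gt_eqF.
have en : eps <= n.
  by apply: le_sqrt; [exact: ltW|rewrite lerDr sqr_ge0].
have hn : cmod (h z0) <= n.
  by apply: le_sqrt => //; rewrite lerDl sqr_ge0.
pose al : C := conjc (h z0) * (n^-1)%:C.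
have al1 : cmod al = cmod (h z0) / n.
  by rewrite /al cmodM cmodJ cmod_real gtr0_norm ?invr_gt0.
pose k z := al * h z + (eps ^+ 2 / n)%:C.
have k0 : k z0 = n%:C.
  have E : conjc (h z0) * h z0 = (cmod (h z0) ^+ 2)%:C.
    by rewrite mulrC -sqr_normc normc_cmod -rmorphXn.
  rewrite /k /al mulrAC E -rmorphM -rmorphD/=; congr (_%:C).
  by rewrite -mulrDl -n2 expr2 mulfK.
have kRe z : cmod (z - z0) < r0 -> 0 < Re (k z).
  move=> zr; have E : k z = n%:C + al * (h z - h z0).
    by rewrite -k0 /k; ring.
  rewrite E reD /=; have : cmod (al * (h z - h z0)) < n.
    apply: lt_le_trans en; rewrite cmodM al1; apply: le_lt_trans (Hh z zr).
    by rewrite ler_piMl// ler_pdivrMr// mul1r.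
  have := normRe_cmod (al * (h z - h z0)); rewrite ler_norml => /andP[]; lra.
have khol : holo_disc k z0 r0.
  move=> z zr; apply: holD; last exact: hol_cst.
  by apply: (holM (hol_cst _ _)); exact: (hol_Pi_disc hh r0z zr).
pose s z := cpow (k z) 2^-1.
have shol : holo_disc s z0 r0.
  move=> z zr; apply: (@hol_comp _ k (fun w => cpow w 2^-1)); first exact: khol.
  exact/hol_cpow/kRe.
have smod z : cmod (s z) = Num.sqrt (cmod (k z)).
  by rewrite /s cmod_cpow powR12_sqrt.
have kle z : cmod (k z) <= Num.sqrt (cmod (h z) ^+ 2 + eps ^+ 2).
  apply: le_trans (cmodD _ _) _; rewrite cmodM al1 cmod_real.
  rewrite (ger0_norm (divr_ge0 (sqr_ge0 eps) (ltW n0))).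
  set a := cmod (h z0) in n2 *; set b := cmod (h z).
  have b0 : 0 <= b by exact: cmod_ge0.
  have -> : a / n * b + eps ^+ 2 / n = (a * b + eps ^+ 2) / n by field.
  rewrite ler_pdivrMr//.
  have ab : 0 <= a * b + eps ^+ 2.
    exact: addr_ge0 (mulr_ge0 h0 b0) (sqr_ge0 eps).
  rewrite /n -sqrtrM; last exact: addr_ge0 (sqr_ge0 b) (sqr_ge0 eps).
  apply: le_sqrt => //; have := sqr_ge0 (eps * (a - b)).
  have -> : (b ^+ 2 + eps ^+ 2) * (a ^+ 2 + eps ^+ 2) =
    (a * b + eps ^+ 2) ^+ 2 + (eps * (a - b)) ^+ 2 by ring.
  by rewrite lerDl.
have rz : `|r| < Re z0 by rewrite gtr0_norm; lra.
have c1 := cont_Pi_circ (continuous_sqreg (eps := eps) hh) rz.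
have cc (c : R) : continuous (fun t : R => c) by move=> t; exact: cvg_cst.
rewrite /sqreg (_ : Num.sqrt (Num.sqrt (cmod (h z0) ^+ 2 + eps ^+ 2)) = cmod (s z0)).
  rewrite lerBlDr -[X in _ <= _ + X]cavg_cst -(cavgD c1 (cc _)).
  apply: le_trans (holo_mean_le rr0 shol) _; apply: le_cavg.
  - exact: (continuous_cmod_circ rr0 (holo_cont_disc shol)).
  - by move=> t; apply: cvgD; [exact: c1|exact: cc].
  by move=> t; rewrite subrK smod ler_wsqrtr.
by rewrite smod k0 cmod_real gtr0_norm.
Qed.

Definition gmean f g z : R := Num.sqrt (cmod (f z * g z)).

Definition gpow p f g x y : R := gmean f g (x +i* y) `^ p.

End SquareRoots.

Section ProductMonotonicity.
Context {R : realType}.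
Local Notation C := R[i].
Variables (p : R) (phi psi : C -> C) (B1 B2 : R).
Hypotheses (p1 : 1 <= p) (hphi : hol_Pi phi) (hpsi : hol_Pi psi).
Hypotheses (Bphi : hp_le p phi B1) (Bpsi : hp_le p psi B2).

Let p0 : 0 < p. Proof. by move: p1; lra. Qed.

Let h z := phi z * psi z.

Let hh : hol_Pi h.
Proof. by move=> z z0; exact: (holM (hphi z0) (hpsi z0)). Qed.

Lemma gmean_le z : gmean phi psi z `^ p <=
  cmod (phi z) `^ p + cmod (psi z) `^ p.
Proof.
rewrite /gmean cmodM; set a := cmod _; set b := cmod _.
have a0 : 0 <= a by exact: cmod_ge0.
have b0 : 0 <= b by exact: cmod_ge0.
wlog ab : a b a0 b0 / a <= b.
  move=> H; have [ab|/ltW ba] := leP a b; first exact: H.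
  by rewrite mulrC addrC; exact: H.
have : Num.sqrt (a * b) <= b by apply: sqrt_le => //; rewrite expr2 ler_wpM2r.
move=> /(le_powR (ltW p0) (sqrtr_ge0 _)) /le_trans; apply.
by rewrite lerDr powR_ge0.
Qed.

Let Ueps eps z := sqreg h eps z `^ p.

Let Ueps_le (eps : R) z : 0 < eps -> Ueps eps z <= cmod (phi z) `^ p + cmod (psi z) `^ p.
Proof.
move=> e0; apply: le_trans (gmean_le z).
by apply: le_powR (ltW p0) (sqreg_ge0 _ _ e0) (sqreg_le _ _ e0).
Qed.

Let Ueps_cont (eps : R) : 0 < eps -> cont_Pi (Ueps eps).
Proof.
move=> e0 z z0; apply: (@cvg_powR _ _ (nbhs (z : C^o)) _ (sqreg h eps)) => //.
- by move=> w; exact: sqreg_ge0.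
- exact: sqreg_ge0.
- exact: continuous_sqreg.
Qed.

(** [sqreg_submean] has to hold with one radius on a whole half-plane. *)
Let h_unif_continuous (x0 eps : R) : 0 < x0 -> 0 < eps -> exists2 rho, 0 < rho < x0 &
  forall z0 z : C, x0 <= Re z0 -> cmod (z - z0) < rho -> cmod (h z - h z0) < eps.
Proof.
move=> x00 e0; have x02 : 0 < x0 / 2 by lra.
have [K1 K10 HK1] := hardy_bounded p1 hphi Bphi x02.
have [K2 K20 HK2] := hardy_bounded p1 hpsi Bpsi x02.
pose K := K1 * K2; have K0 : 0 <= K by exact: mulr_ge0.
have K1p : 0 < K + 1 by lra.
pose rho := Order.min (x0 / 8) (eps * x0 / (8 * (K + 1))).
have rho0 : 0 < rho by rewrite lt_min; apply/andP; split; [lra|rewrite divr_gt0 ?mulr_gt0].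
have rho1 : rho <= x0 / 8 by rewrite ge_min lexx.
have rho2 : rho <= eps * x0 / (8 * (K + 1)) by rewrite ge_min lexx orbT.
exists rho; first by lra.
move=> z0 z z0x zr; set m := cmod (z - z0) in zr.
have m0 : 0 <= m by exact: cmod_ge0.
have rr : 0 < x0 / 4 < x0 / 2 by lra.
have mr : cmod (z - z0) < x0 / 4 by rewrite -/m; lra.
have hd : holo_disc h z0 (x0 / 2) by apply: hol_Pi_disc => //; lra.
have hK w : cmod (w - z0) < x0 / 2 -> cmod (h w) <= K.
  move=> ww; have wx : x0 / 2 <= Re w.
    have := normRe_cmod (w - z0); rewrite reD reN ler_norml => /andP[]; lra.
  by rewrite cmodM ler_pM// ?HK1 ?HK2.
apply: le_lt_trans (Cauchy_lipschitz rr mr hd hK) _; rewrite -/m.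
have h8 : 0 < x0 / 8 by lra.
have : m / (x0 / 4 - m) <= m / (x0 / 8).
  by rewrite ler_wpM2l// lef_pV2 ?posrE; lra.
move=> /(ler_wpM2l K0)/le_lt_trans; apply.
have : (K + 1) * m < (K + 1) * (eps * x0 / (8 * (K + 1))).
  by rewrite ltr_pM2l//; lra.
have -> : (K + 1) * (eps * x0 / (8 * (K + 1))) = eps * (x0 / 8).
  by field; rewrite gt_eqF.
by move=> Hm; rewrite mulrA ltr_pdivrMr//; lra.
Qed.

Let Ueps_mono (eps x1 x2 : R) : 0 < eps -> 0 < x1 -> x1 <= x2 ->
  (Lint (fun y => Ueps eps (x2 +i* y)) <= Lint (fun y => Ueps eps (x1 +i* y)))%E.
Proof.
move=> e0 x10 x12.
apply: (@Lint_nonincreasing _ (Ueps eps) (B1 + B2)) => //.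
- exact: Ueps_cont.
- by move=> z; exact: powR_ge0.
- move=> x x0; apply: (@le_trans _ _ (Lint (lpow p phi x) + Lint (lpow p psi x))%E); last first.
    by rewrite EFinD leeD//; [exact: Bphi|exact: Bpsi].
  rewrite -LintD; last 4 first.
  + exact: (cont_Pi_line (hol_Pi_pow p0 hphi)).
  + exact: (cont_Pi_line (hol_Pi_pow p0 hpsi)).
  + by move=> y; exact: powR_ge0.
  + by move=> y; exact: powR_ge0.
  apply: ge0_le_integral_nomeas => y _; rewrite lee_fin ?powR_ge0//.
  exact: Ueps_le.
- move=> x x0; exists (x / 4), (fun y => dom p phi x y + dom p psi x y); split.
  + by lra.
  + exact: (integrableD measurableT (integrable_dom p0 hphi x0 Bphi)
      (integrable_dom p0 hpsi x0 Bpsi)).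
  + move=> x' y xx; apply: le_trans (Ueps_le _ e0) _.
    by apply: lerD; apply: dom_le => //; exact: ltW.
- move=> x0 x00; have [rho rhox Hrho] := h_unif_continuous x00 e0.
  exists rho => // z r zx rr.
  have rx : `|r| < Re z by rewrite gtr0_norm; lra.
  apply: (Jensen_le p1).
  + exact: (cont_Pi_circ (continuous_sqreg (eps := eps) hh)).
  + by move=> t; exact: sqreg_ge0.
  + exact: sqreg_ge0.
  apply: (sqreg_submean hh e0 rr); first by lra.
  by move=> w wz; exact: Hrho.
Qed.

(** Let [eps] tend to [0] in the regularised square roots. These are there since
    the exponent [p / 2] of the product [phi * psi] may be less than [1]. *)
Lemma product_nonincreasing (x1 x2 : R) : 0 < x1 -> x1 <= x2 ->
  (Lint (gpow p phi psi x2) <= Lint (gpow p phi psi x1))%E.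
Proof.
move=> x10 x12; have x20 : 0 < x2 by lra.
pose e n : R := n.+1%:R^-1.
have e0 n : 0 < e n by rewrite invr_gt0.
have sq0 : Num.sqrt (e n) @[n --> \oo] --> 0.
  rewrite -[X in _ --> X]sqrtr0; apply: (cvg_comp _ _ cvg_harmonic).
  exact: sqrt_continuous.
apply: (@Lint_fatou _ (fun n y => Ueps (e n) (x2 +i* y))).
- by move=> n; exact: (cont_Pi_line (Ueps_cont (e0 n)) x20).
- by move=> n y; exact: powR_ge0.
- move=> y; set z := x2 +i* y; set m := cmod (h z).
  have m0 : 0 <= m by exact: cmod_ge0.
  apply: (@cvg_powR _ _ \oo _ (fun n => sqreg h (e n) z)) => //.
  + by move=> n; exact: sqreg_ge0.
  + exact: sqrtr_ge0.
  + rewrite -[X in _ --> X]subr0; apply: cvgB => //.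
    have -> : gmean phi psi z = Num.sqrt (Num.sqrt (m ^+ 2 + 0)).
      by rewrite addr0 sqrtr_sqr ger0_norm.
    have en0 : e n ^+ 2 @[n --> \oo] --> 0.
      have -> : 0 = 0 * 0 :> R by rewrite mulr0.
      by under eq_fun do rewrite expr2; apply: cvgM; exact: cvg_harmonic.
    have cs : continuous (@Num.sqrt R) by exact: sqrt_continuous.
    have h1 : m ^+ 2 + e n ^+ 2 @[n --> \oo] --> m ^+ 2 + 0.
      by apply: cvgD; [exact: cvg_cst|exact: en0].
    exact: (cvg_comp _ _ (cvg_comp _ _ h1 (cs _)) (cs _)).
- move=> n; apply: le_trans (Ueps_mono (e0 n) x10 x12) _.
  apply: ge0_le_integral_nomeas => y _; rewrite lee_fin ?powR_ge0//.
  exact: le_powR (ltW p0) (sqreg_ge0 _ _ (e0 n)) (sqreg_le _ _ (e0 n)).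
Qed.

End ProductMonotonicity.

(** * Norm continuity of translations *)

Section PointwiseConvexity.
Context {R : realType}.
Local Notation C := R[i].
Implicit Types (a b : C) (p u v x y k : R).

Lemma powR_midconvex p u v : 1 <= p -> 0 <= u -> 0 <= v ->
  ((u + v) / 2) `^ p <= (u `^ p + v `^ p) / 2.
Proof.
move=> p1 u0 v0; have m0 : 0 <= (u + v) / 2 by lra.
have := powR_tangent p1 m0 u0; have := powR_tangent p1 m0 v0.
by set k := p * _; lra.
Qed.

(** Powers with exponent at least [1] are superadditive. *)
Lemma powR_sub_le p u v : 1 <= p -> 0 <= v -> v <= u ->
  (u - v) `^ p <= u `^ p - v `^ p.
Proof.
move=> p1 v0 vu; have p0 : p != 0 by rewrite gt_eqF; lra.
have [u0|u0] := leP u 0.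
  have -> : u = 0 by lra.
  have -> : v = 0 by lra.
  by rewrite subrr powR0// subrr.
have le1 s : 0 <= s -> s <= 1 -> s `^ p <= s.
  rewrite le_eqVlt => /orP[/eqP <- _|s0 s1]; first by rewrite powR0.
  by apply: ge1r_powR; rewrite // s0.
have s1 : (u - v) / u <= 1 by rewrite ler_pdivrMr//; lra.
have s0 : 0 <= (u - v) / u by rewrite divr_ge0//; lra.
have t1 : v / u <= 1 by rewrite ler_pdivrMr//; lra.
have t0 : 0 <= v / u by rewrite divr_ge0//; lra.
have up : 0 <= u `^ p by exact: powR_ge0.
have E1 : (u - v) `^ p = u `^ p * ((u - v) / u) `^ p.
  by rewrite -powRM ?(ltW u0)// mulrC divfK// gt_eqF.
have E2 : v `^ p = u `^ p * (v / u) `^ p.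
  by rewrite -powRM ?(ltW u0)// mulrC divfK// gt_eqF.
have st : ((u - v) / u) `^ p + (v / u) `^ p <= 1.
  have -> : 1 = (u - v) / u + v / u by field; rewrite gt_eqF.
  by apply: lerD; exact: le1.
by have := ler_wpM2l up st; rewrite mulrDr -E1 -E2 mulr1; lra.
Qed.

Lemma powRD_le p u v : 0 <= p -> 0 <= u -> 0 <= v ->
  (u + v) `^ p <= 2 `^ p * (u `^ p + v `^ p).
Proof.
move=> p0 u0 v0; wlog uv : u v u0 v0 / u <= v.
  move=> H; have [uv|/ltW vu] := leP u v; first exact: H.
  by rewrite addrC (addrC (u `^ p)); exact: H.
have : u + v <= 2 * v by lra.
move=> /(le_powR p0 (addr_ge0 u0 v0))/le_trans; apply.
by rewrite powRM// ler_wpM2l ?powR_ge0// lerDr powR_ge0.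
Qed.

Lemma cmod_le_powD p a b : 0 <= p ->
  cmod (a + b) `^ p <= 2 `^ p * (cmod a `^ p + cmod b `^ p).
Proof.
move=> p0; apply: le_trans (powRD_le p0 (cmod_ge0 a) (cmod_ge0 b)).
by apply: le_powR => //; exact: cmodD.
Qed.

Definition uc_const p : R := 2 `^ p * (1 + 8 `^ p).

(** The first defect on the right controls the difference of the moduli, the
    second one that of the directions. For [p = 1] the second defect alone would
    not suffice: it vanishes for positive multiples. *)
Lemma uniform_convexity p k a b : 1 <= p -> 0 < k ->
  cmod (a - b) `^ p <= uc_const p *
    (k * (cmod a `^ p + cmod b `^ p) +
     k^-1 * (cmod a `^ p + cmod b `^ p - 2 * Num.sqrt (cmod (a * b)) `^ p) +
     k^-1 * (cmod a `^ p + cmod b `^ p - 2 * cmod ((a + b) / 2) `^ p)).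
Proof.
move=> p1 k0; have p0 : 0 <= p by lra.
have -> : cmod ((a + b) / 2) = cmod (a + b) / 2.
  have -> : (2 : C) = (2 : R)%:C by rewrite rmorph_nat.
  by rewrite cmodM cmodV cmod_real ger0_norm.
rewrite cmodM; set al := cmod a; set be := cmod b.
have al0 : 0 <= al by exact: cmod_ge0.
have be0 : 0 <= be by exact: cmod_ge0.
set y := cmod (a + b) / 2; pose x := (al + be) / 2.
have y0 : 0 <= y by rewrite divr_ge0.
have yx : y <= x by rewrite /y /x ler_pM2r ?invr_gt0//; exact: cmodD.
have x0 : 0 <= x by lra.
pose A := Num.sqrt al `^ p; pose B := Num.sqrt be `^ p.
have A0 : 0 <= A by exact: powR_ge0.
have B0 : 0 <= B by exact: powR_ge0.
have A2 : A ^+ 2 = al `^ p.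
  by rewrite expr2 /A -powRM ?sqrtr_ge0// -expr2 sqr_sqrtr.
have B2 : B ^+ 2 = be `^ p.
  by rewrite expr2 /B -powRM ?sqrtr_ge0// -expr2 sqr_sqrtr.
have AB : Num.sqrt (al * be) `^ p = A * B.
  by rewrite sqrtrM// powRM ?sqrtr_ge0.
(* By the parallelogram identity; [x - y] is half the defect of the triangle
   inequality. *)
have ab2 : cmod (a - b) ^+ 2 <= (`|al - be| + Num.sqrt (8 * (x * (x - y)))) ^+ 2.
  have e1 : cmod (a - b) ^+ 2 = (al - be) ^+ 2 + 4 * (x - y) * (x + y).
    have : cmod (a - b) ^+ 2 + cmod (a + b) ^+ 2 = 2 * al ^+ 2 + 2 * be ^+ 2.
      by rewrite /al /be !cmod_sqr !reD !imD !reN !imN; ring.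
    have -> : cmod (a + b) = 2 * y by rewrite /y; field.
    by rewrite /x => E; move: E; lra.
  have sx : 0 <= 8 * (x * (x - y)) by rewrite !mulr_ge0//; lra.
  have e2 : `|al - be| ^+ 2 = (al - be) ^+ 2 by rewrite real_normK ?num_real.
  rewrite e1 [leRHS]sqrrD e2 (sqr_sqrtr sx).
  have : 0 <= `|al - be| * Num.sqrt (8 * (x * (x - y))) by rewrite mulr_ge0 ?sqrtr_ge0.
  have : 0 <= (x - y) * (x - y) by rewrite mulr_ge0//; lra.
  by lra.
have ab1 : cmod (a - b) <= `|al - be| + Num.sqrt (8 * (x * (x - y))).
  by rewrite -(ler_pXn2r (n := 2)) ?nnegrE// addr_ge0 ?sqrtr_ge0.
set d1 := al `^ p + be `^ p - 2 * Num.sqrt (al * be) `^ p.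
set d2 := al `^ p + be `^ p - 2 * y `^ p.
have d1E : d1 = (A - B) ^+ 2 by rewrite /d1 AB -A2 -B2; ring.
have d10 : 0 <= d1 by rewrite d1E sqr_ge0.
have xp : x `^ p <= (al `^ p + be `^ p) / 2 by exact: powR_midconvex.
have xyp : (x - y) `^ p <= d2 / 2.
  by have := powR_sub_le p1 y0 yx; rewrite /d2; lra.
have d20 : 0 <= d2 by have := powR_ge0 (x - y) p; lra.
set S := al `^ p + be `^ p in xp d1 d2 d1E d10 xyp d20 *.
have S0 : 0 <= S by rewrite addr_ge0 ?powR_ge0.
have young (u v : R) : u * v <= k * u ^+ 2 / 2 + k^-1 * v ^+ 2 / 2.
  have := sqr_ge0 (k * u - v) => h.
  have : 0 <= k^-1 * (k * u - v) ^+ 2 by rewrite mulr_ge0// invr_ge0 ltW.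
  have -> : k^-1 * (k * u - v) ^+ 2 = k * u ^+ 2 - 2 * (u * v) + k^-1 * v ^+ 2.
    by field; rewrite gt_eqF.
  by lra.
have T1 : `|al - be| `^ p <= k * S + k^-1 * d1.
  have H1 : `|al - be| `^ p <= `|A - B| * (A + B).
    have -> : `|A - B| * (A + B) = `|al `^ p - be `^ p|.
      by rewrite -A2 -B2 subr_sqr normrM [in RHS](ger0_norm (addr_ge0 A0 B0)).
    have [ab|/ltW ba] := leP al be.
      rewrite distrC ger0_norm ?subr_ge0// distrC ger0_norm ?subr_ge0 ?le_powR//.
      exact: powR_sub_le.
    rewrite ger0_norm ?subr_ge0// ger0_norm ?subr_ge0 ?le_powR//.
    exact: powR_sub_le.
  have H2 := young (A + B) `|A - B|; rewrite real_normK ?num_real// -d1E in H2.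
  have H3 : (A + B) ^+ 2 <= 2 * S.
    by rewrite /S -A2 -B2; have := sqr_ge0 (A - B); rewrite sqrrB sqrrD; lra.
  have := ler_wpM2l (ltW k0) H3; rewrite mulrC in H1.
  have : 0 <= k^-1 * d1 by rewrite mulr_ge0// invr_ge0 ltW.
  by lra.
have T2 : Num.sqrt (8 * (x * (x - y))) `^ p <= 8 `^ p * (k * S + k^-1 * d2).
  have xy0 : 0 <= x - y by lra.
  pose X := Num.sqrt x `^ p; pose Y := Num.sqrt (x - y) `^ p.
  have X2 : X ^+ 2 = x `^ p.
    by rewrite expr2 /X -powRM ?sqrtr_ge0// -expr2 sqr_sqrtr.
  have Y2 : Y ^+ 2 = (x - y) `^ p.
    by rewrite expr2 /Y -powRM ?sqrtr_ge0// -expr2 sqr_sqrtr.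
  rewrite sqrtrM// sqrtrM// powRM ?mulr_ge0 ?sqrtr_ge0// powRM ?sqrtr_ge0// -/X -/Y.
  apply: ler_pM; rewrite ?mulr_ge0 ?powR_ge0//.
    apply: (le_powR p0 (sqrtr_ge0 _)).
    rewrite -(ler_pXn2r (n := 2)) ?nnegrE ?sqrtr_ge0// sqr_sqrtr//.
    by lra.
  have := young X Y; rewrite X2 Y2.
  have := ler_wpM2l (ltW k0) xp.
  have ki : 0 <= k^-1 by rewrite invr_ge0 ltW.
  have := ler_wpM2l ki xyp.
  have : 0 <= k * S by rewrite mulr_ge0// ltW.
  have : 0 <= k^-1 * d2 by rewrite mulr_ge0.
  by lra.
apply: le_trans (le_powR p0 (cmod_ge0 _) ab1) _.
apply: le_trans (powRD_le p0 (normr_ge0 _) (sqrtr_ge0 _)) _.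
rewrite /uc_const -mulrA ler_wpM2l ?powR_ge0//.
apply: le_trans (lerD T1 T2) _.
have e8 : 0 <= 8 `^ p :> R by exact: powR_ge0.
have q1 : 0 <= k^-1 * d1 by rewrite mulr_ge0// invr_ge0 ltW.
have q2 : 0 <= k^-1 * d2 by rewrite mulr_ge0// invr_ge0 ltW.
have := mulr_ge0 e8 q1.
by lra.
Qed.

End PointwiseConvexity.

Section Translations.
Context {R : realType}.
Local Notation C := R[i].
Implicit Types (f g phi psi : C -> C) (p x y B K d e : R).

Lemma gpow_diag p f x : gpow p f f x = lpow p f x.
Proof.
apply/funext => y; rewrite /gpow /gmean cmodM -expr2 sqrtr_sqr.
by rewrite ger0_norm.
Qed.

Lemma line_nonincreasing p f B (x1 x2 : R) : 1 <= p -> hol_Pi f -> hp_le p f B ->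
  0 < x1 -> x1 <= x2 -> (Lint (lpow p f x2) <= Lint (lpow p f x1))%E.
Proof.
by move=> p1 hf HB; rewrite -!gpow_diag; exact: (product_nonincreasing p1 hf hf HB HB).
Qed.

Lemma continuous_lpow p f x : 0 < p -> hol_Pi f -> 0 < x -> continuous (lpow p f x).
Proof. by move=> p0 hf; exact: (cont_Pi_line (hol_Pi_pow p0 hf)). Qed.

Lemma hp_leD p f g B K : 0 < p -> hol_Pi f -> hol_Pi g ->
  hp_le p f B -> hp_le p g K -> hp_le p (fun z => f z + g z) (2 `^ p * (B + K)).
Proof.
move=> p0 hf hg HB HK x x0.
have cf := continuous_lpow p0 hf x0; have cg := continuous_lpow p0 hg x0.
apply: (@le_trans _ _ (Lint (fun y => 2 `^ p * (lpow p f x y + lpow p g x y)))).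
  apply: ge0_le_integral_nomeas => y _; rewrite lee_fin ?powR_ge0//.
  by apply: cmod_le_powD; exact: ltW.
rewrite LintZ ?powR_ge0//; last 2 first.
- by move=> y; apply: cvgD; [exact: cf|exact: cg].
- by move=> y; rewrite addr_ge0// powR_ge0.
rewrite EFinM lee_wpmul2l ?lee_fin ?powR_ge0//.
rewrite LintD//; try by move=> y; exact: powR_ge0.
by rewrite EFinD leeD// ?HB// HK.
Qed.

Lemma hp_leZ p f B (c : C) : 0 < p -> hol_Pi f -> hp_le p f B ->
  hp_le p (fun z => c * f z) (cmod c `^ p * B).
Proof.
move=> p0 hf HB x x0.
have -> : lpow p (fun z => c * f z) x = fun y => cmod c `^ p * lpow p f x y.
  by apply/funext => y; rewrite /lpow cmodM powRM.
rewrite LintZ ?powR_ge0//; last 2 first.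
- exact: continuous_lpow.
- by move=> y; exact: powR_ge0.
by rewrite EFinM lee_wpmul2l ?lee_fin ?powR_ge0// HB.
Qed.

Lemma eq_hp_le p f g B : (forall z, 0 < Re z -> f z = g z) -> hp_le p f B ->
  hp_le p g B.
Proof.
move=> fg HB x x0; have -> : lpow p g x = lpow p f x; last exact: HB.
by apply/funext => y; rewrite /lpow fg.
Qed.

Definition shift_by d f (z : C) : C := f (z + d%:C).

Lemma shift_line d f x y : shift_by d f (x +i* y) = f ((x + d) +i* y).
Proof. by rewrite /shift_by; congr f; apply: complex_ext; rewrite /= ?addr0. Qed.

Lemma hol_shift d f : 0 <= d -> hol_Pi f -> hol_Pi (shift_by d f).
Proof.
move=> d0 hf z z0; apply: (@hol_comp _ (fun z => z + d%:C)); first exact: hol_add.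
by apply: hf; rewrite reD /=; lra.
Qed.

Lemma hp_shift p d f B : 0 <= d -> hp_le p f B -> hp_le p (shift_by d f) B.
Proof.
move=> d0 HB x x0; have -> : lpow p (shift_by d f) x = lpow p f (x + d).
  by apply/funext => y; rewrite /lpow shift_line.
by apply: HB; lra.
Qed.

Lemma line_norm_sup p f B : hp_le p f B -> exists A : R,
  [/\ 0 <= A, hp_le p f A &
   forall e, 0 < e -> exists2 t, 0 < t & ((A - e)%:E < Lint (lpow p f t))%E].
Proof.
move=> HB; pose M x := fine (Lint (lpow p f x)).
have ME x : 0 < x -> Lint (lpow p f x) = (M x)%:E.
  move=> x0; rewrite /M fineK// ge0_fin_numE; last first.
    by apply: Lint_ge0 => y; exact: powR_ge0.
  exact: le_lt_trans (HB _ x0) (ltry _).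
pose S := [set M x | x in [set x : R | 0 < x]].
have hS : has_sup S.
  split; first by exists (M 1), 1 => //=.
  by exists B => _ [x /= x0 <-]; rewrite -lee_fin -ME// HB.
exists (sup S); split.
- apply: (@le_trans _ _ (M 1)); last by apply: sup_upper_bound => //; exists 1 => /=.
  by rewrite -lee_fin -ME// Lint_ge0// => y; exact: powR_ge0.
- by move=> x x0; rewrite ME// lee_fin; apply: sup_upper_bound => //; exists x.
- move=> e e0; have [_ [t /= t0 <-] h] := sup_adherent e0 hS.
  by exists t => //; rewrite ME// lte_fin.
Qed.

(** On a line [t] whose norm is nearly maximal, the two means of [f] and its
    translate are also nearly maximal for small translations, by Fatou's lemma.
    By monotonicity they are so on all lines to the left of [t]; there uniform
    convexity applies. To the right of [t] the norm of the difference is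
    monotone. This argument replaces boundary values. *)
Lemma shift_approx p f B e : 1 <= p -> hol_Pi f -> hp_le p f B -> 0 < e ->
  exists2 d, 0 < d & hp_le p (fun z => f z - shift_by d f z) e.
Proof.
move=> p1 hf HB e0; have p0 : 0 < p by lra.
have [A [A0 HA Aadh]] := line_norm_sup HB.
pose c := uc_const p.
have c0 : 0 < c.
  by rewrite /c /uc_const mulr_gt0 ?powR_gt0// ltr_pwDl// powR_ge0.
(* With [k] and [eta], each of the two error terms at the end of [left_t] is at
   most [e / 2]. *)
pose k := e / (4 * c * (A + 1)).
have A1 : 0 < A + 1 by lra.
have k0 : 0 < k by rewrite divr_gt0// !mulr_gt0.
pose eta := e * k / (8 * c).
have eta0 : 0 < eta by apply: (divr_gt0 (mulr_gt0 e0 k0)); exact: mulr_gt0.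
have [t t0 At] := Aadh _ eta0.
pose mid d z := (f z + shift_by d f z) / 2.
have hmid d : 0 <= d -> hol_Pi (mid d).
  move=> d0 z z0; apply: holM; last exact: hol_cst.
  by apply: holD; [exact: hf|exact: hol_shift].
have Bmid d : 0 <= d -> exists K, hp_le p (mid d) K.
  move=> d0; have hs := hol_shift d0 hf.
  have H := hp_leD p0 hf hs HA (hp_shift d0 HA).
  have hfs : hol_Pi (fun z => f z + shift_by d f z).
    by move=> z z0; apply: holD; [exact: hf|exact: hs].
  exists (cmod (2^-1 : C) `^ p * (2 `^ p * (A + A))).
  by apply: eq_hp_le (hp_leZ (2^-1) p0 hfs H) => z _; rewrite /mid mulrC.
pose H d x y := gpow p f (shift_by d f) x y + lpow p (mid d) x y.
have H0 d x y : 0 <= H d x y by rewrite addr_ge0// powR_ge0.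
have cg d x : 0 <= d -> 0 < x -> continuous (gpow p f (shift_by d f) x).
  move=> d0 x0; apply: continuous_powR => //; last by move=> y; exact: sqrtr_ge0.
  move=> y; have hh : hol_Pi (fun z => f z * shift_by d f z).
    by move=> z z0; apply: holM; [exact: hf|exact: hol_shift].
  have h1 := cont_Pi_line (hol_Pi_cmod hh) x0.
  exact: (cvg_comp _ _ (h1 y) (@sqrt_continuous R _)).
have cH d x : 0 <= d -> 0 < x -> continuous (H d x).
  move=> d0 x0 y; apply: cvgD; first exact: cg.
  exact: (continuous_lpow p0 (hmid d d0) x0).
have monoH d x : 0 <= d -> 0 < x -> x <= t -> (Lint (H d t) <= Lint (H d x))%E.
  move=> d0 x0 xt; have hs := hol_shift d0 hf; have [K HK] := Bmid d d0.
  have LH s : 0 < s ->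
      Lint (H d s) = (Lint (gpow p f (shift_by d f) s) + Lint (lpow p (mid d) s))%E.
    move=> s0; apply: (@LintD _ _ _ (cg d s d0 s0) (continuous_lpow p0 (hmid d d0) s0)).
      by move=> y; exact: powR_ge0.
    by move=> y; exact: powR_ge0.
  rewrite (LH _ x0) (LH _ t0).
  apply: leeD; last exact: (line_nonincreasing p1 (hmid d d0) HK).
  exact: (product_nonincreasing p1 hf hs HA (hp_shift d0 HA)).
pose dn (n : nat) : R := n.+1%:R^-1.
have dn0 n : 0 < dn n by rewrite invr_gt0.
have [n Hn] : exists n, ((2 * (A - eta))%:E < Lint (H (dn n) t))%E.
  apply: contrapT => N.
  have {}N n : (Lint (H (dn n) t) <= (2 * (A - eta))%:E)%E.
    by rewrite leNgt; apply/negP => h; apply: N; exists n.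
  have : (Lint (fun y => 2 * lpow p f t y)%R <= (2 * (A - eta))%:E)%E.
    apply: (@Lint_fatou _ (fun n => H (dn n) t)) => //.
    - by move=> n; apply: cH => //; exact: ltW.
    - move=> y; pose z : C := t +i* y.
      have sh : (fun n => shift_by (dn n) f z) @ \oo --> (f z : C^o).
        have ct : {for z, continuous (f : C^o -> C^o)}.
          by apply: hol_continuous; exact: hf.
        have hz : (fun n => z + (dn n)%:C) @ \oo --> (z : C^o).
          apply/cvgC => e' e'0; have /cvgrPdist_lt/(_ _ e'0) := @cvg_harmonic R.
          apply: filterS => m; rewrite sub0r normrN /= => hm.
          by rewrite addrC addKr cmod_real.
        exact: (cvg_comp _ _ hz ct).
      have -> : 2 * lpow p f t y = gmean f f z `^ p + cmod ((f z + f z) / 2) `^ p.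
        have -> : (f z + f z) / 2 = f z by field.
        by rewrite /gmean cmodM -expr2 sqrtr_sqr ger0_norm// /lpow; ring.
      apply: cvgD.
        apply: (@cvg_powR _ _ \oo _ (fun n => gmean f (shift_by (dn n) f) z)) => //.
        + by move=> m; exact: sqrtr_ge0.
        + exact: sqrtr_ge0.
        + have h1 : (fun n => f z * shift_by (dn n) f z) @ \oo --> (f z * f z : C^o).
            by apply: (@cvgM C _ \oo); [exact: cvg_cst|exact: sh].
          exact: (cvg_comp _ _ (cvgC_cmod h1) (@sqrt_continuous R _)).
      apply: (@cvg_powR _ _ \oo _ (fun n => cmod (mid (dn n) z))) => //.
      apply: cvgC_cmod; apply: (@cvgM C _ \oo); last exact: cvg_cst.
      by apply: (@cvgD C C^o); [exact: cvg_cst|exact: sh].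
  rewrite LintZ//; last 2 first.
  - exact: continuous_lpow.
  - by move=> y; exact: powR_ge0.
  rewrite EFinM lee_pmul2l ?lte_fin//.
  by move=> /(lt_le_trans At); rewrite ltxx.
pose d := dn n; have d0 : 0 <= d := ltW (dn0 n).
exists d; first exact: dn0.
have hs := hol_shift d0 hf; have Hs := hp_shift d0 HA.
pose df (z : C) := f z - shift_by d f z.
have hdf : hol_Pi df.
  by move=> z z0; apply: holB; [exact: hf|exact: hs].
have left_t x : 0 < x -> x <= t -> (Lint (lpow p df x) <= e%:E)%E.
  move=> x0 xt; set D := lpow p df x.
  have cD : continuous D by exact: continuous_lpow.
  have D0 y : 0 <= D y by exact: powR_ge0.
  pose c1 := c * (2 * k^-1); pose c2 := c * (k + 2 * k^-1).
  have ki : 0 < k^-1 by rewrite invr_gt0.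
  have k20 : 0 <= 2 * k^-1 by rewrite mulr_ge0 ?(ltW ki).
  have c10 : 0 <= c1 := mulr_ge0 (ltW c0) k20.
  have c20 : 0 <= c2 := mulr_ge0 (ltW c0) (addr_ge0 (ltW k0) k20).
  have cf := continuous_lpow p0 hf x0; have cs := continuous_lpow p0 hs x0.
  have pw y : D y + c1 * H d x y <= c2 * (lpow p f x y + lpow p (shift_by d f) x y).
    have := uniform_convexity (f (x +i* y)) (shift_by d f (x +i* y)) p1 k0.
    rewrite -/c /D /H /c1 /c2 /gpow /gmean /lpow /mid.
    set u := cmod _ `^ p; set v := cmod _ `^ p; set w := cmod _ `^ p.
    set s := Num.sqrt _ `^ p; set m := cmod _ `^ p.
    by lra.
  have : (Lint D + (c1 * (2 * (A - eta)))%:E <= (c2 * (A + A))%:E)%E.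
    apply: (@le_trans _ _ (Lint D + c1%:E * Lint (H d x))%E).
      have h1 : ((2 * (A - eta))%:E <= Lint (H d x))%E.
        exact: (le_trans (ltW Hn) (monoH d x d0 x0 xt)).
      rewrite EFinM; apply: (leeD (lexx _)); apply: lee_wpmul2l; last exact: h1.
      by rewrite lee_fin.
    have cHx := cH d x d0 x0.
    have cH1 : continuous (fun y => c1 * H d x y).
      by move=> y; apply: cvgM; [exact: cvg_cst|exact: cHx].
    have cS : continuous (fun y => lpow p f x y + lpow p (shift_by d f) x y).
      by move=> y; apply: cvgD; [exact: cf|exact: cs].
    have S0 y : 0 <= lpow p f x y + lpow p (shift_by d f) x y.
      by apply: addr_ge0; exact: powR_ge0.
    have H10 y : 0 <= c1 * H d x y := mulr_ge0 c10 (H0 d x y).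
    rewrite -(LintZ cHx (H0 d x) c10) -(LintD cD cH1 D0 H10).
    apply: (@le_trans _ _ (Lint (fun y => c2 * (lpow p f x y + lpow p (shift_by d f) x y)))).
      apply: ge0_le_integral_nomeas => y _; rewrite lee_fin; last exact: pw.
      exact: (addr_ge0 (D0 y) (H10 y)).
    rewrite (LintZ cS S0 c20) (EFinM c2 (A + A)).
    apply: lee_wpmul2l; first by rewrite lee_fin.
    rewrite (LintD cf cs) ?EFinD; try (by move=> y; exact: powR_ge0).
    by apply: leeD; [exact: HA|exact: Hs].
  rewrite -leeBrDr// => /le_trans; apply; rewrite -EFinB lee_fin.
  have -> : c2 * (A + A) - c1 * (2 * (A - eta)) = 2 * c * k * A + 4 * c * k^-1 * eta.
    by rewrite /c1 /c2; ring.
  have -> : 4 * c * k^-1 * eta = e / 2.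
    by rewrite /eta; field; rewrite !gt_eqF.
  have : 2 * c * k * A <= 2 * c * k * (A + 1).
    by have := mulr_gt0 c0 k0; clear; clearbody c k; lra.
  have -> : 2 * c * k * (A + 1) = e / 2.
    by rewrite /k; field; rewrite !gt_eqF.
  by lra.
move=> x x0; have [xt|/ltW tx] := leP x t; first exact: left_t.
have hmN : hol_Pi (fun z => -1 * shift_by d f z).
  by move=> z z0; apply: (holM (hol_cst _ _)); exact: hs.
have := hp_leD p0 hf hmN HA (hp_leZ (-1) p0 hs Hs) => HK.
have {}HK : hp_le p df (2 `^ p * (A + cmod (-1 : C) `^ p * A)).
  by apply: eq_hp_le HK => z _; rewrite mulN1r.
exact: le_trans (line_nonincreasing p1 hdf HK t0 tx) (left_t t t0 (lexx _)).
Qed.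

End Translations.

(** * Cauchy kernels *)

Section Kernels.
Context {R : realType}.
Local Notation C := R[i].
Implicit Types (f g : C -> C) (z w a : C) (p x y B k : R) (h : R -> R).

Lemma Lint_scale h k : 0 < k -> continuous h -> (forall y, 0 <= h y) ->
  Lint (fun y => h (y * k) * k) = Lint h.
Proof.
move=> k0 ch h0; pose F (y : R) := y * k.
have dF x : is_derive x 1 F k.
  by apply: is_derive_eq; rewrite scaler0 add0r /GRing.scale/= mulr1.
have dFE : (F^`())%classic = cst k.
  by apply/funext => x; rewrite derive1E; exact: (@derive_val _ _ _ _ _ _ _ (dF x)).
rewrite /Lint (@increasing_ge0_integration_by_substitutionT R F h).
- by apply: eq_integral => y _; rewrite /= dFE.
- by move=> x y xy; rewrite /F ltr_pM2r.
- by rewrite dFE; exact: cst_continuous.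
- by rewrite dFE; exact: is_cvg_cst.
- by rewrite dFE; exact: is_cvg_cst.
- by move=> x; exact: (@ex_derive _ _ _ _ _ _ _ (dF x)).
- apply/cvgrNyPle => A; near=> x; rewrite /F -(ler_pdivlMr _ _ k0).
  by near: x; apply: nbhs_ninfty_le; rewrite num_real.
- apply/cvgryPge => A; near=> x; rewrite /F -(ler_pdivrMr _ _ k0).
  by near: x; apply: nbhs_pinfty_ge; rewrite num_real.
- exact: ch.
- exact: h0.
Unshelve. all: by end_near. Qed.

Lemma Lint_oneDsqr : Lint (fun y => (oneDsqr y)^-1) = (pi : R)%:E.
Proof.
rewrite /Lint ge0_symfun_integralT.
- by rewrite (_ : [set x : R | _] = `[0%R, +oo[%classic) ?integral0y_oneDsqr -?EFinM;
    [congr EFin; field | apply/seteqP; split => x; rewrite /= in_itv/= andbT].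
- by move=> y; rewrite invr_ge0.
- by move=> y; exact: continuous_oneDsqrV.
- by move=> y; rewrite /= /oneDsqr sqrrN.
Qed.

Lemma sqrD_gt0 (al y : R) : 0 < al -> 0 < al ^+ 2 + y ^+ 2.
Proof. by move=> al0; rewrite ltr_wpDr ?sqr_ge0// exprn_gt0. Qed.

Lemma continuous_sqrDV (al b : R) : 0 < al ->
  continuous (fun y => (al ^+ 2 + (y + b) ^+ 2)^-1).
Proof.
move=> al0 y; apply: cvgV; first by rewrite gt_eqF// sqrD_gt0.
apply: cvgD; first exact: cvg_cst.
have h : (fun y => y + b) @ nbhs y --> y + b.
  by apply: cvgD; [exact: cvg_id|exact: cvg_cst].
exact: (cvg_comp _ _ h (@exprn_continuous _ 2 (y + b))).
Qed.

Lemma Lint_Cauchy (al b : R) : 0 < al ->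
  Lint (fun y => (al ^+ 2 + (y + b) ^+ 2)^-1) = (pi / al)%:E.
Proof.
move=> al0; have ai0 : 0 < al^-1 by rewrite invr_gt0.
have c0 := @continuous_sqrDV al 0 al0.
have p0 y : 0 <= (al ^+ 2 + (y + 0) ^+ 2)^-1 by rewrite invr_ge0 ltW// sqrD_gt0.
have := @Lint_shift _ (fun y => (al ^+ 2 + (y + 0) ^+ 2)^-1) b c0 p0.
under eq_fun do rewrite addr0; move=> ->.
under eq_fun do rewrite addr0.
have e0 y : 0 <= (oneDsqr y)^-1 :> R by rewrite invr_ge0.
have cs : continuous (fun y : R => (oneDsqr (y * al^-1))^-1 * al^-1).
  move=> y; apply: cvgM; last exact: cvg_cst.
  have h : (fun y : R => y * al^-1) @ nbhs y --> y * al^-1.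
    by apply: cvgM; [exact: cvg_id|exact: cvg_cst].
  exact: (cvg_comp _ _ h (@continuous_oneDsqrV R (y * al^-1))).
have -> : (fun y => (al ^+ 2 + y ^+ 2)^-1) =
          (fun y => al^-1 * ((oneDsqr (y * al^-1))^-1 * al^-1)).
  apply/funext => y; rewrite /oneDsqr.
  have := sqrD_gt0 y al0; have al_n : al != 0 by rewrite gt_eqF.
  by move=> ?; field; rewrite ?al_n ?gt_eqF// ?addrC.
rewrite LintZ ?(ltW ai0)//; last by move=> y; rewrite mulr_ge0// ltW.
have co : continuous (fun y : R => (oneDsqr y)^-1) by exact: continuous_oneDsqrV.
by rewrite (Lint_scale ai0 co e0) Lint_oneDsqr -EFinM mulrC.
Qed.

(** The [2/p]-th power of a Cauchy kernel: the [p]-th power of its modulus has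
    an explicit integral over each vertical line. *)
Definition kern p a z : C := (cpow (z + conjc a) (2 / p))^-1.

Lemma Re_addJ z a : 0 < Re z -> 0 < Re a -> 0 < Re (z + conjc a).
Proof. by case: z a => x y [u v] /= ? ?; exact: addr_gt0. Qed.

Lemma Re_gt0_neq0 z : 0 < Re z -> z != 0.
Proof. by move=> z0; apply/eqP => zE; rewrite zE /= ltxx in z0. Qed.

Lemma hol_kern p a : 0 < Re a -> hol_Pi (kern p a).
Proof.
move=> a0 z z0; have h := Re_addJ z0 a0.
apply: holV; first by apply: cpow_neq0; exact: Re_gt0_neq0.
apply: (@hol_comp _ (fun w => w + conjc a) (fun w => cpow w (2 / p)) z).
  exact: hol_add.
exact: hol_cpow.
Qed.

Lemma cmod_kern p a z : 0 < p -> 0 < Re z -> 0 < Re a ->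
  cmod (kern p a z) `^ p = (cmod (z + conjc a) ^+ 2)^-1.
Proof.
move=> p0 z0 a0; have h := Re_gt0_neq0 (Re_addJ z0 a0).
have m0 : 0 < cmod (z + conjc a) by rewrite cmod_gt0.
rewrite /kern cmodV cmod_cpow -powRN -powRrM mulNr mulrVK ?unitfE ?gt_eqF//.
by rewrite powRN powR_mulrn// ltW.
Qed.

Lemma hp_kern p a : 0 < p -> 0 < Re a -> hp_le p (kern p a) (pi / Re a).
Proof.
move=> p0 a0 x x0.
have E : lpow p (kern p a) x = fun y => ((x + Re a) ^+ 2 + (y + - Im a) ^+ 2)^-1.
  apply/funext => y; rewrite /lpow cmod_kern// cmod_sqr.
  by case: a a0 => u v.
have xa : 0 < x + Re a by rewrite addr_gt0.
rewrite E Lint_Cauchy// lee_fin ler_wpM2l ?pi_ge0//.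
by rewrite lef_pV2 ?posrE//; lra.
Qed.

End Kernels.

(** * Totality of the functions e_n *)

Section Density.
Context {R : realType}.
Local Notation C := R[i].
Implicit Types (f g h N : C -> C) (z w a : C) (p x y B K d e : R).

(** Fatou's lemma for [D - H n]. *)
Lemma Lint_small (H : nat -> R -> R) (D : R -> R) e :
  (forall n, continuous (H n)) -> continuous D ->
  (forall n y, 0 <= H n y <= D y) -> (forall y, H n y @[n --> \oo] --> 0) ->
  (Lint D < +oo)%E -> 0 < e -> exists n, (Lint (H n) <= e%:E)%E.
Proof.
move=> cH cD HD H0 Dfin e0; apply: contrapT => no.
have {}no n : (e%:E < Lint (H n))%E.
  by rewrite ltNge; apply/negP => h; apply: no; exists n.
have D0 y : 0 <= D y by have /andP[] := HD 0%N y; lra.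
have DE : Lint D = (fine (Lint D))%:E.
  by rewrite fineK// ge0_fin_numE// Lint_ge0.
have cDH n : continuous (fun y => D y - H n y).
  by move=> y; apply: cvgB; [exact: cD|exact: cH].
have DH0 n y : 0 <= D y - H n y by have /andP[] := HD n y; lra.
have Hn0 n y : 0 <= H n y by have /andP[] := HD n y.
have : (Lint D <= (fine (Lint D) - e)%:E)%E.
  apply: (@Lint_fatou _ (fun n y => D y - H n y)) => //.
    move=> y; rewrite -[X in _ --> X]subr0.
    by apply: cvgB; [exact: cvg_cst|exact: H0].
  move=> n; rewrite EFinB -DE leeBrDr//.
  apply: (@le_trans _ _ (Lint (fun y => (D y - H n y)%R) + Lint (H n))%E).
    by apply: leeD => //; exact: ltW.
  rewrite -LintD//; under eq_fun do rewrite subrK.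
  exact: lexx.
by rewrite DE lee_fin; lra.
Qed.

Definition in_hardy p f : Prop := hol_Pi f /\ exists B, hp_le p f B.

(** Closed linear subspaces of the Hardy space. Closedness makes them
    insensitive to values outside the half-plane, see [closed_eq]. *)
Definition closed_subspace p (Z : (C -> C) -> Prop) : Prop :=
  (forall (c : C) f g, Z f -> Z g -> Z (fun z => c * f z + g z)) /\
  (forall f, in_hardy p f ->
    (forall e, 0 < e -> exists2 g, Z g & hp_le p (fun z => f z - g z) e) -> Z f).

Lemma in_hardyB p f g : 0 < p -> in_hardy p f -> in_hardy p g -> in_hardy p (fun z => f z - g z).
Proof.
move=> p0 [hf [B HB]] [hg [K HK]]; split.
  by move=> z z0; exact: (holB (hf z z0) (hg z z0)).
have hg' : hol_Pi (fun z => -1 * g z).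
  by move=> z z0; exact: (holM (hol_cst _ _) (hg z z0)).
have := hp_leD p0 hf hg' HB (hp_leZ (-1) p0 hg HK) => h.
by eexists; apply: eq_hp_le h => z _; rewrite mulN1r.
Qed.

Lemma in_hardy_shift p d f : 0 <= d -> in_hardy p f -> in_hardy p (shift_by d f).
Proof.
move=> d0 [hf [B HB]]; split; first exact: hol_shift.
by exists B; exact: hp_shift.
Qed.

Lemma closed_eq p Z f g : 0 < p -> closed_subspace p Z -> Z f -> in_hardy p g ->
  (forall z, 0 < Re z -> f z = g z) -> Z g.
Proof.
move=> p0 [_ cZ] Zf ag fg; apply: (cZ _ ag) => e e0; exists f => // x x0.
have -> : lpow p (fun z => g z - f z) x = fun=> 0.
  by apply/funext => y; rewrite /lpow fg// subrr cmod0 powR0// gt_eqF.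
by rewrite /Lint integral0 lee_fin ltW.
Qed.

Lemma closed_shift p d Z : 0 <= d -> closed_subspace p Z ->
  closed_subspace p (fun f => Z (shift_by d f)).
Proof.
move=> d0 [lZ cZ]; split; first by move=> c f g; exact: (lZ c).
move=> f af H; apply: (cZ _ (in_hardy_shift d0 af)) => e /H[g Zg Hg].
exists (shift_by d g); first exact: Zg.
exact: (hp_shift d0 Hg : hp_le p (shift_by d (fun z => f z - g z)) e).
Qed.

(** Dominated convergence on one line gives convergence in norm to the right
    of that line, by monotonicity of the norms on lines. *)
Lemma line_approx p t (u : nat -> C -> C) (D : R -> R) e : 1 <= p -> 0 < t ->
  (forall n, in_hardy p (u n)) -> continuous D ->
  (forall n y, lpow p (u n) t y <= D y) -> (Lint D < +oo)%E ->
  (forall y, cmod (u n (t +i* y)) @[n --> \oo] --> 0) -> 0 < e ->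
  exists n, hp_le p (shift_by t (u n)) e.
Proof.
move=> p1 t0 au cD uD Dfin u0 e0; have p0 : 0 < p by lra.
have [n Hn] : exists n, (Lint (lpow p (u n) t) <= e%:E)%E.
  apply: (@Lint_small _ D) => //.
  - by move=> n; have [hu _] := au n; exact: continuous_lpow.
  - by move=> n y; rewrite uD powR_ge0.
  - move=> y; have <- : 0 `^ p = 0 :> R by rewrite powR0// gt_eqF.
    by apply: (@cvg_powR _ _ \oo _ (fun n => cmod (u n (t +i* y))) 0).
exists n => x x0; have [hu [B HB]] := au n.
have -> : lpow p (shift_by t (u n)) x = lpow p (u n) (x + t).
  by apply/funext => y; rewrite /lpow shift_line.
apply: le_trans Hn; apply: (line_nonincreasing p1 hu HB) => //; lra.
Qed.

Definition cay z : C := (z - 1) / (z + 1).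
Definition cayinv w : C := (1 + w) / (1 - w).

Lemma addr1_neq0 z : 0 < Re z -> z + 1 != 0.
Proof. by move=> z0; apply: Re_gt0_neq0; rewrite reD /=; lra. Qed.

Lemma cmod_cay z : 0 < Re z -> cmod (cay z) < 1.
Proof.
move=> z0; have n0 := addr1_neq0 z0.
rewrite /cay cmodM cmodV ltr_pdivrMr ?cmod_gt0// mul1r.
rewrite -(ltr_pXn2r (n := 2)) ?nnegrE// !cmod_sqr !reD !imD !reN !imN /=.
by nra.
Qed.

Lemma subr1_neq0 w : cmod w < 1 -> 1 - w != 0.
Proof.
move=> w1; rewrite subr_eq0; apply/eqP => wE.
by move: w1; rewrite -wE cmod1 ltxx.
Qed.

Lemma Re_cayinv w : cmod w < 1 -> 0 < Re (cayinv w).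
Proof.
move=> w1; have n0 := subr1_neq0 w1.
have m0 : 0 < cmod (1 - w) by rewrite cmod_gt0.
have E : cayinv w * (cmod (1 - w) ^+ 2)%:C = (1 + w) * conjc (1 - w).
  have -> : (cmod (1 - w) ^+ 2)%:C = (1 - w) * conjc (1 - w).
    apply: complex_ext; rewrite ?reM ?imM cmod_sqr /=; case: (1 - w) => a b /=; ring.
  by rewrite /cayinv mulrA divfK.
have H : 0 < Re ((1 + w) * conjc (1 - w)).
  have : cmod w ^+ 2 < 1 by rewrite expr_lt1.
  by rewrite cmod_sqr; case: w {w1 n0 m0 E} => a b /= ?; lra.
have : Re (cayinv w * (cmod (1 - w) ^+ 2)%:C) = Re (cayinv w) * cmod (1 - w) ^+ 2.
  by rewrite reM /= mulr0 subr0.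
rewrite E => H'; rewrite H' in H; move: H.
by rewrite pmulr_lgt0// exprn_gt0.
Qed.

Lemma cayK z : 0 < Re z -> cayinv (cay z) = z.
Proof.
move=> z0; have n0 := addr1_neq0 z0; rewrite /cayinv /cay.
field; rewrite n0 /=.
have -> : z + 1 - (z - 1) = 2%:R by ring.
by rewrite pnatr_eq0.
Qed.

Lemma conjc_1 : conjc (1 : C) = 1.
Proof. by apply: complex_ext; rewrite /= ?oppr0. Qed.

Lemma e_E p n z : 0 < Re z -> e_ p n z = cay z ^+ n * kern p 1 z.
Proof.
move=> z0; have n0 := addr1_neq0 z0.
by rewrite /e_ /kern /cay conjc_1 cpowD// cpow_nat// invfM expr_div_n mulrAC mulrA.
Qed.

Lemma hp_le_kern p f B : 0 < p -> 0 <= B ->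
  (forall z, 0 < Re z -> cmod (f z) <= B * cmod (kern p 1 z)) ->
  hp_le p f (B `^ p * pi).
Proof.
move=> p0 B0 H x x0; have r1 : 0 < Re (1 : C) by exact: ltr01.
have hk : hol_Pi (kern p 1) := hol_kern r1.
apply: (@le_trans _ _ (Lint (fun y => B `^ p * lpow p (kern p 1) x y))).
  apply: ge0_le_integral_nomeas => y _; rewrite lee_fin ?powR_ge0//.
  rewrite /lpow -powRM//; apply: le_powR => //; [exact: ltW|exact: H].
rewrite LintZ ?powR_ge0//; last 2 first.
- exact: continuous_lpow.
- by move=> y; exact: powR_ge0.
rewrite EFinM lee_wpmul2l ?lee_fin ?powR_ge0//.
by have := hp_kern p0 r1 x0; rewrite divr1.
Qed.

Lemma hol_cay z : 0 < Re z -> hol cay z.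
Proof.
move=> z0; apply: (@hol_div _ (fun z => z - 1) (fun z => z + 1) z).
- exact: addr1_neq0.
- exact: hol_sub.
- exact: hol_add.
Qed.

(** The powers [w ^+ n] correspond to the functions [e_ p n]. *)
Definition disc_fun p N z : C := N (cay z) * kern p 1 z.

Lemma in_hardy_disc_fun p N B : 0 < p -> holo_disc N 0 1 ->
  (forall w, cmod w < 1 -> cmod (N w) <= B) -> in_hardy p (disc_fun p N).
Proof.
move=> p0 hN HB; have r1 : 0 < Re (1 : C) by exact: ltr01.
have B0 : 0 <= B by apply: le_trans (HB 0 _); rewrite ?cmod0.
split; last first.
  exists (B `^ p * pi); apply: hp_le_kern => // z z0.
  by rewrite cmodM ler_wpM2r// HB// cmod_cay.
move=> z z0; apply: holM; last exact: hol_kern.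
apply: (@hol_comp _ cay N); first exact: hol_cay.
by apply: hN; rewrite subr0 cmod_cay.
Qed.

Lemma closed_sum p Z (a : nat -> C) n : closed_subspace p Z ->
  (forall n, Z (e_ p n)) -> Z (fun z => \sum_(i < n) a i * e_ p i z).
Proof.
move=> [lZ _] Ze; elim: n => [|n IH].
  have -> : (fun z => \sum_(i < 0) a i * e_ p i z) = fun z => -1 * e_ p 0 z + e_ p 0 z.
    by apply/funext => z; rewrite big_ord0 mulN1r addNr.
  exact: lZ.
have -> : (fun z => \sum_(i < n.+1) a i * e_ p i z) =
    fun z => a n * e_ p n z + \sum_(i < n) a i * e_ p i z.
  by apply/funext => z; rewrite big_ord_recr addrC.
exact: lZ.
Qed.

(** Taylor polynomials converge uniformly on the closed unit disc, and
    [kern p 1] has finite norm. *)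
Lemma closed_disc_fun p Z N (R0 : R) B : 0 < p -> closed_subspace p Z ->
  (forall n, Z (e_ p n)) -> 1 < R0 -> holo_disc N 0 R0 ->
  (forall w, cmod w < R0 -> cmod (N w) <= B) -> Z (disc_fun p N).
Proof.
move=> p0 cZ Ze R01 hN HB.
have aN : in_hardy p (disc_fun p N).
  apply: (@in_hardy_disc_fun _ _ B) => //.
    by move=> w w1; apply: hN; exact: lt_trans R01.
  by move=> w w1; apply: HB; exact: lt_trans R01.
apply: (cZ.2 _ aN) => e e0.
have pi0 := pi_gt0 R.
pose e' := (e / pi) `^ p^-1.
have e'0 : 0 < e' by rewrite powR_gt0// divr_gt0.
have r1 : 0 < (1 + R0) / 2 < R0 by apply/andP; split; lra.
have r2 : (0 : R) <= 1 < (1 + R0) / 2 by apply/andP; split; lra.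
have [n [a Ha]] := Taylor_approx r1 r2 hN HB e'0.
exists (fun z => \sum_(i < n) a i * e_ p i z); first exact: (closed_sum a n cZ Ze).
have -> : e = e' `^ p * pi.
  by rewrite powRVK// ?divfK ?gt_eqF// divr_ge0// ltW.
apply: hp_le_kern => //; first exact: ltW.
move=> z z0.
have -> : disc_fun p N z - \sum_(i < n) a i * e_ p i z =
    (N (cay z) - \sum_(i < n) a i * cay z ^+ i) * kern p 1 z.
  rewrite mulrBl mulr_suml; congr (_ - _).
  by apply: eq_bigr => i _; rewrite e_E// mulrA.
by rewrite cmodM ler_wpM2r// Ha// ltW// cmod_cay.
Qed.

End Density.

Section Totality.
Context {R : realType}.
Local Notation C := R[i].
Implicit Types (f g h N : C -> C) (z w a b : C) (p s x y B K d e : R).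

Lemma Arg_mul a b : 0 < Re a -> 0 < Re b -> Arg (a * b) = Arg a + Arg b.
Proof.
move=> a0 b0; have an := Re_gt0_neq0 a0; have bn := Re_gt0_neq0 b0.
have /andP[a1 a2] := Arg_bound a0; have /andP[b1 b2] := Arg_bound b0.
have -> : a * b = (cmod a * cmod b * cos (Arg a + Arg b)) +i*
                  (cmod a * cmod b * sin (Arg a + Arg b)).
  rewrite {1}(polarE an) {1}(polarE bn) cosD sinD.
  by apply: complex_ext; rewrite ?reM ?imM /=; ring.
by rewrite Arg_polar ?mulr_gt0 ?cmod_gt0//; apply/andP; split; lra.
Qed.

Lemma cpowM a b s : 0 < Re a -> 0 < Re b -> cpow (a * b) s = cpow a s * cpow b s.
Proof.
move=> a0 b0; rewrite /cpow Arg_mul// cmodM powRM// mulrDr cosD sinD.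
by apply: complex_ext; rewrite ?reM ?imM /=; ring.
Qed.

(** Horizontal translates of [e_ p n] correspond to functions holomorphic in a
    larger disc, since the translation fixes infinity. *)
Lemma closed_shift_e p Z d n : 0 < p -> 0 < d -> closed_subspace p Z ->
  (forall n, Z (e_ p n)) -> in_hardy p (e_ p n) -> Z (shift_by d (e_ p n)).
Proof.
move=> p0 d0 cZ Ze ae.
(* In terms of [z], [v w] is [(z + d + 1) / (z + 1)]; it stays away from [0] for
   [cmod w < R0]. *)
pose v w : C := 1 + d%:C * ((1 - w) / 2).
pose N w : C := ((w + d%:C * ((1 - w) / 2)) / v w) ^+ n * (cpow (v w) (2 / p))^-1.
pose R0 := 1 + d^-1.
have di : 0 < d^-1 by rewrite invr_gt0.
have Rev w : Re (v w) = 1 + d * ((1 - Re w) / 2).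
  rewrite /v; have -> : (1 - w) / 2 = ((1 - Re w) / 2) +i* (- Im w / 2).
    have -> : (2 : C)^-1 = ((2 : R)^-1)%:C by rewrite fmorphV rmorph_nat.
    by apply: complex_ext; rewrite ?reM ?imM /= reD imD reN imN /=; ring.
  by rewrite reD reM /=; ring.
have v0 w : cmod w < R0 -> 1 / 2 <= Re (v w).
  move=> wR; rewrite Rev; have := Re_cmod w.
  have : d * d^-1 = 1 by rewrite divff// gt_eqF.
  by move: wR; rewrite /R0 => *; nra.
have vn w : cmod w < R0 -> v w != 0.
  by move=> /v0 h; apply: Re_gt0_neq0; lra.
have hs w : hol (fun w => d%:C * ((1 - w) / 2)) w.
  apply: (holM (hol_cst _ w)); apply: holM; last exact: hol_cst.
  by apply: holB; [exact: hol_cst|exact: hol_id].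
have hv w : hol v w by exact: (holD (hol_cst 1 w) (hs w)).
have hN : holo_disc N 0 R0.
  move=> w; rewrite subr0 => wR; have vw := vn w wR.
  apply: holM.
    apply: holX; apply: (@hol_div _ (fun w => w + d%:C * ((1 - w) / 2)) v) => //.
    exact: (holD (hol_id w) (hs w)).
  apply: holV; first exact: cpow_neq0.
  apply: (@hol_comp _ v (fun u => cpow u (2 / p))) => //.
  by apply: hol_cpow; have := v0 w wR; lra.
pose B1 := (R0 + d * (1 + R0)) * 2.
pose B := B1 ^+ n * ((1 / 2) `^ (2 / p))^-1.
have NB w : cmod w < R0 -> cmod (N w) <= B.
  move=> wR; have vw := v0 w wR.
  have mv : 1 / 2 <= cmod (v w) by apply: le_trans vw (Re_cmod _).
  have mv0 : 0 < cmod (v w) by lra.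
  rewrite /N cmodM cmodX cmodV cmod_cpow; apply: ler_pM.
  - by rewrite exprn_ge0.
  - by rewrite invr_ge0 powR_ge0.
  - apply: lerXn2r; rewrite ?nnegrE//.
      have R0p : 0 < R0 by rewrite /R0; lra.
      by rewrite /B1 mulr_ge0// addr_ge0 ?(ltW R0p)// mulr_ge0 ?(ltW d0)//; lra.
    rewrite cmodM cmodV ler_pdivrMr//.
    have h1 : cmod (w + d%:C * ((1 - w) / 2)) <= R0 + d * (1 + R0).
      apply: le_trans (cmodD _ _) _; apply: lerD; first exact: ltW.
      rewrite cmodM cmod_real (gtr0_norm d0) ler_pM2l//.
      rewrite cmodM cmodV.
      have -> : cmod (2 : C) = 2.
        have -> : (2 : C) = (2 : R)%:C by rewrite rmorph_nat.
        by rewrite cmod_real ger0_norm.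
      have := cmodD 1 (- w); rewrite cmodN cmod1.
      by have := cmod_ge0 (1 - w); lra.
    have : 0 <= R0 + d * (1 + R0) by apply: le_trans h1.
    by move=> h2; rewrite /B1; nra.
  - by rewrite lef_pV2 ?posrE ?powR_gt0//; apply: le_powR; rewrite ?divr_ge0// ltW.
have R01 : 1 < R0 by rewrite /R0; lra.
have ZN := closed_disc_fun p0 cZ Ze R01 hN NB.
apply: (closed_eq p0 cZ ZN); first by apply: in_hardy_shift => //; exact: ltW.
move=> z z0; have n0 := addr1_neq0 z0.
have zd0 : 0 < Re (z + d%:C) by rewrite reD /=; lra.
have z10 : 0 < Re (z + 1) by rewrite reD /=; lra.
have nd0 := addr1_neq0 zd0.
have sE : (1 - cay z) / 2 = (z + 1)^-1.
  rewrite /cay; field; rewrite n0 /=.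
  by rewrite ?pnatr_eq0.
have vE : v (cay z) = (z + d%:C + 1) / (z + 1).
  by rewrite /v sE; field.
have vc : 0 < Re (v (cay z)).
  have := @v0 (cay z); have := cmod_cay z0 => c1 /(_ (lt_trans c1 R01)); lra.
rewrite /shift_by e_E// /disc_fun /N /kern conjc_1.
have -> : z + d%:C + 1 = v (cay z) * (z + 1) by rewrite vE divfK.
rewrite cpowM// invfM -[LHS]mulrA; congr (_ ^+ _ * _).
rewrite vE sE /cay; field.
by rewrite n0 nd0.
Qed.

End Totality.

Section TotalityEnd.
Context {R : realType}.
Local Notation C := R[i].
Implicit Types (f g h N : C -> C) (z w a b : C) (p s x y B K d e : R).

Lemma hol_e p n : hol_Pi (e_ p n : C -> C).
Proof.
move=> z z0; have z10 : 0 < Re (z + 1) by rewrite reD /=; lra.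
apply: (@hol_div _ (fun z => (z - 1) ^+ n) (fun z => cpow (z + 1) (2 / p + n%:R)) z).
- by apply: cpow_neq0; exact: addr1_neq0.
- by apply: holX; exact: hol_sub.
- apply: (@hol_comp _ (fun w => w + 1) (fun w => cpow w (2 / p + n%:R)) z).
    exact: hol_add.
  exact: hol_cpow.
Qed.

Lemma in_hardy_e p n : 0 < p -> in_hardy p (e_ p n : C -> C).
Proof.
move=> p0; split; first exact: hol_e.
exists (1 `^ p * pi); apply: hp_le_kern => // z z0.
rewrite e_E// cmodM cmodX mul1r ler_piMl//.
by apply: exprn_ile1 => //; exact: ltW (cmod_cay z0).
Qed.

Lemma kern_neq0 p a z : 0 < Re a -> 0 < Re z -> kern p a z != 0.
Proof.
move=> a0 z0; rewrite invr_neq0// cpow_neq0//.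
by apply: Re_gt0_neq0; exact: Re_addJ.
Qed.

Lemma hol_cayinv w : cmod w < 1 -> hol cayinv w.
Proof.
move=> w1; apply: (@hol_div _ (fun w => 1 + w) (fun w => 1 - w) w).
- exact: subr1_neq0.
- exact: (holD (hol_cst 1 w) (hol_id w)).
- exact: (holB (hol_cst 1 w) (hol_id w)).
Qed.

(** [h] divided by the kernel becomes a bounded function on the disc, whose
    dilations extend holomorphically to larger discs. *)
Lemma closed_kern_bounded p Z d h B : 1 <= p -> 0 < d -> closed_subspace p Z ->
  (forall n, Z (e_ p n)) -> hol_Pi h ->
  (forall z, 0 < Re z -> cmod (h z) <= B * cmod (kern p 1 z)) ->
  Z (shift_by d h).
Proof.
move=> p1 d0 cZ Ze hh hB; have p0 : 0 < p by lra.
have r1 : 0 < Re (1 : C) by exact: ltr01.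
have kn z : 0 < Re z -> kern p 1 z != 0 by exact: kern_neq0.
have B0 : 0 <= B.
  have := hB 1 r1; have : 0 < cmod (kern p 1 1) by rewrite cmod_gt0 kn.
  by move=> m0 hm; have := le_trans (cmod_ge0 _) hm; rewrite pmulr_lge0.
have ah : in_hardy p h by split => //; exists (B `^ p * pi); exact: hp_le_kern.
pose G w := h (cayinv w) / kern p 1 (cayinv w).
have hG w : cmod w < 1 -> hol G w.
  move=> w1; have c0 := Re_cayinv w1.
  apply: (@hol_div _ (fun w => h (cayinv w)) (fun w => kern p 1 (cayinv w)) w).
  - exact: kn.
  - by apply: (@hol_comp _ cayinv h w); [exact: hol_cayinv|exact: hh].
  - apply: (@hol_comp _ cayinv (kern p 1) w); first exact: hol_cayinv.
    exact: hol_kern.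
have BG w : cmod w < 1 -> cmod (G w) <= B.
  move=> w1; have c0 := Re_cayinv w1.
  by rewrite cmodM cmodV ler_pdivrMr ?cmod_gt0 ?kn// hB.
pose r (n : nat) : R := 1 - n.+2%:R^-1.
have rP n : 0 < r n < 1.
  have h1 : (n.+2%:R : R)^-1 <= 2^-1 by rewrite lef_pV2 ?posrE// ler_nat.
  have h2 : 0 < (n.+2%:R : R)^-1 by rewrite invr_gt0.
  by rewrite /r; move: (_^-1) h1 h2 => q h1 h2; apply/andP; split; lra.
pose N n w := G ((r n)%:C * w).
have rw n w : cmod w < (r n)^-1 -> cmod ((r n)%:C * w) < 1.
  have /andP[a b] := rP n => wr.
  by rewrite cmodM cmod_real (gtr0_norm a) mulrC -ltr_pdivlMr// mul1r.
have r_1 n w : cmod w < 1 -> cmod w < (r n)^-1.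
  have /andP[a b] := rP n => w1; apply: lt_trans w1 _.
  by rewrite invf_gt1.
have hN n : holo_disc (N n) 0 (r n)^-1.
  move=> w; rewrite subr0 => /rw wr.
  apply: (@hol_comp _ (fun w => (r n)%:C * w) G w); last exact: hG.
  exact: (holM (hol_cst _ w) (hol_id w)).
have BN n w : cmod w < (r n)^-1 -> cmod (N n w) <= B by move=> /rw; exact: BG.
have aN n : in_hardy p (disc_fun p (N n)).
  apply: (@in_hardy_disc_fun _ _ _ B) => //.
    by move=> w w1; apply: hN; exact: r_1.
  by move=> w w1; apply: BN; exact: r_1.
pose u n z := h z - disc_fun p (N n) z.
have kD n z : 0 < Re z -> cmod (u n z) <= 2 * B * cmod (kern p 1 z).
  move=> z0; apply: le_trans (cmodD _ _) _; rewrite cmodN.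
  have := hB _ z0; have : cmod (disc_fun p (N n) z) <= B * cmod (kern p 1 z).
    by rewrite cmodM ler_wpM2r// BN// r_1// cmod_cay.
  by lra.
pose D y := (2 * B) `^ p * lpow p (kern p 1) d y.
have ck : continuous (lpow p (kern p 1) d) := continuous_lpow p0 (hol_kern r1) d0.
apply: (cZ.2 _ (in_hardy_shift (ltW d0) ah)) => e e0.
have [n Hn] : exists n, hp_le p (shift_by d (u n)) e.
  apply: (@line_approx _ p d u D e p1 d0 _ _ _ _ _ e0).
  - by move=> n; exact: (in_hardyB p0 ah (aN n)).
  - by move=> y; apply: cvgM; [exact: cvg_cst|exact: ck].
  - move=> n y; rewrite /D /lpow -powRM ?mulr_ge0//.
    by apply: (le_powR (ltW p0) (cmod_ge0 _)); exact: kD.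
  - have k0 y : 0 <= lpow p (kern p 1) d y by exact: powR_ge0.
    rewrite /D (LintZ ck k0 (powR_ge0 _ _)).
    rewrite lte_mul_pinfty ?lee_fin ?powR_ge0//.
    exact: le_lt_trans (hp_kern p0 r1 d0) (ltry _).
  - move=> y; pose z : C := d +i* y; have z0 : 0 < Re z by [].
    have c1 := cmod_cay z0.
    have h1 : (fun n => (r n)%:C * cay z) @ \oo --> (cay z : C^o).
      apply/cvgC => e' e'0.
      have /cvgrPdist_lt/(_ _ e'0) := @cvg_harmonic R.
      apply: filterS => m; rewrite sub0r normrN /= => hm.
      have -> : (r m)%:C * cay z - cay z = (- m.+2%:R^-1)%:C * cay z.
        by rewrite /r rmorphB rmorphN rmorph1; ring.
      rewrite cmodM cmod_real normrN ger0_norm ?invr_ge0//.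
      apply: (@le_lt_trans _ _ (m.+2%:R^-1 * 1)).
        by rewrite ler_wpM2l ?invr_ge0// ltW.
      rewrite mulr1; apply: le_lt_trans hm; rewrite ger0_norm ?invr_ge0//.
      by rewrite lef_pV2 ?posrE// ler_nat.
    have h2 : (fun n => N n (cay z)) @ \oo --> (G (cay z) : C^o).
      exact: (cvg_comp _ _ h1 (hol_continuous (hG _ c1))).
    have h3 : (fun n => u n z) @ \oo --> (h z - G (cay z) * kern p 1 z : C^o).
      apply: (@cvgB C C^o); first exact: cvg_cst.
      by apply: (@cvgM C _ \oo); [exact: h2|exact: cvg_cst].
    have := cvgC_cmod h3; rewrite /G cayK// divfK ?kn// subrr cmod0.
    exact.
exists (shift_by d (disc_fun p (N n))); last exact: Hn.
have cZ' := closed_shift (ltW d0) cZ.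
apply: (closed_disc_fun p0 cZ' _ _ (hN n) (@BN n)).
  by move=> k; apply: (closed_shift_e p0 d0 cZ Ze); exact: in_hardy_e.
by have /andP[a b] := rP n; rewrite invf_gt1.
Qed.

End TotalityEnd.

Section TotalityConclusion.
Context {R : realType}.
Local Notation C := R[i].
Implicit Types (f g h N : C -> C) (z w a b : C) (p s x y B K d e : R).

(** A multiplier close to [1] for large [K], with the decay that makes a bounded
    function comparable to [kern p 1]. *)
Definition damp K z : C := (K%:C / (z + K%:C)) ^+ 2.

Lemma addK_neq0 K z : 0 < K -> 0 < Re z -> z + K%:C != 0.
Proof. by move=> K0 z0; apply: Re_gt0_neq0; rewrite reD /=; lra. Qed.

Lemma cmod_damp K z : 0 < K -> 0 < Re z -> cmod (damp K z) <= 1.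
Proof.
move=> K0 z0; rewrite cmodX cmodM cmodV cmod_real (gtr0_norm K0).
apply: exprn_ile1; first by rewrite divr_ge0// ltW.
rewrite ler_pdivrMr ?cmod_gt0 ?addK_neq0// mul1r.
by apply: le_trans (Re_cmod _); rewrite reD /=; lra.
Qed.

Lemma hol_damp K : 0 < K -> hol_Pi (damp K).
Proof.
move=> K0 z z0; apply: holX.
apply: (@hol_div _ (fun=> K%:C) (fun z => z + K%:C) z).
- exact: addK_neq0.
- exact: hol_cst.
- exact: hol_add.
Qed.

Lemma damp_kern p K z : 1 <= p -> 1 <= K -> 0 < Re z ->
  cmod (damp K z) <= K ^+ 2 * cmod (kern p 1 z).
Proof.
move=> p1 K1 z0; have K0 : 0 < K by lra.
have m1 : 1 <= cmod (z + 1) by apply: le_trans (Re_cmod _); rewrite reD /=; lra.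
have mK : cmod (z + 1) <= cmod (z + K%:C).
  rewrite -(ler_pXn2r (n := 2)) ?nnegrE// !cmod_sqr !reD !imD /=.
  by nra.
rewrite cmodX cmodM cmodV cmod_real (gtr0_norm K0) expr_div_n.
rewrite ler_wpM2l ?sqr_ge0//.
rewrite /kern conjc_1 cmodV cmod_cpow.
rewrite lef_pV2 ?posrE ?exprn_gt0 ?powR_gt0//; try by lra.
apply: (@le_trans _ _ (cmod (z + 1) ^+ 2)); last first.
  by apply: lerXn2r; rewrite ?nnegrE.
rewrite -powR_mulrn//; apply: ler_powR => //.
by rewrite ler_pdivrMr; [lra|lra].
Qed.

Lemma damp_cvg z : 0 < Re z ->
  (fun n => damp n.+1%:R z) @ \oo --> (1 : C^o).
Proof.
move=> z0; have h : (fun n => (n.+1%:R : R)%:C / (z + (n.+1%:R)%:C)) @ \oo --> (1 : C^o).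
  apply/cvgC => e e0.
  have m0 : 0 < cmod z by rewrite cmod_gt0 Re_gt0_neq0.
  have em : 0 < e / cmod z by rewrite divr_gt0.
  have /cvgrPdist_lt/(_ _ em) := @cvg_harmonic R.
  apply: filterS => n; rewrite sub0r normrN /= => hn.
  have k0 : 0 < n.+1%:R :> R by [].
  have kn := addK_neq0 k0 z0; rewrite ger0_norm ?invr_ge0// in hn.
  set k : R := n.+1%:R in k0 kn hn *.
  have -> : k%:C / (z + k%:C) - 1 = - z / (z + k%:C).
    by apply: (mulIf kn); rewrite mulrBl !divfK// mul1r opprD addrCA subrr addr0.
  rewrite cmodM cmodN cmodV.
  have kz : k <= cmod (z + k%:C).
    by apply: le_trans (Re_cmod _); rewrite reD /=; lra.
  apply: (@le_lt_trans _ _ (cmod z * k^-1)).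
    rewrite ler_wpM2l// lef_pV2 ?posrE//; exact: lt_le_trans kz.
  by rewrite mulrC -ltr_pdivlMr.
have := @cvgM C _ \oo _ _ _ _ _ h h; rewrite mulr1; exact.
Qed.

(** The inner translation makes [f] bounded, as damping requires; the outer one
    leaves room for a line on which dilations converge. *)
Lemma closed_shift_twice p Z d f : 1 <= p -> 0 < d -> closed_subspace p Z ->
  (forall n, Z (e_ p n)) -> in_hardy p f -> Z (shift_by d (shift_by d f)).
Proof.
move=> p1 d0 cZ Ze af; have p0 : 0 < p by lra.
have [hf [B HB]] := af.
have asf := in_hardy_shift (ltW d0) (in_hardy_shift (ltW d0) af).
apply: (cZ.2 _ asf) => e e0.
pose psi (n : nat) z := f z * damp n.+1%:R z.
have k0 (n : nat) : 0 < n.+1%:R :> R by [].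
have hpsi n : hol_Pi (psi n).
  by move=> z z0; exact: (holM (hf z z0) (hol_damp (k0 n) z0)).
have psi_le n z : 0 < Re z -> cmod (psi n z) <= cmod (f z).
  by move=> z0; rewrite cmodM ler_piMr// cmod_damp.
have apsi n : in_hardy p (psi n).
  split; first exact: hpsi.
  exists B => x x0; apply: le_trans (HB x x0).
  apply: ge0_le_integral_nomeas => y _; rewrite lee_fin ?powR_ge0//.
  by apply: (le_powR (ltW p0) (cmod_ge0 _)); exact: psi_le.
pose u n z := f z - psi n z.
pose t := d + d; have t0 : 0 < t by rewrite /t; lra.
pose D y := 2 `^ p * lpow p f t y.
have cf : continuous (lpow p f t) := continuous_lpow p0 hf t0.
have [n Hn] : exists n, hp_le p (shift_by t (u n)) e.
  apply: (@line_approx _ p t u D e p1 t0 _ _ _ _ _ e0).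
  - by move=> n; exact: (in_hardyB p0 af (apsi n)).
  - by move=> y; apply: cvgM; [exact: cvg_cst|exact: cf].
  - move=> n y; rewrite /D /lpow -(powRM _ (ler0n _ 2) (cmod_ge0 _)).
    apply: (le_powR (ltW p0) (cmod_ge0 _)).
    apply: le_trans (cmodD _ _) _; rewrite cmodN.
    by have := psi_le n (t +i* y) t0; lra.
  - have l0 y : 0 <= lpow p f t y by exact: powR_ge0.
    rewrite /D (LintZ cf l0 (powR_ge0 _ _)).
    rewrite lte_mul_pinfty ?lee_fin ?powR_ge0//.
    exact: le_lt_trans (HB t t0) (ltry _).
  - move=> y; pose z : C := t +i* y; have z0 : 0 < Re z by [].
    have h3 : (fun n => u n z) @ \oo --> (f z - f z * 1 : C^o).
      apply: (@cvgB C C^o); first exact: cvg_cst.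
      by apply: (@cvgM C _ \oo); [exact: cvg_cst|exact: damp_cvg].
    by have := cvgC_cmod h3; rewrite mulr1 subrr cmod0; exact.
exists (shift_by d (shift_by d (psi n))); last first.
  apply: eq_hp_le Hn => z z0; rewrite /shift_by /u.
  by rewrite -!addrA -rmorphD.
have [M M0 HM] := hardy_bounded p1 hf HB d0.
pose K : R := n.+1%:R; have K1 : 1 <= K by rewrite ler1n.
apply: (closed_kern_bounded (B := M * K ^+ 2) p1 d0 cZ Ze (hol_shift (ltW d0) (hpsi n))).
move=> z z0; have zd0 : 0 < Re (z + d%:C) by rewrite reD /=; lra.
rewrite /shift_by cmodM -mulrA; apply: ler_pM => //.
  by apply: HM; rewrite reD /=; lra.
apply: le_trans (damp_kern p1 K1 zd0) _; rewrite ler_wpM2l ?sqr_ge0//.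
rewrite /kern !cmodV !cmod_cpow conjc_1.
have m0 : 0 < cmod (z + 1) by rewrite cmod_gt0 addr1_neq0.
have mm : cmod (z + 1) <= cmod (z + d%:C + 1).
  rewrite -(ler_pXn2r (n := 2)) ?nnegrE// !cmod_sqr !reD !imD /=.
  by nra.
rewrite lef_pV2 ?posrE ?powR_gt0//; last exact: lt_le_trans mm.
by apply: le_powR => //; rewrite divr_ge0// ltW.
Qed.

(** Translation, damping, dilation in the disc and Taylor expansion are
    successive approximations in norm. *)
Theorem closed_total p Z f : 1 <= p -> closed_subspace p Z ->
  (forall n, Z (e_ p n)) -> in_hardy p f -> Z f.
Proof.
move=> p1 cZ Ze af; have p0 : 0 < p by lra.
have [hf [B HB]] := af.
apply: (cZ.2 _ af) => e e0; have [d d0 Hd] := shift_approx p1 hf HB e0.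
exists (shift_by d f); last exact: Hd.
have d20 : 0 < d / 2 by rewrite divr_gt0.
apply: (closed_eq p0 cZ (closed_shift_twice p1 d20 cZ Ze af)).
  exact: (in_hardy_shift (ltW d0) af).
move=> z z0; rewrite /shift_by -addrA -rmorphD; congr (f (z + _%:C)); by field.
Qed.

End TotalityConclusion.

(** * The Hardy norm and bounded operators *)

Section HardyNorm.
Context {R : realType}.
Local Notation C := R[i].
Implicit Types (f g phi psi : C -> C) (z w : C) (p x y B K M e : R).

Lemma hardy_norm_ge0 p f : (0 <= hardy_norm p f)%E.
Proof.
apply: (@le_trans _ _ (((pi^-1)%:E * Lint (lpow p f 1)) `^ p^-1)%E).
  exact: poweR_ge0.
by apply: ereal_sup_ubound; exists 1 => //=.
Qed.

Lemma hardy_norm_le p f M : 0 < p -> 0 <= M ->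
  (hardy_norm p f <= M%:E)%E <-> hp_le p f (M `^ p * pi).
Proof.
move=> p0 M0; have pi0 := pi_gt0 R.
have key x : (((pi^-1)%:E * Lint (lpow p f x)) `^ p^-1 <= M%:E)%E <->
    (Lint (lpow p f x) <= (M `^ p * pi)%:E)%E.
  have : (0 <= Lint (lpow p f x))%E by apply: Lint_ge0 => y; exact: powR_ge0.
  case: (Lint _) => [L| |] // L0; last first.
    by rewrite gt0_muley ?lte_fin ?invr_gt0// poweRyr ?invr_eq0 ?gt_eqF.
  rewrite lee_fin in L0; rewrite -EFinM poweR_EFin !lee_fin.
  have q0 : 0 <= pi^-1 * L by rewrite mulr_ge0// invr_ge0 ltW.
  rewrite -ler_pdivrMr// mulrC; split => h.
    have := le_powR (ltW p0) (powR_ge0 _ _) h.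
    by rewrite powRVK// mulrC.
  rewrite -(powRKV p0 M0); apply: le_powR => //; first by rewrite invr_ge0 ltW.
  by rewrite mulrC.
split.
  move=> h x x0; apply/key; apply: le_trans h.
  by apply: ereal_sup_ubound; exists x.
by move=> H; apply: ge_ereal_sup => _ [x /= x0 <-]; apply/key; exact: H.
Qed.

Lemma HardyP p f : 0 < p -> Hardy p f <-> in_hardy p f.
Proof.
move=> p0; have pi0 := pi_gt0 R; rewrite /Hardy; split => -[/HolP hf].
  move=> fin; split=> //; have n0 := hardy_norm_ge0 p f.
  exists (fine (hardy_norm p f) `^ p * pi); apply/hardy_norm_le => //.
    by rewrite fine_ge0.
  by rewrite fineK// ge0_fin_numE.
case=> B HB; split; first exact/HolP.
have B0 := hp_le_ge0 HB.
apply: le_lt_trans (ltry ((B / pi) `^ p^-1)).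
apply/hardy_norm_le => //; first exact: powR_ge0.
by rewrite powRVK ?divfK ?gt_eqF// divr_ge0// ltW.
Qed.

Lemma bounded_hp p (T : (C -> C) -> (C -> C)) : 0 < p ->
  bounded_linear_operator p T ->
  exists2 K, 0 <= K & forall phi B, hol_Pi phi -> hp_le p phi B -> hp_le p (T phi) (K * B).
Proof.
move=> p0 [_ _ _ [M HM]]; have pi0 := pi_gt0 R.
exists (`|M| `^ p) => [|phi B hphi HB]; first exact: powR_ge0.
have B0 := hp_le_ge0 HB; pose b := (B / pi) `^ p^-1.
have b0 : 0 <= b by exact: powR_ge0.
have BE : B = b `^ p * pi.
  by rewrite powRVK ?divfK ?gt_eqF// divr_ge0// ltW.
have Hphi : Hardy p phi by apply/HardyP => //; split => //; exists B.
have nb : (hardy_norm p phi <= b%:E)%E by apply/hardy_norm_le => //; rewrite -BE.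
rewrite BE mulrA -powRM//; apply/hardy_norm_le => //; first by rewrite mulr_ge0.
apply: le_trans (HM _ Hphi) _; rewrite EFinM.
apply: (@le_trans _ _ (`|M|%:E * hardy_norm p phi)%E).
  by apply: lee_wpmul2r; [exact: hardy_norm_ge0|rewrite lee_fin ler_norm].
by apply: lee_wpmul2l => //; rewrite lee_fin.
Qed.

Lemma in_hardyDZ p (c : C) f g : 0 < p -> in_hardy p f -> in_hardy p g -> in_hardy p (fun z => c * f z + g z).
Proof.
move=> p0 [hf [B HB]] [hg [K HK]].
have hcf : hol_Pi (fun z => c * f z).
  by move=> z z0; exact: (holM (hol_cst c z) (hf z z0)).
split; first by move=> z z0; exact: (holD (hcf z z0) (hg z z0)).
by eexists; apply: (hp_leD p0 hcf hg (hp_leZ c p0 hf HB) HK).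
Qed.

Lemma near_Pi z : 0 < Re z -> \forall w \near (z : C^o), 0 < Re w.
Proof.
move=> z0; apply/nbhsC; exists (Re z) => // w wz.
by have := normRe_cmod (w - z); rewrite reD reN ler_norml => /andP[]; lra.
Qed.

(** For fixed [z] both sides are continuous functionals of [phi], so they agree
    on a closed subspace. *)
Lemma eval_total p (T : (C -> C) -> (C -> C)) (F : C -> C) z : 1 <= p ->
  bounded_linear_operator p T -> 0 < Re z -> 0 < Re (F z) ->
  (forall n, T (e_ p n) z = e_ p n (F z)) ->
  forall phi, in_hardy p phi -> T phi z = phi (F z).
Proof.
move=> p1 hT z0 Fz0 He phi aphi; have p0 : 0 < p by lra.
have [K K0 HK] := bounded_hp p0 hT; have [T1 _ T3 _] := hT.
have Tlin (a b : C) f g : in_hardy p f -> in_hardy p g ->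
    T (fun z => a * f z + b * g z) z = a * T f z + b * T g z.
  move=> /(HardyP _ p0) hf /(HardyP _ p0) hg.
  by apply: (T3 a b _ _ hf hg); rewrite inE.
pose Z f := in_hardy p f /\ T f z = f (F z).
suff : Z phi by case.
apply: (closed_total p1 _ _ aphi); last first.
  by move=> n; split; [exact: in_hardy_e|exact: He].
split.
  move=> c f g [af fE] [ag gE]; split; first exact: in_hardyDZ.
  have := Tlin c 1 _ _ af ag; rewrite mul1r.
  by under eq_fun do rewrite mul1r; rewrite fE gE.
move=> f af H; split => //; apply/eqP; rewrite -subr_eq0 -cmod_eq0 eq_le cmod_ge0 andbT.
pose c := 2 `^ p * (2 `^ p * (2 / Re z) * K + 2 `^ p * (2 / Re (F z))).
have c0 : 0 <= c.
  have q0 : 0 <= 2 `^ p :> R by exact: powR_ge0.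
  have i1 : 0 <= 2 / Re z by rewrite divr_ge0// ltW.
  have i2 : 0 <= 2 / Re (F z) by rewrite divr_ge0// ltW.
  exact: (mulr_ge0 q0 (addr_ge0 (mulr_ge0 (mulr_ge0 q0 i1) K0) (mulr_ge0 q0 i2))).
suff le e : 0 < e -> cmod (T f z - f (F z)) `^ p <= c * e.
  have m0 : cmod (T f z - f (F z)) `^ p <= 0.
    apply/ler_addgt0Pl => e e0; rewrite addr0.
    have d0 : 0 < e / (c + 1) by rewrite divr_gt0// ltr_wpDl.
    apply: le_trans (le _ d0) _; rewrite mulrA ler_pdivrMr ?ltr_wpDl//.
    by rewrite mulrC ler_pM2l//; lra.
  rewrite leNgt; apply/negP => gt0; move: m0; rewrite leNgt => /negP; apply.
  exact: powR_gt0.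
move=> e0; have [g [ag gE] Hg] := H e e0.
have afg := in_hardyB p0 af ag.
have TE : T f z - f (F z) = T (fun z => f z - g z) z + - (f (F z) - g (F z)).
  have := Tlin 1 (-1) _ _ af ag; rewrite mul1r mulN1r gE.
  have -> : (fun z => 1 * f z + -1 * g z) = fun z => f z - g z.
    by apply/funext => w; rewrite mul1r mulN1r.
  by move=> ->; ring.
rewrite TE; apply: le_trans (cmod_le_powD _ _ (ltW p0)) _; rewrite cmodN.
have hTfg : in_hardy p (T (fun z => f z - g z)).
  by apply/(HardyP _ p0); apply: T1; exact/(HardyP _ p0).
have b1 := point_bound p1 hTfg.1 z0 (HK _ _ afg.1 Hg).
have b2 := point_bound p1 afg.1 Fz0 Hg.
rewrite /c -mulrA ler_wpM2l ?powR_ge0// mulrDl.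
by apply: lerD => //; rewrite -mulrA.
Qed.

End HardyNorm.

(** * Symbols of composition operators and their angular derivative *)

Section Symbol.
Context {R : realType}.
Local Notation C := R[i].
Implicit Types (f g G F phi psi u : C -> C) (z w v : C) (p x y B K M e : R).

Lemma kern1_cpow p w : 0 < Re w -> kern p 1 w = cpow (w + 1) (- (2 / p)).
Proof. by move=> w0; rewrite /kern conjc_1 cpowV// addr1_neq0. Qed.

Lemma Arg_kern1_bound p w : 1 <= p -> 0 < Re w -> `|- (2 / p) * Arg (w + 1)| < pi.
Proof.
move=> p1 w0; have w10 : 0 < Re (w + 1) by rewrite reD /=; lra.
have p0 : 0 < p by lra.
have : `|Arg (w + 1)| < pi / 2 by rewrite ltr_norml Arg_bound.
have s0 : 0 <= 2 / p by rewrite divr_ge0// ltW.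
have s2 : 2 / p <= 2 by rewrite ler_pdivrMr//; lra.
rewrite normrM normrN (ger0_norm s0) => h.
apply: le_lt_trans (ler_wpM2r (normr_ge0 _) s2) _; lra.
Qed.

Lemma cpow_kern1 p w : 1 <= p -> 0 < Re w -> cpow (kern p 1 w) (p / 2) = (w + 1)^-1.
Proof.
move=> p1 w0; have n0 := addr1_neq0 w0; have p0 : p != 0 by rewrite gt_eqF//; lra.
rewrite kern1_cpow// cpow_cpow ?Arg_kern1_bound//.
have -> : - (2 / p) * (p / 2) = - 1%:R by field.
by rewrite -cpowV// cpow_nat// expr1.
Qed.

Lemma kern1_dom p w : 1 <= p -> 0 < Re w -> cpow_dom (p / 2) (kern p 1 w).
Proof.
move=> p1 w0; have n0 := addr1_neq0 w0; have b := Arg_kern1_bound p1 w0.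
have w10 : 0 < Re (w + 1) by rewrite reD /=; lra.
have AE : Arg (kern p 1 w) = - (2 / p) * Arg (w + 1) by rewrite kern1_cpow// Arg_cpow.
split.
- by apply: kern_neq0 w0; exact: ltr01.
- by rewrite AE.
- have p0 : 0 < p by lra.
  have s0 : 0 <= 2 / p by rewrite divr_ge0// ltW.
  rewrite AE normrM normrN (ger0_norm s0).
  have -> : p / 2 * (2 / p * `|Arg (w + 1)|) = `|Arg (w + 1)| by field; rewrite gt_eqF.
  have : `|Arg (w + 1)| < pi / 2 by rewrite ltr_norml Arg_bound.
  by have := pi_gt0 R; lra.
Qed.

(** The membership in [cpow_dom] is what makes the inverse power recover [v]. *)
Lemma kern1_symbol p v : 1 <= p -> cpow_dom (p / 2) v ->
  0 < Re ((cpow v (p / 2))^-1 - 1) -> kern p 1 ((cpow v (p / 2))^-1 - 1) = v.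
Proof.
move=> p1 [v0 vpi vp] F0; have p0 : 0 < p by lra.
rewrite kern1_cpow// subrK cpowV// cpow_cpow//; last first.
  by rewrite mulNr normrN normrM ger0_norm// divr_ge0// ltW.
have -> : - (p / 2) * - (2 / p) = 1%:R by field; rewrite gt_eqF.
by rewrite cpow_nat.
Qed.

Lemma cay_symbol (c : C) : c != 0 -> cay (c^-1 - 1) = 1 - 2 * c.
Proof. by move=> c0; rewrite /cay subrK; field. Qed.

(** Evaluating [T] on the Cauchy kernel at [G z] turns the growth estimate for
    Hardy functions into a lower bound for [Re (G z)]. *)
Lemma composition_Re_bound p (T : (C -> C) -> (C -> C)) G : 1 <= p ->
  bounded_linear_operator p T -> (forall z, 0 < Re z -> 0 < Re (G z)) ->
  (forall phi, in_hardy p phi -> forall z, 0 < Re z -> T phi z = phi (G z)) ->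
  exists2 c : R, 0 < c & forall z, 0 < Re z -> c * Re z <= Re (G z).
Proof.
move=> p1 hT G0 TG; have p0 : 0 < p by lra.
have [K K0 HK] := bounded_hp p0 hT; have [T1 _ _ _] := hT.
have pi0 := pi_gt0 R; have q0 : 0 <= 2 `^ p :> R by exact: powR_ge0.
pose Q := 8 * (2 `^ p * K * pi) + 1.
have Q0 : 0 < Q by rewrite ltr_wpDl// !mulr_ge0// ltW.
exists Q^-1; first by rewrite invr_gt0.
move=> z z0; pose a := G z; have a0 : 0 < Re a by exact: G0.
have Hk := hp_kern p0 a0.
have ak : in_hardy p (kern p a) by split; [exact: hol_kern|exists (pi / Re a)].
have hTk : in_hardy p (T (kern p a)).
  by apply/(HardyP _ p0); apply: T1; exact/(HardyP _ p0).
have := point_bound p1 hTk.1 z0 (HK _ _ ak.1 Hk).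
rewrite TG// cmod_kern// -/a.
have -> : a + conjc a = (2 * Re a)%:C.
  by apply: complex_ext; case: (a) => x y /=; rewrite ?subrr//; ring.
rewrite cmod_real gtr0_norm ?mulr_gt0// => H.
rewrite mulrC ler_pdivrMr//.
have n1 : Re a != 0 by rewrite gt_eqF.
have n2 : Re z != 0 by rewrite gt_eqF.
have w0 : 0 <= 4 * Re a ^+ 2 * Re z by rewrite !mulr_ge0 ?sqr_ge0// ltW.
have := ler_wpM2l w0 H.
have -> : 4 * Re a ^+ 2 * Re z * ((2 * Re a) ^+ 2)^-1 = Re z by field.
have -> : 4 * Re a ^+ 2 * Re z * (2 `^ p * (2 / Re z) * (K * (pi / Re a))) =
   Re a * (8 * (2 `^ p * K * pi)) by field; rewrite n1 n2.
have -> : Re a * Q = Re a * (8 * (2 `^ p * K * pi)) + Re a by rewrite /Q; ring.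
by move/le_trans; apply; rewrite lerDl ltW.
Qed.

Lemma cmod_conjD (u v : C) : cmod u <= cmod (u + conjc v) + cmod v.
Proof.
have := cmodD (u + conjc v) (- conjc v); rewrite addrK cmodN.
by rewrite cmodJ.
Qed.

Lemma cay_defect z : 0 < Re z ->
  (1 - cmod (cay z) ^+ 2) * cmod (z + 1) ^+ 2 = 4 * Re z.
Proof.
move=> z0; have n0 := addr1_neq0 z0.
have m0 : cmod (z + 1) != 0 by rewrite cmod_eq0.
rewrite /cay cmodM cmodV mulrBl mul1r -exprMn mulfVK//.
by rewrite !cmod_sqr !reD !imD !reN !imN /=; ring.
Qed.

(** Harnack's inequality in the disc, transported by the Cayley map that sends
    the origin to [z0]. For [z] as large as required, [z0] is absorbed into the
    factor [8]. *)
Lemma Harnack_Pi g z0 z : hol_Pi g -> (forall z, 0 < Re z -> 0 <= Re (g z)) ->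
  0 < Re z0 -> 0 < Re z -> `|Im z0| + Re z0 <= cmod z ->
  cmod (g z) <= cmod (g z0) + 8 * (Re (g z0) / Re z0) * (cmod z ^+ 2 / Re z).
Proof.
move=> hg g0 z00 z0' zbig; set x0 := Re z0 in z00 zbig *.
pose b : C := 0 +i* Im z0.
have x0n : (x0%:C : C) != 0 by apply: Re_gt0_neq0.
pose m w := x0%:C * cayinv w + b.
have Rem w : cmod w < 1 -> 0 < Re (m w).
  move=> w1; rewrite reD reM /= mul0r subr0 addr0.
  by rewrite mulr_gt0// Re_cayinv.
have hh : holo_disc (fun w => g (m w)) 0 1.
  move=> w; rewrite subr0 => w1.
  apply: (@hol_comp _ m g w); last by apply: hg; exact: Rem.
  apply: holD; last exact: hol_cst.
  by apply: holM; [exact: hol_cst|exact: hol_cayinv].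
have hpos w : cmod (w - 0) < 1 -> 0 <= Re (g (m w)).
  by rewrite subr0 => w1; apply: g0; exact: Rem.
pose zeta := (z - b) / x0%:C.
have Rez : Re zeta = Re z / x0.
  have -> : zeta = ((Re z / x0) +i* ((Im z - Im z0) / x0)).
    apply: (mulIf x0n); rewrite divfK//.
    have xn : x0 != 0 by rewrite gt_eqF.
    apply: complex_ext.
      by rewrite reM /= reD reN /= mulr0 !subr0 divfK.
    by rewrite imM /= imD imN /= mulr0 add0r divfK.
  by [].
have zeta0 : 0 < Re zeta by rewrite Rez divr_gt0.
pose w := cay zeta; have w1 : cmod w < 1 by exact: cmod_cay.
have mw : m w = z by rewrite /m /w cayK// mulrC divfK// subrK.
have m0 : m 0 = z0.
  rewrite /m /cayinv addr0 subr0 divr1 mulr1.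
  by rewrite /b /x0; case: (z0) => u v; apply: complex_ext; rewrite /= ?addr0 ?add0r.
pose r := (1 + cmod w) / 2.
have rP : 0 < r < 1.
  by have := cmod_ge0 w; rewrite /r => ?; apply/andP; split; lra.
have wr : cmod (w - 0) < r by rewrite subr0 /r; lra.
have := Harnack rP wr hh hpos; rewrite subr0 m0 mw => H.
apply: le_trans (cmod_conjD _ (g z0)) _; rewrite addrC lerD2l.
apply: le_trans H _.
have g00 : 0 <= Re (g z0) by apply: g0.
have d0 : 0 < 1 - cmod w by lra.
have rE : r / (r - cmod w) <= 4 / (1 - cmod w ^+ 2).
  have -> : r / (r - cmod w) = (1 + cmod w) / (1 - cmod w).
    by rewrite /r; field; rewrite !gt_eqF//; lra.
  have c0 := cmod_ge0 w.
  have D0 : 0 < 1 - cmod w ^+ 2 by rewrite subr_gt0 expr_lt1.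
  rewrite ler_pdivlMr// mulrAC ler_pdivrMr//.
  rewrite -subr_ge0.
  have -> : 4 * (1 - cmod w) - (1 + cmod w) * (1 - cmod w ^+ 2) =
      (1 - cmod w) * (4 - (1 + cmod w) ^+ 2) by ring.
  by apply: mulr_ge0; [exact: ltW|nra].
have zn := addr1_neq0 zeta0.
have mz0 : 0 < cmod (zeta + 1) by rewrite cmod_gt0.
have dE : 4 / (1 - cmod w ^+ 2) = cmod (zeta + 1) ^+ 2 / Re zeta.
  have E := cay_defect zeta0; rewrite -/w in E.
  have D0 : 0 < 1 - cmod w ^+ 2 by rewrite subr_gt0 expr_lt1.
  have Dn : 1 - cmod w ^+ 2 != 0 by rewrite gt_eqF.
  have Zn : Re zeta != 0 by rewrite gt_eqF.
  apply/eqP; rewrite (eqr_div _ _ Dn Zn); apply/eqP.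
  by rewrite -E mulrC.
rewrite dE in rE.
have zle : cmod (zeta + 1) <= 2 * cmod z / x0.
  rewrite ler_pdivlMr//.
  have -> : cmod (zeta + 1) * x0 = cmod ((zeta + 1) * x0%:C).
    by rewrite cmodM cmod_real gtr0_norm.
  have -> : (zeta + 1) * x0%:C = z + (x0%:C - b).
    by rewrite mulrDl mul1r divfK//; ring.
  apply: le_trans (cmodD _ _) _.
  have := cmod_le_ReIm (x0%:C - b).
  rewrite reD imD reN imN /= subr0 add0r normrN (gtr0_norm z00).
  by lra.
have sq : cmod (zeta + 1) ^+ 2 <= (2 * cmod z / x0) ^+ 2.
  by apply: lerXn2r; rewrite ?nnegrE// divr_ge0 ?mulr_ge0// ltW.
have rE2 : r / (r - cmod w) <= (2 * cmod z / x0) ^+ 2 / Re zeta.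
  apply: le_trans rE _; rewrite ler_wpM2r// invr_ge0 ltW//.
have := ler_wpM2l (mulr_ge0 (ler0n _ 2) g00 : 0 <= 2 * Re (g z0)) rE2.
move/le_trans; apply; rewrite Rez.
have -> : 2 * Re (g z0) * ((2 * cmod z / x0) ^+ 2 / (Re z / x0)) =
  8 * (Re (g z0) / x0) * (cmod z ^+ 2 / Re z) by field; rewrite !gt_eqF.
exact: lexx.
Qed.

End Symbol.

Section AngularDerivative.
Context {R : realType}.
Local Notation C := R[i].
Implicit Types (G g : C -> C) (z w : C) (c e : R).

(** Let [c] be the infimum of [Re (G z) / Re z]. Then [G z - c * z] has
    nonnegative real part, which at some point [z1] is small compared with
    [Re z1]; Harnack's inequality spreads this over every sector. *)
Lemma Julia_Caratheodory G (c0 : R) : hol_Pi G -> 0 < c0 ->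
  (forall z, 0 < Re z -> c0 * Re z <= Re (G z)) ->
  exists2 l : C, l != 0 & angular_lim (fun z => G z / z) l.
Proof.
move=> hG c00 HG.
pose A := [set Re (G z) / Re z | z in [set z : C | 0 < Re z]].
have A0 : A !=set0 by exists (Re (G 1) / Re (1 : C)), 1 => //=; exact: ltr01.
have Alb : lbound A c0.
  by move=> _ [z /= z0 <-]; rewrite ler_pdivlMr// HG.
have hA : has_inf A by split => //; exists c0.
pose c := inf A; have cc0 : c0 <= c by apply: lb_le_inf.
pose g z := G z - c%:C * z.
have hg : hol_Pi g.
  move=> z z0; exact: (holB (hG z z0) (holM (hol_cst _ z) (hol_id z))).
have Reg z : Re (g z) = Re (G z) - c * Re z.
  by rewrite reD reN reM /= mul0r subr0.
have g0 z : 0 < Re z -> 0 <= Re (g z).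
  move=> z0; rewrite Reg subr_ge0 -ler_pdivlMr//.
  by apply: (ge_inf hA.2); exists z.
exists c%:C; first by apply: Re_gt0_neq0; rewrite /=; lra.
move=> beta beta2 e e0; have [b0|b0] := leP beta 0.
  by exists 0 => z zb; have := normr_ge0 (Arg z); lra.
pose k := cos beta.
have k0 : 0 < k by apply: cos_gt0_pihalf; apply/andP; split; lra.
pose eta := e * k / 16; have eta0 : 0 < eta by rewrite divr_gt0// mulr_gt0.
have [_ [z1 /= z10 <-] Hz1] := inf_adherent eta0 hA.
exists (`|Im z1| + Re z1 + 2 * cmod (g z1) / e) => z zb Mz.
have [_ [kz zn]] := sector_Re zb beta2; rewrite -/k in kz.
have mz : 0 < cmod z by rewrite cmod_gt0.
have z0 : 0 < Re z by apply: lt_le_trans kz; exact: mulr_gt0.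
have q0 : 0 <= 2 * cmod (g z1) / e by rewrite divr_ge0 ?mulr_ge0// ltW.
have z1i := normr_ge0 (Im z1).
have zbig : `|Im z1| + Re z1 <= cmod z by lra.
have H := Harnack_Pi hg g0 z10 z0 zbig.
have gz1 : Re (g z1) / Re z1 <= eta.
  rewrite Reg mulrBl mulfK ?gt_eqF//; rewrite -/c in Hz1; lra.
have h1 : 2 * cmod (g z1) < e * cmod z.
  by rewrite -ltr_pdivrMl// mulrC; lra.
have h2 : 8 * (Re (g z1) / Re z1) * (cmod z ^+ 2 / Re z) <= 8 * eta * (cmod z / k).
  have y1 : 0 <= Re (g z1) / Re z1 by rewrite divr_ge0 ?g0// ltW.
  have y2 : 0 <= cmod z ^+ 2 / Re z by rewrite divr_ge0 ?sqr_ge0// ltW.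
  apply: (ler_pM (mulr_ge0 _ y1) y2) => //; first by rewrite ler_pM2l.
  rewrite ler_pdivrMr// mulrAC ler_pdivlMr// expr2 -mulrA ler_pM2l//.
  by rewrite mulrC.
have h3 : 8 * eta * (cmod z / k) = e * cmod z / 2.
  by rewrite /eta; field; rewrite gt_eqF.
have -> : G z / z - c%:C = g z / z by rewrite /g mulrBl mulfK.
rewrite cmodM cmodV ltr_pdivrMr//; lra.
Qed.

End AngularDerivative.

(** * The characterisation *)

Theorem theorem4p2 (R : realType) (p : R) (hp : 1 <= p)
    (T : (R[i] -> R[i]) -> (R[i] -> R[i]))
    (hT : bounded_linear_operator p T) :
  (composition_operator p T <->
     [/\ condition_a p T, condition_b p T & condition_c p T]) /\
  ([/\ condition_a p T, condition_b p T & condition_c p T] ->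
     forall phi : R[i] -> R[i], Hardy p phi ->
       {in Pi_plane, T phi =1 phi \o symbol p (T (e_ p 0))}).
Proof.
have p0 : 0 < p by lra.
have back : [/\ condition_a p T, condition_b p T & condition_c p T] ->
    forall phi : R[i] -> R[i], Hardy p phi ->
    {in Pi_plane, T phi =1 phi \o symbol p (T (e_ p 0))}.
  move=> [[dom0 [_ F0]] _ cT] phi /(HardyP _ p0) aphi z; rewrite inE => z0 /=.
  apply: (eval_total hp hT z0 (F0 z z0) _ aphi) => n.
  have Fz0 := F0 z z0; have D := dom0 z z0; have [u0 _ _] := D.
  rewrite cT ?inE// e_E// cay_symbol ?cpow_neq0//.
  by rewrite [kern _ _ _](kern1_symbol hp D Fz0) mulrC.
split=> //; split; last first.
  move=> abc; exists (symbol p (T (e_ p 0))); last exact: back.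
  by case: abc => -[].
move=> [G [/HolP hG G0] TG].
have TGa phi : in_hardy p phi -> forall z, 0 < Re z -> T phi z = phi (G z).
  by move=> /(HardyP _ p0) hphi z z0; apply: (TG _ hphi); rewrite inE.
have Te n z : 0 < Re z -> T (e_ p n) z = cay (G z) ^+ n * kern p 1 (G z).
  by move=> z0; rewrite (TGa _ (in_hardy_e n p0) z z0) e_E//; exact: G0.
have Te0 z : 0 < Re z -> T (e_ p 0) z = kern p 1 (G z).
  by move=> z0; rewrite Te// expr0 mul1r.
have SG z : 0 < Re z -> symbol p (T (e_ p 0)) z = G z.
  move=> z0; have Gz := G0 z z0.
  by rewrite /symbol Te0// (cpow_kern1 hp Gz) invrK addrK.
have hS : hol_Pi (symbol p (T (e_ p 0))).
  move=> z z0; apply: (@eq_near_hol _ G); last exact: hG.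
  by apply: filterS (near_Pi z0) => w w0; rewrite SG.
split.
- split; first by move=> z z0; rewrite Te0//; apply: kern1_dom => //; exact: G0.
  split; first exact/HolP.
  by move=> z z0; have := G0 z z0; rewrite -(SG z z0).
- have [c c0 Hc] := composition_Re_bound hp hT G0 TGa.
  by apply: (Julia_Caratheodory hS c0) => z z0; rewrite SG// Hc.
- move=> n z; rewrite inE => z0; have Gz := G0 z z0.
  rewrite Te// Te0// cpow_kern1// mulrC; congr (_ * _ ^+ n).
  have n0 := addr1_neq0 Gz.
  by have := cay_symbol (invr_neq0 n0); rewrite invrK addrK.
Qed.
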